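(* Let $n\ge 2$ be an integer, let $D>0$ and $\tilde\beta>0$, and let $a_0,a_n,u_0,k\in\mathbb{R}$. Consider the reaction–convection–diffusion equation $$\frac{\partial u}{\partial t}+(a_0+a_nu^n)\frac{\partial u}{\partial x}=D\frac{\partial^2u}{\partial x^2}+\tilde\beta\, u(u-u_0)(k-u).$$ Then this equation has at most one isolated periodic (traveling) wave solution, in the sense explained in the context, in each of the following cases: (i) $0<u_0<k\le 2u_0$, for all integers $n\ge 2$; (ii) $-k<u_0<0$, for all integers $n\ge 2$; (iii) $k>0$ and $u_0<-k$, for all integers $n\ge 2$; (iv) $k>0$ and $u_0=-k$, for all even positive integers $n$.
   Context: Traveling waves $u(x,t)=u(\eta)$, $\eta=x-ct$ ($c$ the wave speed) satisfy $D u''=(-c+a_0+a_nu^n)u'-\tilde\beta u(u-u_0)(k-u)$. Set $\beta=\tilde\beta/D>0$ and write $\frac{a_0-c}{D}=\alpha_0\epsilon$, $\frac{a_n}{D}=\alpha_n\epsilon$ with $0<\epsilon\ll 1$ and real parameters $\alpha_0,\alpha_n$. This gives the planar system $$\frac{du}{d\eta}=y,\qquad \frac{dy}{d\eta}=\epsilon(\alpha_0+\alpha_nu^n)y-\beta u(u-u_0)(k-u),$$ whose $\epsilon=0$ version is the Hamiltonian system with $H(u,y)=\frac{y^2}{2}+\beta\left(-\frac{u^4}{4}+\frac{k+u_0}{3}u^3-\frac{ku_0}{2}u^2\right)$. In each case listed, the unperturbed system has a center (at $(u_0,0)$ in case (i), at $(0,0)$ in cases (ii)–(iv)) surrounded by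 a periodic annulus $\{\Gamma_h: H(u,y)=h,\ h\in(h_1,h_2)\}$ of closed level curves, where $(h_1,h_2)$ is maximal. An isolated periodic wave solution of the PDE corresponds to a limit cycle of the perturbed system; the claim ''at most one isolated periodic wave solution'' means that, for $\epsilon>0$ sufficiently small, at most one limit cycle of the perturbed system bifurcates from this periodic annulus. *)

(* Defs.v *)
From Stdlib Require Import Reals Arith.
From Coquelicot Require Import Coquelicot.
Open Scope R_scope.

Definition pt := (R * R)%type.
Definition pset := pt -> Prop.

Definition same_set (A B : pset) : Prop := forall p, A p <-> B p.
Definition subset (A B : pset) : Prop := forall p, A p -> B p.

Definition pert_rhs (n : nat) (beta u0 k alpha0 alphan eps : R) (u y : R) : R :=
  eps * (alpha0 + alphan * u ^ n) * y - beta * u * (u - u0) * (k - u).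

Definition is_solution (F : R -> R -> R) (u y : R -> R) : Prop :=
  forall t, is_derive u t (y t) /\ is_derive y t (F (u t) (y t)).

Definition periodic_solution (F : R -> R -> R) (u y : R -> R) : Prop :=
  is_solution F u y /\
  (exists T, 0 < T /\ forall t, u (t + T) = u t /\ y (t + T) = y t) /\
  (exists t, (u t, y t) <> (u 0, y 0)).

Definition orbit (u y : R -> R) : pset := fun p => exists t, p = (u t, y t).

Definition periodic_orbit (F : R -> R -> R) (G : pset) : Prop :=
  exists u y, periodic_solution F u y /\ same_set G (orbit u y).

Definition dist2 (p q : pt) : R :=
  sqrt ((fst p - fst q) ^ 2 + (snd p - snd q) ^ 2).

Definition limit_cycle (F : R -> R -> R) (G : pset) : Prop :=
  periodic_orbit F G /\
  exists delta, 0 < delta /\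
    forall G', periodic_orbit F G' ->
      (forall q, G' q -> exists p, G p /\ dist2 p q < delta) ->
      same_set G' G.

Definition compact2 (K : pset) : Prop :=
  (exists M, forall p, K p -> Rabs (fst p) <= M /\ Rabs (snd p) <= M) /\
  (forall (s : nat -> pt) (p : pt), (forall m, K (s m)) ->
     Un_cv (fun m => fst (s m)) (fst p) -> Un_cv (fun m => snd (s m)) (snd p) ->
     K p).

(* The periodic annulus of the unperturbed (Hamiltonian, eps = 0) system:
   the union of its closed orbits.  In each of the cases (i)-(iv) the
   potential has a single well, so every closed orbit surrounds the unique
   center and this union is exactly the maximal period annulus
   {Gamma_h : h in (h1,h2)}. *)
Definition period_annulus (n : nat) (beta u0 k : R) : pset :=
  fun p => exists G, periodic_orbit (pert_rhs n beta u0 k 0 0 0) G /\ G p.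

Definition theorem_cases (n : nat) (u0 k : R) : Prop :=
  (0 < u0 /\ u0 < k /\ k <= 2 * u0) \/
  (- k < u0 /\ u0 < 0) \/
  (0 < k /\ u0 < - k) \/
  (0 < k /\ u0 = - k /\ Nat.Even n).

(* Main.v *)
(** In suitable coordinates the system is [x' = y], [y' = eps F(x) y - V'(x)] with
    [V'(x) = beta x (m - x) (l + x)], [0 < m <= l] and [F] an affine function of [R0(x) = x^n] or
    [(l + x)^n].  Put [s = sign x * sqrt (2 V)] and use polar coordinates [s = r cos th],
    [y = - r sin th]: periodic orbits in the annulus become [2 pi]-periodic solutions of a scalar
    equation [dr/dth = eps q(th, r, eps)].  If there were two of them for arbitrarily small [eps],
    the averaged function [M(r) = int q(th, r, 0)] would have, up to [o(1)], a zero at which a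
    difference quotient vanishes.  But [M = alpha0 a + alphan b], where [b / a] has positive
    derivative: by a Chebyshev type argument this follows from the monotonicity in [s] of the
    value at [V' = 0] of the chord joining the points [(V', R0)] over [X(-s)] and [X(s)].  For
    powers of [x] these values satisfy a two-term recursion whose coefficients
    [X(s) + X(-s)] and [-X(s) X(-s)] are nonnegative and nondecreasing.  When
    [alpha0 = alphan = 0] the system is Hamiltonian and no periodic orbit is isolated. *)

Require Import Defs.
From Stdlib Require Import Reals Arith ZArith Lra Lia Psatz Classical IndefiniteDescription.
From Coquelicot Require Import Coquelicot.
Open Scope R_scope.

(** * Calculus *)

(** The isometry to the normal form puts the center at [0] and a nearest saddle at [m]; the other
    saddle is [- l]. The four cases are the ways in which [m <= l] can be arranged. When [m = l] the
    potential is even and the chord of an odd power vanishes identically, whence the parity in case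
    (iv). Differentiating [M] under the integral produces the derivative of the integrand, about
    which nothing is known. An integration by parts removes it: [M'] is the integral of the same
    function [k (r * cos t)] against [cos t ^ 2], where [M] has the weight [r * sin t ^ 2]. Two
    weights against one function is the situation that Chebyshev's argument handles. No return map
    is built, so its smoothness in [eps] is never at issue: two given solutions are subtracted from
    each other. For this the error in the difference of the two values of [M] must be proportional
    to the initial gap, not merely small. Hence the [r]-derivative of [q], and not only [q], has to
    be uniformly close to its value at [eps = 0]; this closeness holds on a compact range of radii
    inside the annulus. *)

Ltac der H :=
  match type of H with is_derive ?f ?t ?l =>
    let E := fresh in
    assert (E : Derive (fun x : R => f x) t = l) by exact (is_derive_unique _ _ _ H);
    rewrite ?E; clear E
  end.

Lemma is_derive_continuous (f : R -> R) (x l : R) : is_derive f x l -> continuous f x.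
Proof. intros H. apply (ex_derive_continuous f). now exists l. Qed.

Lemma is_derive_eq (f : R -> R) (x a b : R) : is_derive f x a -> a = b -> is_derive f x b.
Proof. now intros H <-. Qed.

Lemma is_derive_Rconst (c x : R) : is_derive (fun _ => c) x 0.
Proof. exact (is_derive_const c x). Qed.

Lemma is_derive_Rmult (f g : R -> R) (x a b : R) :
  is_derive f x a -> is_derive g x b ->
  is_derive (fun t => f t * g t) x (a * g x + f x * b).
Proof.
  intros Hf Hg. apply (is_derive_mult f g x a b Hf Hg). intros; apply Rmult_comm.
Qed.

Lemma is_derive_Rplus (f g : R -> R) (x a b : R) :
  is_derive f x a -> is_derive g x b -> is_derive (fun t => f t + g t) x (a + b).
Proof. exact (is_derive_plus f g x a b). Qed.

Lemma is_derive_Rminus (f g : R -> R) (x a b : R) :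
  is_derive f x a -> is_derive g x b -> is_derive (fun t => f t - g t) x (a - b).
Proof. exact (is_derive_minus f g x a b). Qed.

Lemma is_derive_Rcomp (f g : R -> R) (x a b : R) :
  is_derive f (g x) a -> is_derive g x b -> is_derive (fun t => f (g t)) x (a * b).
Proof.
  intros Hf Hg. eapply is_derive_eq; [exact (is_derive_comp f g x a b Hf Hg)|].
  apply Rmult_comm.
Qed.

Lemma MVT_derive (f f' : R -> R) (a b : R) :
  a <= b -> (forall t, a <= t <= b -> is_derive f t (f' t)) ->
  exists c, a <= c <= b /\ f b - f a = f' c * (b - a).
Proof.
  intros Hab H.
  destruct (MVT_gen f a b f') as [c [Hc E]].
  - intros x Hx. apply H. rewrite Rmin_left, Rmax_right in Hx by lra. lra.
  - intros x Hx. rewrite Rmin_left, Rmax_right in Hx by lra.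
    apply continuity_pt_filterlim, (is_derive_continuous f x (f' x)), H; lra.
  - rewrite Rmin_left, Rmax_right in Hc by lra. now exists c.
Qed.

Lemma derive_nonneg_incr (f f' : R -> R) (a b : R) :
  a <= b -> (forall t, a <= t <= b -> is_derive f t (f' t)) ->
  (forall t, a <= t <= b -> 0 <= f' t) -> f a <= f b.
Proof.
  intros Hab H H0. destruct (MVT_derive f f' a b Hab H) as [c [Hc E]].
  specialize (H0 c Hc). nra.
Qed.

Lemma derive_pos_incr (f f' : R -> R) (a b : R) :
  a < b -> (forall t, a <= t <= b -> is_derive f t (f' t)) ->
  (forall t, a <= t <= b -> 0 < f' t) -> f a < f b.
Proof.
  intros Hab H H0. destruct (MVT_derive f f' a b (Rlt_le _ _ Hab) H) as [c [Hc E]].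
  specialize (H0 c Hc). nra.
Qed.

Lemma derive_strict_incr (f f' : R -> R) (a b : R) :
  a < b -> (forall t, a <= t <= b -> is_derive f t (f' t)) ->
  (forall t, a <= t <= b -> 0 <= f' t) -> (forall t, a < t < b -> 0 < f' t) -> f a < f b.
Proof.
  intros Hab H H0 H1.
  apply Rle_lt_trans with (f (a + (b - a) / 3)).
  { apply (derive_nonneg_incr f f'); [lra| |]; intros; [apply H|apply H0]; lra. }
  apply Rlt_le_trans with (f (a + 2 * (b - a) / 3)).
  { apply (derive_pos_incr f f'); [lra| |]; intros; [apply H|apply H1]; lra. }
  apply (derive_nonneg_incr f f'); [lra| |]; intros; [apply H|apply H0]; lra.
Qed.

Lemma derive_zero_const (f : R -> R) :
  (forall t, is_derive f t 0) -> forall a b, f a = f b.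
Proof.
  assert (K : (forall t, is_derive f t 0) -> forall a b, a <= b -> f a = f b).
  { intros H a b Hab. destruct (MVT_derive f (fun _ => 0) a b Hab) as [c [Hc E]].
    - intros; apply H. - lra. }
  intros H a b. destruct (Rle_dec a b) as [L|L].
  - now apply K. - symmetry; apply K; auto; lra.
Qed.

Lemma derive_bound_lip (f f' : R -> R) (a b C : R) :
  a <= b -> (forall t, a <= t <= b -> is_derive f t (f' t)) ->
  (forall t, a <= t <= b -> Rabs (f' t) <= C) -> Rabs (f b - f a) <= C * (b - a).
Proof.
  intros Hab H H0. destruct (MVT_derive f f' a b Hab H) as [c [Hc E]].
  rewrite E, Rabs_mult, (Rabs_right (b - a)) by lra.
  apply Rmult_le_compat_r; [lra | auto].
Qed.

(** [d t * exp (- L * (t - a))] has derivative [(d' t - L * d t) * exp (- L * (t - a))], so it does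
    not increase. [h] is its negative, to fit the monotonicity lemma. *)
Lemma gronwall_growth (d d' : R -> R) (L a b : R) :
  a <= b -> (forall t, a <= t <= b -> is_derive d t (d' t)) ->
  (forall t, a <= t <= b -> d' t <= L * d t) ->
  d b <= d a * exp (L * (b - a)).
Proof.
  intros Hab H H0.
  set (h := fun t => - (d t * exp (- L * (t - a)))).
  assert (E : h a <= h b).
  { apply (derive_nonneg_incr h (fun t => - ((d' t - L * d t) * exp (- L * (t - a)))) a b Hab).
    - intros t Ht. unfold h. specialize (H t Ht).
      auto_derive.
      + now exists (d' t).
      + der H. unfold Rminus. ring.
    - intros t Ht. specialize (H0 t Ht).
      pose proof (exp_pos (- L * (t - a))). nra. }
  unfold h in E. replace (- L * (a - a)) with 0 in E by ring. rewrite exp_0 in E.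
  replace (- L * (b - a)) with (- (L * (b - a))) in E by ring. rewrite exp_Ropp in E.
  pose proof (exp_pos (L * (b - a))) as P.
  apply Rmult_le_reg_r with (/ exp (L * (b - a))).
  - now apply Rinv_0_lt_compat.
  - rewrite Rmult_assoc, Rinv_r by lra. lra.
Qed.

(** The growth estimate for the square of [d], with constant [2 * L], settles the times after [t0];
    the earlier ones follow by reversing time. *)
Lemma gronwall_zero (d d' : R -> R) (L t0 : R) :
  (forall t, is_derive d t (d' t)) -> (forall t, Rabs (d' t) <= L * Rabs (d t)) ->
  d t0 = 0 -> forall t, d t = 0.
Proof.
  assert (K : forall (d d' : R -> R) t0 t, t0 <= t ->
    (forall t, is_derive d t (d' t)) -> (forall t, Rabs (d' t) <= L * Rabs (d t)) ->
    d t0 = 0 -> d t = 0).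
  { clear. intros d d' t0 t Ht H H0 Z.
    assert (E : d t * d t <= (d t0 * d t0) * exp (2 * L * (t - t0))).
    { apply (gronwall_growth (fun t => d t * d t) (fun t => d' t * d t + d t * d' t)); auto.
      - intros s _. specialize (H s). auto_derive.
        + now repeat split; exists (d' s).
        + der H. ring.
      - intros s _. specialize (H0 s).
        assert (d' s * d s <= Rabs (d' s) * Rabs (d s)).
        { rewrite <- Rabs_mult. apply Rle_abs. }
        assert (Rabs (d s) * Rabs (d s) = d s * d s).
        { rewrite <- Rabs_mult. apply Rabs_right. nra. }
        pose proof (Rmult_le_compat_r _ _ _ (Rabs_pos (d s)) H0) as H3.
        rewrite Rmult_assoc, H2 in H3. lra. }
    rewrite Z in E. nra. }
  intros H H0 Z t. destruct (Rle_dec t0 t) as [G|G].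
  - now apply (K d d' t0).
  - pose proof (K (fun s => d (- s)) (fun s => - d' (- s)) (- t0) (- t)) as Q.
    simpl in Q. rewrite !Ropp_involutive in Q. apply Q; auto; [lra| |].
    + intros s. specialize (H (- s)). auto_derive.
      * now exists (d' (- s)).
      * der H. ring.
    + intros s. now rewrite Rabs_Ropp.
Qed.

(** Continuity of [g] at [z] comes first: [f] is strictly increasing, so [g y] is trapped between
    [g z - e'] and [g z + e'] as soon as [y] lies between the values of [f] there. The expansion of
    [f] at [g z] is then inverted. *)
Lemma is_derive_inverse (f f' g : R -> R) (a b z : R) :
  (forall x, a < x < b -> is_derive f x (f' x)) ->
  (forall x, a < x < b -> 0 < f' x) ->
  a < g z < b ->
  locally z (fun y => a < g y < b /\ f (g y) = y) ->
  is_derive g z (/ f' (g z)).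
Proof.
  intros Hd Hp Hz Hl.
  assert (Hinc : forall x y, a < x < b -> a < y < b -> x < y -> f x < f y).
  { intros x y Hx Hy Hxy. apply (derive_pos_incr f f'); auto; intros; [apply Hd|apply Hp]; lra. }
  pose proof (proj2 (locally_singleton _ _ Hl)) as Ez. cbv beta in Ez.
  assert (Hc : continuous g z).
  { intros P [e He].
    set (e' := Rmin (e / 2) (Rmin ((g z - a) / 2) ((b - g z) / 2))).
    assert (He' : 0 < e').
    { unfold e'. pose proof (cond_pos e). repeat apply Rmin_pos; lra. }
    assert (B : e' <= e / 2 /\ e' <= (g z - a) / 2 /\ e' <= (b - g z) / 2).
    { unfold e'. repeat split.
      - apply Rmin_l.
      - eapply Rle_trans; [apply Rmin_r|apply Rmin_l].
      - eapply Rle_trans; [apply Rmin_r|apply Rmin_r]. }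
    assert (L1 : f (g z - e') < z) by (rewrite <- Ez at 2; apply Hinc; lra).
    assert (L2 : z < f (g z + e')) by (rewrite <- Ez at 1; apply Hinc; lra).
    assert (Hd0 : 0 < Rmin (z - f (g z - e')) (f (g z + e') - z)) by (apply Rmin_pos; lra).
    destruct Hl as [d2 Hl].
    exists (mkposreal _ (Rmin_pos _ _ Hd0 (cond_pos d2))).
    intros y Hy. change (Rabs (y - z) < Rmin (Rmin (z - f (g z - e')) (f (g z + e') - z)) d2) in Hy.
    assert (Hy1 : Rabs (y - z) < Rmin (z - f (g z - e')) (f (g z + e') - z))
      by (eapply Rlt_le_trans; [apply Hy|apply Rmin_l]).
    assert (Hy2 : Rabs (y - z) < d2) by (eapply Rlt_le_trans; [apply Hy|apply Rmin_r]).
    assert (Hy3 : Rabs (y - z) < z - f (g z - e')) by (eapply Rlt_le_trans; [apply Hy1|apply Rmin_l]).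
    assert (Hy4 : Rabs (y - z) < f (g z + e') - z) by (eapply Rlt_le_trans; [apply Hy1|apply Rmin_r]).
    destruct (Hl y Hy2) as [R1 R2].
    apply Rabs_def2 in Hy3. apply Rabs_def2 in Hy4.
    apply He. change (Rabs (g y - g z) < e).
    assert (g y < g z + e').
    { apply Rnot_le_lt. intros C. destruct C as [C|C].
      - apply Hinc in C; lra.
      - rewrite C, R2 in Hy4. lra. }
    assert (g z - e' < g y).
    { apply Rnot_le_lt. intros C. destruct C as [C|C].
      - apply Hinc in C; lra.
      - rewrite <- C, R2 in Hy3. lra. }
    pose proof (cond_pos e). apply Rabs_def1; lra. }
  pose proof (Hp _ Hz) as Pz.
  split. { apply is_linear_scal_l. }
  intros x Hx. apply (is_filter_lim_locally_unique (V := R_NormedModule) z x) in Hx. subst x.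
  intros eps.
  set (l := f' (g z)) in *.
  (* With [u] the increment of [g] and [v] that of the argument, [eta <= l / 2] yields
     [l * Rabs u <= 2 * Rabs v]; the second bound then turns the error [eta * Rabs u] into
     [eps * l * Rabs v]. *)
  set (eta := Rmin (l / 2) (eps * (l * l) / 2)).
  assert (Heta : 0 < eta).
  { unfold eta. apply Rmin_pos; [lra|]. pose proof (cond_pos eps).
    apply Rdiv_lt_0_compat; [|lra]. apply Rmult_lt_0_compat; nra. }
  destruct (Hd _ Hz) as [_ Hf].
  specialize (Hf (g z) (fun P H => H) (mkposreal _ Heta)).
  apply Hc in Hf. 
  generalize (filter_and _ _ Hl Hf). apply filter_imp.
  intros y [[R1 R2] R3]. simpl in R3.
  change (Rabs (g y - g z - (y - z) * / l) <= eps * Rabs (y - z)).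
  change (Rabs (f (g y) - f (g z) - (g y - g z) * l) <= eta * Rabs (g y - g z)) in R3.
  rewrite R2, Ez in R3.
  set (u := g y - g z) in *. set (v := y - z) in *.
  assert (E1 : eta <= l / 2) by apply Rmin_l.
  assert (E2 : eta <= eps * (l * l) / 2) by apply Rmin_r.
  assert (T : l * Rabs u <= eta * Rabs u + Rabs v).
  { replace (l * Rabs u) with (Rabs (u * l)).
    2:{ rewrite Rabs_mult, (Rabs_right l) by lra. ring. }
    replace (u * l) with (v - (v - u * l)) by ring.
    eapply Rle_trans; [apply Rabs_triang|]. rewrite Rabs_Ropp. lra. }
  pose proof (Rabs_pos u). pose proof (Rabs_pos v).
  assert (T2 : l * Rabs u <= 2 * Rabs v) by nra.
  replace (u - v * / l) with (- ((v - u * l) * / l)) by (field; lra).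
  rewrite Rabs_Ropp, Rabs_mult, (Rabs_right (/ l)).
  2:{ apply Rle_ge, Rlt_le, Rinv_0_lt_compat; lra. }
  apply Rmult_le_reg_r with l; [lra|].
  rewrite Rmult_assoc, Rinv_l by lra. rewrite Rmult_1_r.
  eapply Rle_trans; [apply R3|].
  assert (eta * Rabs u <= eps * (l * l) / 2 * Rabs u) by nra.
  pose proof (cond_pos eps). 
  assert (eps * (l * l) / 2 * Rabs u <= eps * l / 2 * (2 * Rabs v)).
  { replace (eps * (l * l) / 2 * Rabs u) with (eps * l / 2 * (l * Rabs u)) by field.
    apply Rmult_le_compat_l; [|auto]. apply Rlt_le. apply Rdiv_lt_0_compat; nra. }
  lra.
Qed.

(** A slope bounded below by [c] makes [f] cover the whole line. This serves twice: to take the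
    angle as the new time along an orbit, and to recover the angle from a quadrature for the
    time. *)
Lemma global_inverse (f f' : R -> R) (c : R) :
  0 < c -> (forall t, is_derive f t (f' t)) -> (forall t, c <= f' t) ->
  exists g, (forall z, f (g z) = z) /\ (forall t, g (f t) = t) /\
    (forall z, is_derive g z (/ f' (g z))).
Proof.
  intros Hc Hd Hp.
  assert (Hinc : forall x y, x < y -> f x + c * (y - x) <= f y).
  { intros x y Hxy. destruct (MVT_derive f f' x y) as [d [Hd1 Hd2]]; [lra|auto|].
    specialize (Hp d). nra. }
  assert (Hcont : continuity f).
  { intros x. apply continuity_pt_filterlim, (is_derive_continuous f x (f' x)), Hd. }
  assert (Hs : forall z, exists t, f t = z).
  { intros z.
    (* Growing at rate at least [c], [f] changes by more than [Rabs (z - f 0)] over the distance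
       [M]; the [1] makes this strict. *)
    set (M := Rabs (z - f 0) / c + 1).
    assert (HM : c * M > Rabs (z - f 0)) by (unfold M; field_simplify; lra).
    pose proof (Rabs_pos (z - f 0)).
    assert (0 < M). { apply Rnot_le_lt. intros C. nra. }
    pose proof (Hinc 0 M ltac:(lra)). pose proof (Hinc (- M) 0 ltac:(lra)).
    pose proof (Rle_abs (z - f 0)).
    pose proof (Rle_abs (- (z - f 0))) as N. rewrite Rabs_Ropp in N.
    assert (f (- M) <= z <= f M) by lra.
    destruct (IVT_gen f (- M) M z) as [x [_ Hx]]; auto; [|now exists x].
    rewrite Rmin_left, Rmax_right by lra. lra. }
  destruct (functional_choice _ Hs) as [g Hg].
  exists g. split; [auto|]. split.
  - intros t. destruct (Rtotal_order (g (f t)) t) as [L|[L|L]]; auto;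
    exfalso; pose proof (Hinc _ _ L) as Q; rewrite Hg in Q; nra.
  - intros z. apply (is_derive_inverse f f' g (g z - 1) (g z + 1) z); auto; try lra.
    + intros x _. specialize (Hp x). lra.
    + exists (mkposreal c Hc). intros y Hy. change (Rabs (y - z) < c) in Hy.
      split; auto. apply Rabs_def2 in Hy.
      split; apply Rnot_le_lt; intros C.
      * assert (g y < g z) as L by lra. pose proof (Hinc _ _ L) as Q. rewrite !Hg in Q. nra.
      * assert (g z < g y) as L by lra. pose proof (Hinc _ _ L) as Q. rewrite !Hg in Q. nra.
Qed.

Lemma RInt_pos_of_point (f : R -> R) (a b x0 : R) :
  a < x0 < b -> (forall x, a <= x <= b -> continuous f x) ->
  (forall x, a <= x <= b -> 0 <= f x) -> 0 < f x0 -> 0 < RInt f a b.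
Proof.
  intros Hx Hc Hp H0.
  assert (I : forall u v, a <= u -> u <= v -> v <= b -> ex_RInt f u v).
  { intros u v H1 H2 H3. apply (ex_RInt_continuous (V := R_CompleteNormedModule)). intros z Hz.
    rewrite Rmin_left, Rmax_right in Hz by lra. apply Hc; lra. }
  destruct (Hc x0 ltac:(lra) (fun y => f x0 / 2 < y)) as [d Hd].
  { exists (mkposreal (f x0 / 2) ltac:(lra)). intros y Hy.
    change (Rabs (y - f x0) < f x0 / 2) in Hy. apply Rabs_def2 in Hy. lra. }
  set (e := Rmin (d / 2) (b - x0)).
  assert (He : 0 < e). { apply Rmin_pos; [pose proof (cond_pos d)|]; lra. }
  assert (He1 : e <= d / 2) by apply Rmin_l. assert (He2 : e <= b - x0) by apply Rmin_r.
  rewrite <- (RInt_Chasles f a x0 b) by (apply I; lra).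
  rewrite <- (RInt_Chasles f x0 (x0 + e) b) by (apply I; lra).
  assert (0 <= RInt f a x0) by (apply RInt_ge_0; [lra|apply I; lra|intros; apply Hp; lra]).
  assert (0 <= RInt f (x0 + e) b) by (apply RInt_ge_0; [lra|apply I; lra|intros; apply Hp; lra]).
  assert (0 < RInt f x0 (x0 + e)).
  { apply RInt_gt_0; [lra| |intros; apply Hc; lra].
    intros x Hx'. assert (f x0 / 2 < f x); [|lra]. apply Hd.
    change (Rabs (x - x0) < d). pose proof (cond_pos d). apply Rabs_def1; lra. }
  change plus with Rplus. lra.
Qed.

Lemma continuous_bounded (f : R -> R) (a b : R) :
  a <= b -> (forall x, a <= x <= b -> continuous f x) ->
  exists M, 0 < M /\ forall x, a <= x <= b -> Rabs (f x) <= M.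
Proof.
  intros Hab Hc.
  destruct (continuity_ab_maj (fun x => Rabs (f x)) a b Hab) as [x0 [H0 _]].
  { intros c Hc'. apply continuity_pt_filterlim.
    apply (continuous_comp f Rabs); [now apply Hc|apply continuous_Rabs]. }
  exists (Rabs (f x0) + 1). split; [pose proof (Rabs_pos (f x0)); lra|].
  intros x Hx. specialize (H0 x Hx). simpl in H0. lra.
Qed.

Lemma continuous_pos_bound (f : R -> R) (a b : R) :
  a <= b -> (forall x, a <= x <= b -> continuous f x) ->
  (forall x, a <= x <= b -> 0 < f x) ->
  exists c, 0 < c /\ forall x, a <= x <= b -> c <= f x.
Proof.
  intros Hab Hc Hp.
  destruct (continuity_ab_min f a b Hab) as [x0 [H0 H1]].
  { intros c Hc'. apply continuity_pt_filterlim. now apply Hc. }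
  exists (f x0). split; auto.
Qed.

(** * The coordinate [s] *)

Definition cub (beta m l x : R) : R := beta * x * (m - x) * (l + x).

(* [2 V(x) = x^2 * rho x] where [V' = cub] and [V 0 = 0]. *)
Definition rho (beta m l x : R) : R := beta * (m * l - 2 * (l - m) * x / 3 - x ^ 2 / 2).
Definition sg (beta m l x : R) : R := x * sqrt (rho beta m l x).
(** This is [V'(x) / s] after cancelling the common factor [x], hence regular and positive at the
    center. Since [s ^ 2 = 2 V], it is also [ds/dx]. *)
Definition om (beta m l x : R) : R := beta * (m - x) * (l + x) / sqrt (rho beta m l x).
Definition om1 (beta m l x : R) : R :=
  beta * ((m - x) - (l + x)) / sqrt (rho beta m l x)
  - beta * (m - x) * (l + x) * (beta * (- 2 * (l - m) / 3 - x))
    / (2 * sqrt (rho beta m l x) * rho beta m l x).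

Section Chart.
Variables beta m l : R.
Hypothesis Hbeta : 0 < beta.
Hypothesis Hm : 0 < m.
Hypothesis Hl : m <= l.

(** [rho / beta = (m - x) * (l + x) / 2 + (m * l / 2 - (l - m) * x / 6)]; the first term is
    nonnegative between the saddles and the second is positive for [x <= m]. *)
Lemma rho_pos x : - l <= x <= m -> 0 < rho beta m l x.
Proof.
  intros H. unfold rho. apply Rmult_lt_0_compat; [auto|].
  assert (0 <= (m - x) * (l + x)) by (apply Rmult_le_pos; lra).
  assert (0 <= (l - m) * (l + x)) by (apply Rmult_le_pos; lra).
  assert (0 <= (l - m) * (m - x)) by (apply Rmult_le_pos; lra).
  assert (0 < m * l) by nra.
  assert (0 <= l - m) by lra. nra.
Qed.

Lemma rho_derive x : is_derive (rho beta m l) x (beta * (- 2 * (l - m) / 3 - x)).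
Proof. unfold rho. auto_derive; auto. field. Qed.

Lemma sqrt_rho_derive x : - l <= x <= m ->
  is_derive (fun x => sqrt (rho beta m l x)) x
    (beta * (- 2 * (l - m) / 3 - x) / (2 * sqrt (rho beta m l x))).
Proof.
  intros H. apply is_derive_sqrt; [apply rho_derive | now apply rho_pos].
Qed.

Lemma sg_derive x : - l <= x <= m -> is_derive (sg beta m l) x (om beta m l x).
Proof.
  intros H. unfold sg, om.
  pose proof (rho_pos x H) as P. pose proof (sqrt_lt_R0 _ P) as Q.
  pose proof (sqrt_def _ (Rlt_le _ _ P)) as E.
  eapply is_derive_eq.
  { apply (is_derive_Rmult (fun x => x)); [apply is_derive_id | now apply sqrt_rho_derive]. }
  unfold one; simpl.
  set (q := sqrt (rho beta m l x)) in *.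
  apply Rmult_eq_reg_r with (2 * q); [|lra].
  field_simplify; [|lra|lra].
  replace (q ^ 2) with (rho beta m l x) by (rewrite <- E; ring).
  unfold rho. field.
Qed.

Lemma om_pos x : - l < x < m -> 0 < om beta m l x.
Proof.
  intros H. unfold om. apply Rdiv_lt_0_compat.
  - repeat apply Rmult_lt_0_compat; lra.
  - apply sqrt_lt_R0, rho_pos; lra.
Qed.

Lemma om_nonneg x : - l <= x <= m -> 0 <= om beta m l x.
Proof.
  intros H. unfold om. apply Rdiv_le_0_compat.
  - repeat apply Rmult_le_pos; lra.
  - apply sqrt_lt_R0, rho_pos; lra.
Qed.

Lemma cub_om_sg x : - l <= x <= m -> cub beta m l x = om beta m l x * sg beta m l x.
Proof.
  intros H. unfold cub, om, sg. field.
  apply Rgt_not_eq, sqrt_lt_R0, rho_pos; lra.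
Qed.

Lemma om_derive x : - l <= x <= m -> is_derive (om beta m l) x (om1 beta m l x).
Proof.
  intros H. unfold om, om1.
  pose proof (rho_pos x H) as P. pose proof (sqrt_lt_R0 _ P) as Q.
  pose proof (sqrt_def _ (Rlt_le _ _ P)) as E.
  evar_last.
  { apply (is_derive_div (fun x => beta * (m - x) * (l + x)) (fun x => sqrt (rho beta m l x)) x
      (beta * ((m - x) - (l + x)))).
    - auto_derive; auto. ring.
    - now apply sqrt_rho_derive.
    - lra. }
  set (q := sqrt (rho beta m l x)) in *. rewrite <- E. field. lra.
Qed.

Lemma om1_continuous x : - l <= x <= m -> continuous (om1 beta m l) x.
Proof.
  intros H. pose proof (rho_pos x H) as P. pose proof (sqrt_lt_R0 _ P) as Q.
  unfold om1. apply (ex_derive_continuous (V := R_NormedModule)).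
  unfold rho in *. auto_derive.
  simpl in *. rewrite ?Rmult_1_r in *. unfold Rminus, Rdiv in *.
  repeat split; auto; nra.
Qed.

Lemma sg_incr_weak x y : - l <= x -> x <= y -> y <= m -> sg beta m l x <= sg beta m l y.
Proof.
  intros. apply (derive_nonneg_incr (sg beta m l) (om beta m l)); auto.
  - intros; apply sg_derive; lra. - intros; apply om_nonneg; lra.
Qed.

Lemma sg_incr x y : - l <= x -> x < y -> y <= m -> sg beta m l x < sg beta m l y.
Proof.
  intros. apply (derive_strict_incr (sg beta m l) (om beta m l)); auto; intros.
  - apply sg_derive; lra.
  - apply om_nonneg; lra.
  - apply om_pos; lra.
Qed.

Lemma sg_0 : sg beta m l 0 = 0.
Proof. unfold sg; ring. Qed.

Lemma sg_m_pos : 0 < sg beta m l m.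
Proof. rewrite <- sg_0. apply sg_incr; lra. Qed.

(** [rho (- l) - rho m = beta * (l ^ 2 - m ^ 2) / 6 >= 0]: the potential at the saddle [- l] is at
    least as high as at [m]. The annulus is therefore a punctured disc of radius [sg m] in the
    [(s, y)] plane. *)
Lemma sg_left_end : sg beta m l (- l) <= - sg beta m l m.
Proof.
  unfold sg.
  assert (sqrt (rho beta m l m) <= sqrt (rho beta m l (- l))).
  { apply sqrt_le_1_alt. unfold rho. apply Rmult_le_compat_l; [lra|]. nra. }
  pose proof (sqrt_pos (rho beta m l m)). nra.
Qed.

Lemma sg_continuous x : continuous (sg beta m l) x.
Proof.
  unfold sg. apply (continuous_mult (K := R_AbsRing) (fun x => x)); [apply continuous_id|].
  apply (continuous_comp (rho beta m l) sqrt); [|apply continuous_sqrt].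
  apply (is_derive_continuous _ _ _ (rho_derive x)).
Qed.

Lemma chart_exists : exists X : R -> R,
  (forall s, Rabs s < sg beta m l m ->
     - l < X s < m /\ sg beta m l (X s) = s /\ is_derive X s (/ om beta m l (X s))) /\
  (forall x, - l < x < m -> Rabs (sg beta m l x) < sg beta m l m -> X (sg beta m l x) = x).
Proof.
  pose proof sg_left_end as L. pose proof sg_m_pos as P.
  assert (Ex : forall s, exists x, Rabs s < sg beta m l m -> - l < x < m /\ sg beta m l x = s).
  { intros s. destruct (Rlt_dec (Rabs s) (sg beta m l m)) as [A|A].
    (* The choice of [X] needs a value for every [s]; beyond the range of the chart it is
       arbitrary. *)
    2:{ exists 0. intros; lra. }
    apply Rabs_def2 in A.
    destruct (IVT_gen (sg beta m l) (- l) m s) as [x [Hx E]].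
    - intros x. apply continuity_pt_filterlim, sg_continuous.
    - rewrite Rmin_left, Rmax_right by lra. lra.
    - exists x. intros _. rewrite Rmin_left, Rmax_right in Hx by lra.
      split; auto. split; apply Rnot_le_lt; intros C.
      + replace x with (- l) in E by lra. lra.
      + replace x with m in E by lra. lra. }
  destruct (functional_choice _ Ex) as [X HX].
  exists X. split.
  - intros s Hs. destruct (HX s Hs) as [A B]. split; [exact A|]. split; [exact B|].
    apply (is_derive_inverse (sg beta m l) (om beta m l) X (- l) m s); auto.
    + intros; apply sg_derive; lra.
    + intros; apply om_pos; lra.
    + assert (Hp : 0 < sg beta m l m - Rabs s) by lra.
      exists (mkposreal _ Hp). intros y Hy. change (Rabs (y - s) < sg beta m l m - Rabs s) in Hy.
      apply HX. replace y with (y - s + s) by ring.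
      eapply Rle_lt_trans; [apply Rabs_triang|]. lra.
  - intros x Hx Hsx. destruct (HX _ Hsx) as [A B].
    destruct (Rtotal_order (X (sg beta m l x)) x) as [C|[C|C]]; auto; exfalso.
    + pose proof (sg_incr (X (sg beta m l x)) x ltac:(lra) C ltac:(lra)). lra.
    + pose proof (sg_incr x (X (sg beta m l x)) ltac:(lra) C ltac:(lra)). lra.
Qed.

End Chart.

(** * Monotonicity of chords *)

(* The chord through [(V'(a), f a)] and [(V'(b), f b)], with [a = X (-s) < 0 < b = X s] on the
   same level of [V], evaluated at [V' = 0]; recall [V'(X s) = s * w s]. *)
Definition chord (X w f : R -> R) (s : R) : R :=
  (f (X s) * w (- s) + f (X (- s)) * w s) / (w s + w (- s)).

Section Chord.
Variables beta m l : R.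
Hypothesis Hbeta : 0 < beta.
Hypothesis Hm : 0 < m.
Hypothesis Hl : m <= l.
Variable X : R -> R.
Local Notation S := (sg beta m l m).
Local Notation w := (fun s => om beta m l (X s)).
Hypothesis HX : forall s, Rabs s < S ->
  - l < X s < m /\ sg beta m l (X s) = s /\ is_derive X s (/ om beta m l (X s)).

(** Nonnegativity is bundled with monotonicity because the recursion for chords multiplies such
    functions. *)
Definition nonneg_incr (f : R -> R) : Prop :=
  forall s1 s2, 0 <= s1 -> s1 <= s2 -> s2 < S -> 0 <= f s1 <= f s2.

Definition strict_incr (f : R -> R) : Prop :=
  forall s1 s2, 0 <= s1 -> s1 < s2 -> s2 < S -> f s1 < f s2.

Local Notation p := (fun s => X s + X (- s)).
Local Notation q := (fun s => - (X s * X (- s))).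

Lemma X_incr s t : - S < s -> s < t -> t < S -> X s < X t.
Proof.
  intros Hs Hst Ht.
  destruct (HX s) as [A1 [A2 _]]; [apply Rabs_def1; lra|].
  destruct (HX t) as [B1 [B2 _]]; [apply Rabs_def1; lra|].
  apply Rnot_le_lt. intros C.
  pose proof (sg_incr_weak beta m l Hbeta Hm Hl (X t) (X s)). lra.
Qed.

Lemma X_0 : X 0 = 0.
Proof.
  pose proof (sg_m_pos beta m l Hbeta Hm Hl) as P.
  destruct (HX 0) as [A1 [A2 _]]; [rewrite Rabs_R0; lra|].
  destruct (Rtotal_order (X 0) 0) as [C|[C|C]]; auto; exfalso.
  - pose proof (sg_incr beta m l Hbeta Hm Hl (X 0) 0 ltac:(lra) C ltac:(lra)).
    rewrite sg_0 in H. lra.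
  - pose proof (sg_incr beta m l Hbeta Hm Hl 0 (X 0) ltac:(lra) C ltac:(lra)).
    rewrite sg_0 in H. lra.
Qed.

Lemma w_pos s : Rabs s < S -> 0 < om beta m l (X s).
Proof. intros H. destruct (HX s H) as [A _]. now apply om_pos. Qed.

Lemma X_signs s : 0 < s -> s < S -> X (- s) < 0 < X s.
Proof.
  intros H1 H2. rewrite <- X_0. split; apply X_incr; lra.
Qed.

Lemma cub_X s : Rabs s < S -> cub beta m l (X s) = om beta m l (X s) * s.
Proof.
  intros H. destruct (HX s H) as [A [B _]].
  rewrite <- B at 3. apply cub_om_sg; auto; lra.
Qed.

(** * Sum and product of the two points on a level of the potential *)

Lemma p_nonneg s : 0 <= s -> s < S -> 0 <= X s + X (- s).
Proof.
  intros [H1|H1] H2.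
  2:{ subst s. rewrite Ropp_0, X_0. lra. }
  destruct (X_signs s H1 H2) as [Ha Hb].
  destruct (HX s) as [A1 [A2 _]]; [apply Rabs_def1; lra|].
  destruct (HX (- s)) as [B1 [B2 _]]; [apply Rabs_def1; lra|].
  set (z := - X (- s)) in *. replace (X (- s)) with (- z) in * by (unfold z; ring).
  apply Rnot_lt_le. intros C.
  (* [V (- x) >= V x] for [x >= 0], since [m <= l]. *)
  assert (K : forall x, 0 <= x -> sg beta m l x <= - sg beta m l (- x)).
  { intros x Hx. unfold sg.
    assert (sqrt (rho beta m l x) <= sqrt (rho beta m l (- x))).
    { apply sqrt_le_1_alt. unfold rho. apply Rmult_le_compat_l; nra. }
    nra. }
  (* [z] may lie beyond [m], where [sg] need not increase; the reflected values are then compared at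
     [m] and contradict [s < S]. *)
  destruct (Rle_dec z m) as [D|D].
  - pose proof (sg_incr beta m l Hbeta Hm Hl (X s) z ltac:(lra) ltac:(lra) D).
    pose proof (K z ltac:(lra)). lra.
  - pose proof (sg_incr beta m l Hbeta Hm Hl (- z) (- m) ltac:(lra) ltac:(lra) ltac:(lra)).
    pose proof (K m ltac:(lra)). lra.
Qed.

Lemma q_nonneg s : 0 <= s -> s < S -> 0 <= - (X s * X (- s)).
Proof.
  intros [H1|H1] H2.
  - destruct (X_signs s H1 H2). nra.
  - subst s. rewrite X_0. lra.
Qed.

Lemma q_pos s : 0 < s -> s < S -> 0 < - (X s * X (- s)).
Proof. intros H1 H2. destruct (X_signs s H1 H2). nra. Qed.

(** With [b = X s] and [a = X (- s)], this is [V(b) = V(a)] divided by [b - a], written through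
    [p = a + b] and [q = - a * b]: [a^2 + a b + b^2 = p^2 + q] and [a^2 + b^2 = p^2 + 2 q]. *)
Lemma level_relation s : 0 <= s -> s < S ->
  m * l * p s = 2 * (l - m) * (p s ^ 2 + q s) / 3 + p s * (p s ^ 2 + 2 * q s) / 2.
Proof.
  intros [H1|H1] H2.
  2:{ subst s. rewrite Ropp_0, X_0. field. }
  destruct (X_signs s H1 H2) as [Ha Hb].
  destruct (HX s) as [A1 [A2 _]]; [apply Rabs_def1; lra|].
  destruct (HX (- s)) as [B1 [B2 _]]; [apply Rabs_def1; lra|].
  set (b := X s) in *. set (a := X (- s)) in *.
  assert (E : b ^ 2 * rho beta m l b = a ^ 2 * rho beta m l a).
  { rewrite <- (sqrt_def (rho beta m l b)), <- (sqrt_def (rho beta m l a))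
      by (apply Rlt_le, rho_pos; auto; lra).
    unfold sg in A2, B2.
    replace (b ^ 2 * _) with ((b * sqrt (rho beta m l b)) ^ 2) by ring.
    replace (a ^ 2 * _) with ((a * sqrt (rho beta m l a)) ^ 2) by ring.
    rewrite A2, B2. ring. }
  unfold rho in E.
  apply Rmult_eq_reg_l with (beta * (b - a)).
  2:{ apply Rmult_integral_contrapositive; split; lra. }
  lra.
Qed.

(** By [cub_X] the sum of [V'] over the two points is [s] times the difference of the two
    frequencies. Eliminating [m * l * p] with [level_relation] turns minus this sum into a
    polynomial in [p] and [q] with nonnegative coefficients. *)
Lemma w_reflect_le s : 0 <= s -> s < S -> om beta m l (X s) <= om beta m l (X (- s)).
Proof.
  intros [H1|H1] H2.
  2:{ subst s. rewrite Ropp_0. lra. }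
  pose proof (level_relation s (Rlt_le _ _ H1) H2) as E. cbv beta in E.
  pose proof (p_nonneg s (Rlt_le _ _ H1) H2) as Hp.
  pose proof (q_nonneg s (Rlt_le _ _ H1) H2) as Hq.
  pose proof (cub_X s) as C1. pose proof (cub_X (- s)) as C2.
  rewrite Rabs_Ropp in C2. rewrite Rabs_right in C1, C2 by lra.
  specialize (C1 H2). specialize (C2 H2).
  assert (0 <= - cub beta m l (X s) - cub beta m l (X (- s))).
  { unfold cub.
    replace (- (beta * X s * (m - X s) * (l + X s)) - beta * X (- s) * (m - X (- s)) * (l + X (- s)))
      with (beta * (- (m * l * (X s + X (- s))) + (l - m) * ((X s + X (- s)) ^ 2 + 2 * - (X s * X (- s)))
         + ((X s + X (- s)) ^ 3 + 3 * (X s + X (- s)) * - (X s * X (- s))))) by ring.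
    rewrite E.
    set (pp := X s + X (- s)) in *. set (qq := - (X s * X (- s))) in *.
    apply Rmult_le_pos; [lra|].
    replace (_ + _) with ((l - m) * (pp ^ 2 / 3 + 4 * qq / 3) + (pp ^ 3 / 2 + 2 * (pp * qq))) by field.
    assert (0 <= pp * qq) by (now apply Rmult_le_pos).
    assert (0 <= pp ^ 3) by (now apply pow_le).
    assert (0 <= pp ^ 2) by (now apply pow_le).
    assert (0 <= (l - m) * (pp ^ 2 / 3 + 4 * qq / 3)) by (apply Rmult_le_pos; lra).
    lra. }
  apply Rmult_le_reg_r with s; auto. lra.
Qed.

(** Since [X' = 1 / w], the derivative is [1 / w s - 1 / w (- s)], whose sign is given by
    [w_reflect_le]. *)
Lemma p_nonneg_incr : nonneg_incr p.
Proof.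
  intros s1 s2 H1 H12 H2. split; [apply p_nonneg; lra|].
  apply (derive_nonneg_incr p (fun s => / om beta m l (X s) - / om beta m l (X (- s)))); auto.
  - intros t Ht. apply (is_derive_eq _ _ (/ om beta m l (X t) + / om beta m l (X (- t)) * - 1)); [|ring].
    apply is_derive_Rplus.
    + apply HX, Rabs_def1; lra.
    + apply (is_derive_Rcomp X Ropp).
      * apply HX, Rabs_def1; lra.
      * auto_derive; auto.
  - intros t Ht. pose proof (w_reflect_le t ltac:(lra) ltac:(lra)) as E.
    pose proof (w_pos t ltac:(apply Rabs_def1; lra)).
    pose proof (Rinv_le_contravar _ _ H E). lra.
Qed.

Lemma q_strict_incr : strict_incr q.
Proof.
  intros s1 s2 H1 H12 H2.
  destruct (X_signs s2 ltac:(lra) H2) as [A B].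
  pose proof (X_incr s1 s2 ltac:(lra) H12 H2).
  pose proof (X_incr (- s2) (- s1) ltac:(lra) ltac:(lra) ltac:(lra)).
  assert (0 <= X s1 /\ X (- s1) <= 0).
  { destruct H1 as [H1|H1].
    - destruct (X_signs s1); lra.
    - subst s1. rewrite Ropp_0, X_0. lra. }
  nra.
Qed.

Lemma q_nonneg_incr : nonneg_incr q.
Proof.
  intros s1 s2 H1 H12 H2. split; [apply q_nonneg; lra|].
  destruct H12 as [H12|H12]; [|subst; lra]. apply Rlt_le, q_strict_incr; lra.
Qed.

Lemma nonneg_incr_plus f g : nonneg_incr f -> nonneg_incr g -> nonneg_incr (fun s => f s + g s).
Proof.
  intros Hf Hg s1 s2 H1 H12 H2.
  specialize (Hf s1 s2 H1 H12 H2). specialize (Hg s1 s2 H1 H12 H2). lra.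
Qed.

Lemma nonneg_incr_mult f g : nonneg_incr f -> nonneg_incr g -> nonneg_incr (fun s => f s * g s).
Proof.
  intros Hf Hg s1 s2 H1 H12 H2.
  specialize (Hf s1 s2 H1 H12 H2). specialize (Hg s1 s2 H1 H12 H2).
  split; [apply Rmult_le_pos; lra|]. apply Rmult_le_compat; lra.
Qed.

Lemma nonneg_incr_const c : 0 <= c -> nonneg_incr (fun _ => c).
Proof. intros Hc s1 s2 _ _ _. lra. Qed.

Lemma nonneg_incr_ext f g :
  (forall s, 0 <= s -> s < S -> f s = g s) -> nonneg_incr f -> nonneg_incr g.
Proof.
  intros E Hf s1 s2 H1 H12 H2. rewrite <- !E by lra. now apply Hf.
Qed.

Lemma strict_incr_ext f g :
  (forall s, 0 <= s -> s < S -> f s = g s) -> strict_incr f -> strict_incr g.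
Proof.
  intros E Hf s1 s2 H1 H12 H2. rewrite <- !E by lra. now apply Hf.
Qed.

(** * Chords of powers of [x] *)

Lemma w_both s : 0 <= s -> s < S -> 0 < om beta m l (X s) /\ 0 < om beta m l (X (- s)).
Proof. intros. split; apply w_pos, Rabs_def1; lra. Qed.

Lemma chord_linear f g (c : R) s : 0 <= s -> s < S ->
  chord X w (fun x => f x + c * g x) s = chord X w f s + c * chord X w g s.
Proof.
  intros H1 H2. destruct (w_both s H1 H2). unfold chord. field. lra.
Qed.

Lemma chord_one s : 0 <= s -> s < S -> chord X w (fun _ => 1) s = 1.
Proof. intros H1 H2. destruct (w_both s H1 H2). unfold chord. field. lra. Qed.

(** [X s] and [X (- s)] are the two roots of [z ^ 2 = p * z + q], and the chord depends only on the
    values of the function at these roots, linearly. *)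
Lemma chord_rec f s : 0 <= s -> s < S ->
  chord X w (fun x => x * (x * f x)) s
  = p s * chord X w (fun x => x * f x) s + q s * chord X w f s.
Proof. intros H1 H2. destruct (w_both s H1 H2). unfold chord. field. lra. Qed.

(** Up to the factor [beta] this is the slope of the secant of [V'] through the two points, and [V']
    is negative at the left one and positive at the right one. At [s = 0] it reduces to [m * l]. *)
Lemma slope_pos s : 0 <= s -> s < S -> 0 < m * l - (l - m) * p s - p s ^ 2 - q s.
Proof.
  intros [H1|H1] H2.
  2:{ subst s. cbv beta. rewrite Ropp_0, X_0. assert (0 < m * l) by (apply Rmult_lt_0_compat; lra). ring_simplify. lra. }
  destruct (X_signs s H1 H2) as [A B].
  destruct (w_both s (Rlt_le _ _ H1) H2) as [W1 W2].
  pose proof (cub_X s ltac:(apply Rabs_def1; lra)) as C1.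
  pose proof (cub_X (- s) ltac:(apply Rabs_def1; lra)) as C2.
  assert (0 < cub beta m l (X s) - cub beta m l (X (- s))) as E by (rewrite C1, C2; nra).
  unfold cub in E.
  apply Rmult_lt_reg_l with (beta * (X s - X (- s))); [nra|].
  rewrite Rmult_0_r.
  replace (beta * (X s - X (- s)) * _) with
   (beta * X s * (m - X s) * (l + X s) - beta * X (- s) * (m - X (- s)) * (l + X (- s))) by ring.
  exact E.
Qed.

(** The chord of the identity is the zero of the secant of [V'], that is
    [(a V'(b) - b V'(a)) / (V'(b) - V'(a))]. Numerator and denominator share the factor
    [beta * (b - a)]; the proof multiplies by [s] in order to replace frequencies by values of
    [V']. *)
Lemma chord_id s : 0 <= s -> s < S ->
  chord X w (fun x => x) s
  = q s * ((l - m) + p s) * / (m * l - (l - m) * p s - p s ^ 2 - q s).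
Proof.
  intros H1 H2. destruct (w_both s H1 H2) as [W1 W2].
  pose proof (slope_pos s H1 H2) as D. cbv beta in D |- *.
  unfold chord.
  destruct H1 as [H1|H1].
  2:{ subst s. cbv beta. rewrite Ropp_0, X_0. assert (0 < m * l) by (apply Rmult_lt_0_compat; lra). unfold Rdiv. ring. }
  pose proof (cub_X s ltac:(apply Rabs_def1; lra)) as C1.
  pose proof (cub_X (- s) ltac:(apply Rabs_def1; lra)) as C2.
  unfold cub in C1, C2.
  set (b := X s) in *. set (a := X (- s)) in *.
  set (w1 := om beta m l b) in *. set (w2 := om beta m l a) in *.
  apply Rmult_eq_reg_r with ((w1 + w2) * (m * l - (l - m) * (b + a) - (b + a) ^ 2 - - (b * a))).
  2:{ apply Rgt_not_eq, Rmult_lt_0_compat; lra. }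
  field_simplify; [|lra|lra].
  apply Rmult_eq_reg_r with s; [|lra].
  assert (E1 : w1 * s = beta * b * (m - b) * (l + b)) by lra.
  assert (E2 : w2 * s = - (beta * a * (m - a) * (l + a))) by lra.
  match goal with |- ?u = ?v => cut (u - v = 0); [lra|] end.
  match goal with |- ?u = 0 => 
   replace u with ((w1 * s) * (a * (m * l - (l - m) * (b + a) - (b + a) ^ 2 - - (b * a)) + b * a * ((l - m) + (b + a)))
    + (w2 * s) * (b * (m * l - (l - m) * (b + a) - (b + a) ^ 2 - - (b * a)) + b * a * ((l - m) + (b + a)))) by ring end.
  rewrite E1, E2. ring.
Qed.

(** In the closed form, the numerator increases with [p] and [q] and the positive denominator
    decreases. *)
Lemma chord_id_nonneg_incr : nonneg_incr (chord X w (fun x => x)).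
Proof.
  apply (nonneg_incr_ext (fun s => q s * ((l - m) + p s) * / (m * l - (l - m) * p s - p s ^ 2 - q s))).
  { intros. symmetry. now apply chord_id. }
  apply nonneg_incr_mult.
  - apply nonneg_incr_mult; [apply q_nonneg_incr|].
    apply (nonneg_incr_plus (fun _ => l - m)); [apply nonneg_incr_const; lra | apply p_nonneg_incr].
  - intros s1 s2 H1 H12 H2.
    pose proof (slope_pos s1 ltac:(lra) ltac:(lra)) as D1.
    pose proof (slope_pos s2 ltac:(lra) ltac:(lra)) as D2.
    pose proof (p_nonneg_incr s1 s2 H1 H12 H2) as Hp.
    pose proof (q_nonneg_incr s1 s2 H1 H12 H2) as Hq. cbv beta in *.
    split; [apply Rlt_le, Rinv_0_lt_compat, D1|].
    apply Rinv_le_contravar; auto.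
    assert (0 <= l - m) by lra. nra.
Qed.

(** The recursion has two terms, so the induction carries two consecutive exponents; it starts from
    the chords of [1] and of [x]. *)
Lemma chord_pow_nonneg_incr n : nonneg_incr (chord X w (fun x => x ^ n)).
Proof.
  assert (K : nonneg_incr (chord X w (fun x => x ^ n)) /\
              nonneg_incr (chord X w (fun x => x ^ (Datatypes.S n)))); [|apply K].
  induction n as [|n [IH1 IH2]]; split; auto.
  - apply (nonneg_incr_ext (fun _ => 1)); [|apply nonneg_incr_const; lra].
    intros s H1 H2. symmetry. now apply chord_one.
  - apply (nonneg_incr_ext (chord X w (fun x => x))); [|apply chord_id_nonneg_incr].
    intros s H1 H2. unfold chord. simpl. now rewrite !Rmult_1_r.
  - apply (nonneg_incr_ext (fun s => p s * chord X w (fun x => x ^ Datatypes.S n) s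
       + q s * chord X w (fun x => x ^ n) s)).
    + intros s H1 H2. symmetry. now apply (chord_rec (fun x => x ^ n)).
    + apply (nonneg_incr_plus (fun s => p s * chord X w (fun x => x ^ Datatypes.S n) s));
        apply nonneg_incr_mult; auto using p_nonneg_incr, q_nonneg_incr.
Qed.

(** Positivity is inherited from two exponents below through [q > 0]. For even [n] the descent ends
    at the constant [1]; for odd [n] it ends at [x], whose chord contains the factor [l - m + p],
    positive if [m < l]. *)
Lemma chord_pow_pos n : m < l \/ Nat.Even n ->
  forall s, 0 < s -> s < S -> 0 < chord X w (fun x => x ^ n) s.
Proof.
  assert (K : (m < l \/ Nat.Even n ->
     forall s, 0 < s -> s < S -> 0 < chord X w (fun x => x ^ n) s) /\
    (m < l \/ Nat.Even (Datatypes.S n) ->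
     forall s, 0 < s -> s < S -> 0 < chord X w (fun x => x ^ Datatypes.S n) s)); [|apply K].
  induction n as [|n [IH1 IH2]]; split; auto.
  - intros _ s H1 H2. simpl. rewrite chord_one; lra.
  - intros [H|[k Hk]] s H1 H2; [|lia].
    replace (chord X w (fun x => x ^ 1) s) with (chord X w (fun x => x) s).
    2:{ unfold chord. simpl. now rewrite !Rmult_1_r. }
    rewrite chord_id by lra.
    pose proof (p_nonneg s ltac:(lra) H2). pose proof (q_pos s H1 H2).
    apply Rmult_lt_0_compat; [apply Rmult_lt_0_compat; lra|].
    apply Rinv_0_lt_compat, slope_pos; lra.
  - intros H s H1 H2.
    replace (chord X w (fun x => x ^ Datatypes.S (Datatypes.S n)) s) with
      (p s * chord X w (fun x => x ^ Datatypes.S n) s + q s * chord X w (fun x => x ^ n) s).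
    2:{ symmetry. apply (chord_rec (fun x => x ^ n)); lra. }
    pose proof (p_nonneg s ltac:(lra) H2). pose proof (q_pos s H1 H2).
    pose proof (chord_pow_nonneg_incr (Datatypes.S n) s s ltac:(lra) ltac:(lra) H2) as N.
    assert (0 < chord X w (fun x => x ^ n) s).
    { apply IH1; auto. destruct H as [H|[k Hk]]; [now left|].
      right. exists (pred k). lia. }
    assert (0 < q s * chord X w (fun x => x ^ n) s) by (now apply Rmult_lt_0_compat).
    assert (0 <= p s * chord X w (fun x => x ^ Datatypes.S n) s) by (apply Rmult_le_pos; lra).
    lra.
Qed.

Lemma strict_incr_plus f g : strict_incr f -> nonneg_incr g -> strict_incr (fun s => f s + g s).
Proof.
  intros Hf Hg s1 s2 H1 H12 H2.
  specialize (Hf s1 s2 H1 H12 H2). specialize (Hg s1 s2 H1 (Rlt_le _ _ H12) H2). lra.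
Qed.

(** In the recursion the strict growth comes from [q] alone, through the term
    [q * chord (x ^ (n - 2))]; this is why that chord has to be positive and not just
    nonnegative. *)
Lemma chord_pow_strict_incr n : (2 <= n)%nat -> m < l \/ Nat.Even n ->
  strict_incr (chord X w (fun x => x ^ n)).
Proof.
  intros Hn H. destruct n as [|[|n]]; try lia.
  assert (H' : m < l \/ Nat.Even n).
  { destruct H as [H|[k Hk]]; [now left|]. right. exists (pred k). lia. }
  apply (strict_incr_ext (fun s => q s * chord X w (fun x => x ^ n) s
       + p s * chord X w (fun x => x ^ Datatypes.S n) s)).
  { intros s H1 H2. rewrite Rplus_comm. symmetry. now apply (chord_rec (fun x => x ^ n)). }
  apply (strict_incr_plus (fun s => q s * chord X w (fun x => x ^ n) s)).
  - intros s1 s2 H1 H12 H2.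
    pose proof (q_strict_incr s1 s2 H1 H12 H2) as Q.
    pose proof (chord_pow_nonneg_incr n s1 s2 H1 (Rlt_le _ _ H12) H2) as N.
    pose proof (chord_pow_pos n H' s2 ltac:(lra) H2) as P.
    pose proof (q_nonneg s1 H1 ltac:(lra)). cbv beta in *. nra.
  - apply nonneg_incr_mult; [apply p_nonneg_incr | apply chord_pow_nonneg_incr].
Qed.

(** * Chords of powers of [l + x] *)

Lemma chord_shift_rec i n s : 0 <= s -> s < S ->
  chord X w (fun x => x ^ i * (l + x) ^ Datatypes.S n) s
  = chord X w (fun x => x ^ Datatypes.S i * (l + x) ^ n) s
    + l * chord X w (fun x => x ^ i * (l + x) ^ n) s.
Proof.
  intros H1 H2. rewrite <- chord_linear by auto. unfold chord. simpl. f_equal. ring.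
Qed.

Lemma nonneg_incr_scal c f : 0 <= c -> nonneg_incr f -> nonneg_incr (fun s => c * f s).
Proof. intros Hc Hf. apply (nonneg_incr_mult (fun _ => c)); auto using nonneg_incr_const. Qed.

(** Expanding one factor [l + x] at a time only produces nonnegative combinations of chords of
    powers of [x]; the free exponent [i] absorbs the factors [x]. *)
Lemma chord_shift_nonneg_incr n i : nonneg_incr (chord X w (fun x => x ^ i * (l + x) ^ n)).
Proof.
  revert i. induction n as [|n IH]; intros i.
  - apply (nonneg_incr_ext (chord X w (fun x => x ^ i))); [|apply chord_pow_nonneg_incr].
    intros s _ _. unfold chord. simpl. now rewrite !Rmult_1_r.
  - eapply nonneg_incr_ext; [intros s H1 H2; symmetry; now apply chord_shift_rec|].
    apply nonneg_incr_plus; auto. apply nonneg_incr_scal; auto. lra.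
Qed.

(** Strictness comes from a summand that keeps the factor [x ^ 2]: the exponent [2] is even, so its
    chord increases strictly also when [m = l]. The remaining summands of the expansion are merely
    nondecreasing. *)
Lemma chord_shift_strict_incr n : (2 <= n)%nat -> strict_incr (chord X w (fun x => (l + x) ^ n)).
Proof.
  intros Hn.
  assert (T2 : forall k, strict_incr (chord X w (fun x => x ^ 2 * (l + x) ^ k))).
  { induction k as [|k IH].
    - apply (strict_incr_ext (chord X w (fun x => x ^ 2))).
      + intros s _ _. unfold chord. simpl. now rewrite !Rmult_1_r.
      + apply chord_pow_strict_incr; [lia|]. right. now exists 1%nat.
    - eapply strict_incr_ext; [intros s H1 H2; symmetry; now apply chord_shift_rec|].
      intros s1 s2 H1 H12 H2.
      pose proof (chord_shift_nonneg_incr k 3 s1 s2 H1 (Rlt_le _ _ H12) H2).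
      specialize (IH s1 s2 H1 H12 H2). nra. }
  destruct n as [|[|n]]; try lia.
  apply (strict_incr_ext (fun s =>
    chord X w (fun x => x ^ 2 * (l + x) ^ n) s
    + (l * chord X w (fun x => x ^ 1 * (l + x) ^ n) s
       + l * chord X w (fun x => x ^ 0 * (l + x) ^ Datatypes.S n) s))).
  - intros s H1 H2. rewrite <- Rplus_assoc, <- chord_shift_rec, <- chord_shift_rec by auto.
    unfold chord. simpl. now rewrite !Rmult_1_l.
  - apply strict_incr_plus; auto.
    apply nonneg_incr_plus; apply nonneg_incr_scal; try lra; apply chord_shift_nonneg_incr.
Qed.

End Chord.

(** * Angular means *)

Definition sin2_mean (k : R -> R) (r : R) : R :=
  RInt (fun t => r * sin t ^ 2 * k (r * cos t)) 0 (2 * PI).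
Definition cos2_mean (k : R -> R) (r : R) : R :=
  RInt (fun t => cos t ^ 2 * k (r * cos t)) 0 (2 * PI).

Lemma abs_mult_cos r t : Rabs (r * cos t) <= Rabs r.
Proof.
  rewrite Rabs_mult. rewrite <- (Rmult_1_r (Rabs r)) at 2.
  apply Rmult_le_compat_l; [apply Rabs_pos|].
  apply Rabs_le. pose proof (COS_bound t). lra.
Qed.

Lemma continuous_Rmult (f g : R -> R) x :
  continuous f x -> continuous g x -> continuous (fun t => f t * g t) x.
Proof. apply (continuous_mult f g). Qed.

Lemma continuous_Rplus (f g : R -> R) x :
  continuous f x -> continuous g x -> continuous (fun t => f t + g t) x.
Proof. apply (continuous_plus f g). Qed.

Lemma continuous_pow2 (f : R -> R) x : continuous f x -> continuous (fun t => f t ^ 2) x.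
Proof.
  intros H. apply (continuous_ext (fun t => f t * f t)); [intros; simpl; ring|].
  now apply continuous_Rmult.
Qed.

Lemma ex_RInt_cont (f : R -> R) a b :
  a <= b -> (forall x, a <= x <= b -> continuous f x) -> ex_RInt f a b.
Proof.
  intros Hab H. apply (ex_RInt_continuous (V := R_CompleteNormedModule)). intros z Hz.
  rewrite Rmin_left, Rmax_right in Hz by lra. now apply H.
Qed.

Lemma RInt_Rext (f g : R -> R) a b : (forall x, f x = g x) -> RInt f a b = RInt g a b.
Proof. intros H. apply RInt_ext. intros x _. apply H. Qed.

Lemma RInt_Rscal (f : R -> R) a b c :
  ex_RInt f a b -> RInt (fun t => c * f t) a b = c * RInt f a b.
Proof. exact (RInt_scal (V := R_CompleteNormedModule) f a b c). Qed.

Lemma ex_RInt_Rscal (f : R -> R) a b c :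
  ex_RInt f a b -> ex_RInt (fun t => c * f t) a b.
Proof. exact (ex_RInt_scal (V := R_NormedModule) f a b c). Qed.

Lemma RInt_Rminus (f g : R -> R) a b :
  ex_RInt f a b -> ex_RInt g a b -> RInt (fun t => f t - g t) a b = RInt f a b - RInt g a b.
Proof. exact (RInt_minus (V := R_CompleteNormedModule) f g a b). Qed.

Lemma RInt_Ropp (f : R -> R) a b :
  ex_RInt f a b -> RInt (fun t => - f t) a b = - RInt f a b.
Proof. exact (RInt_opp (V := R_CompleteNormedModule) f a b). Qed.

(** The half turn [t |-> t + PI] preserves [sin t ^ 2] and negates [cos t], so folding the period
    leaves twice the even part in [cos t]. Abstracting the integrand as [h] makes this a
    substitution of arguments. *)
Lemma RInt_half_period (h : R -> R -> R) :
  (forall t, continuous (fun t => h (sin t ^ 2) (cos t)) t) ->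
  RInt (fun t => h (sin t ^ 2) (cos t)) 0 (2 * PI)
  = RInt (fun t => h (sin t ^ 2) (cos t) + h (sin t ^ 2) (- cos t)) 0 PI.
Proof.
  intros Hc. pose proof PI_RGT_0.
  assert (I : forall a b, a <= b -> ex_RInt (fun t => h (sin t ^ 2) (cos t)) a b).
  { intros. apply ex_RInt_cont; auto. }
  rewrite <- (RInt_Chasles (fun t => h (sin t ^ 2) (cos t)) 0 PI (2 * PI)) by (apply I; lra).
  assert (E : RInt (fun t => h (sin t ^ 2) (cos t)) PI (2 * PI)
    = RInt (fun t => h (sin t ^ 2) (- cos t)) 0 PI).
  { replace (2 * PI) with (1 * PI + PI) by ring.
    replace PI with (1 * 0 + PI) at 1 by ring.
    rewrite <- (RInt_comp_lin (fun t => h (sin t ^ 2) (cos t)) 1 PI 0 PI) by (apply I; lra).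
    apply RInt_ext. intros x _. unfold scal; simpl; unfold mult; simpl.
    rewrite !Rmult_1_l, neg_cos, neg_sin. f_equal. ring. }
  rewrite E. symmetry. apply (RInt_plus (fun t => h (sin t ^ 2) (cos t))).
  - apply I; lra.
  - apply (ex_RInt_ext (fun t => scal 1 (h (sin (1 * t + PI) ^ 2) (cos (1 * t + PI))))).
    + intros x _. unfold scal; simpl; unfold mult; simpl.
      rewrite !Rmult_1_l, neg_cos, neg_sin. f_equal. ring.
    + apply (ex_RInt_comp_lin (fun t => h (sin t ^ 2) (cos t))). apply I; lra.
Qed.

Section Means.
Variable S : R.

Definition cont_on (k : R -> R) : Prop := forall s, Rabs s < S -> continuous k s.

Lemma cont_comp_cos k r : cont_on k -> Rabs r < S ->
  forall t, continuous (fun t => k (r * cos t)) t.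
Proof.
  intros Hk Hr t. apply (continuous_comp (fun t => r * cos t) k).
  - apply continuous_Rmult; [apply continuous_const | apply continuous_cos].
  - apply Hk. eapply Rle_lt_trans; [apply abs_mult_cos|auto].
Qed.

Lemma cont_sin2_integrand k r : cont_on k -> Rabs r < S ->
  forall t, continuous (fun t => r * sin t ^ 2 * k (r * cos t)) t.
Proof.
  intros Hk Hr t. apply continuous_Rmult; [|now apply cont_comp_cos].
  apply continuous_Rmult; [apply continuous_const|].
  apply continuous_pow2, continuous_sin.
Qed.

Lemma cont_cos2_integrand k r : cont_on k -> Rabs r < S ->
  forall t, continuous (fun t => cos t ^ 2 * k (r * cos t)) t.
Proof.
  intros Hk Hr t. apply continuous_Rmult; [|now apply cont_comp_cos].
  apply continuous_pow2, continuous_cos.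
Qed.

Lemma sin2_mean_linear k1 k2 c r : cont_on k1 -> cont_on k2 -> Rabs r < S ->
  sin2_mean (fun s => k2 s - c * k1 s) r = sin2_mean k2 r - c * sin2_mean k1 r.
Proof.
  intros H1 H2 Hr. pose proof PI_RGT_0. unfold sin2_mean.
  assert (J : forall k, cont_on k -> ex_RInt (fun t => r * sin t ^ 2 * k (r * cos t)) 0 (2 * PI)).
  { intros k Hk. apply ex_RInt_cont; [lra|]. intros; now apply cont_sin2_integrand. }
  rewrite <- RInt_Rscal by auto. rewrite <- RInt_Rminus by auto using ex_RInt_Rscal.
  apply RInt_Rext. intros x. ring.
Qed.

Lemma cos2_mean_linear k1 k2 c r : cont_on k1 -> cont_on k2 -> Rabs r < S ->
  cos2_mean (fun s => k2 s - c * k1 s) r = cos2_mean k2 r - c * cos2_mean k1 r.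
Proof.
  intros H1 H2 Hr. pose proof PI_RGT_0. unfold cos2_mean.
  assert (J : forall k, cont_on k -> ex_RInt (fun t => cos t ^ 2 * k (r * cos t)) 0 (2 * PI)).
  { intros k Hk. apply ex_RInt_cont; [lra|]. intros; now apply cont_cos2_integrand. }
  rewrite <- RInt_Rscal by auto. rewrite <- RInt_Rminus by auto using ex_RInt_Rscal.
  apply RInt_Rext. intros x. ring.
Qed.

Lemma cont_on_lin k1 k2 c : cont_on k1 -> cont_on k2 -> cont_on (fun s => k2 s - c * k1 s).
Proof.
  intros H1 H2 s Hs. apply (continuous_minus (V := R_NormedModule) k2).
  - now apply H2.
  - apply continuous_Rmult; [apply continuous_const|now apply H1].
Qed.

Lemma sin2_mean_pos k r : cont_on k -> (forall s, Rabs s < S -> 0 < k s) -> 0 < r -> r < S ->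
  0 < sin2_mean k r.
Proof.
  intros Hk Hp H0 H1. pose proof PI_RGT_0. pose proof PI_4.
  assert (Hr : Rabs r < S) by (apply Rabs_def1; lra).
  assert (K : forall t, 0 < k (r * cos t)).
  { intros. apply Hp. eapply Rle_lt_trans; [apply abs_mult_cos|auto]. }
  apply (RInt_pos_of_point _ _ _ (PI / 2)); [lra| | |].
  - intros; now apply cont_sin2_integrand.
  - intros x _. specialize (K x). apply Rmult_le_pos; [|lra].
    apply Rmult_le_pos; [lra|]. apply pow2_ge_0.
  - specialize (K (PI / 2)). rewrite sin_PI2, pow1, Rmult_1_r. now apply Rmult_lt_0_compat.
Qed.

(* Chebyshev's argument: the first mean of [e = k2 - P k1] vanishes, so by Rolle the folded [e]
   vanishes at some [t0], and there the weight [cos^2] may be replaced by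
   [cos^2 t - cos^2 t0 = sin^2 t0 cos^2 t - cos^2 t0 sin^2 t], which has the sign of [e]. *)
Lemma mean_wronskian_pos k1 k2 r :
  cont_on k1 -> cont_on k2 -> (forall s, Rabs s < S -> 0 < k1 s) ->
  (forall s1 s2, 0 <= s1 -> s1 < s2 -> s2 < S ->
    (k2 s1 + k2 (- s1)) / (k1 s1 + k1 (- s1)) < (k2 s2 + k2 (- s2)) / (k1 s2 + k1 (- s2))) ->
  0 < r -> r < S ->
  0 < cos2_mean k2 r * sin2_mean k1 r - sin2_mean k2 r * cos2_mean k1 r.
Proof.
  intros H1 H2 Hp Hinc H0 HS. pose proof PI_RGT_0 as HPI.
  assert (Hr : Rabs r < S) by (apply Rabs_def1; lra).
  pose proof (sin2_mean_pos k1 r H1 Hp H0 HS) as Apos.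
  set (P := sin2_mean k2 r / sin2_mean k1 r).
  set (k := fun s => k2 s - P * k1 s).
  assert (Hk : cont_on k) by (now apply cont_on_lin).
  assert (E1 : sin2_mean k r = 0).
  { unfold k. rewrite sin2_mean_linear by auto. unfold P. field. lra. }
  assert (E2 : cos2_mean k2 r * sin2_mean k1 r - sin2_mean k2 r * cos2_mean k1 r
     = sin2_mean k1 r * cos2_mean k r).
  { unfold k. rewrite cos2_mean_linear by auto. unfold P. field. lra. }
  rewrite E2. apply Rmult_lt_0_compat; auto.
  set (e := fun s => k s + k (- s)).
  set (xi := fun s => (k2 s + k2 (- s)) / (k1 s + k1 (- s))).
  assert (Hw : forall s, Rabs s < S -> 0 < k1 s + k1 (- s)).
  { intros s Hs. pose proof (Hp s Hs). pose proof (Hp (- s)). rewrite Rabs_Ropp in H3.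
    specialize (H3 Hs). lra. }
  assert (He : forall s, Rabs s < S -> e s = (xi s - P) * (k1 s + k1 (- s))).
  { intros s Hs. specialize (Hw s Hs). unfold e, k, xi. field. lra. }
  assert (Hxi : forall s, xi s = xi (Rabs s)).
  { intros s. unfold Rabs. destruct (Rcase_abs s); auto. unfold xi.
    rewrite Ropp_involutive, (Rplus_comm (k2 (- s))), (Rplus_comm (k1 (- s))). auto. }
  assert (Hcos : forall t, Rabs (r * cos t) < S).
  { intros. eapply Rle_lt_trans; [apply abs_mult_cos|auto]. }
  assert (Ce : forall t, continuous (fun t => e (r * cos t)) t).
  { intros t. unfold e. apply continuous_Rplus; [now apply cont_comp_cos|].
    apply (continuous_ext (fun t => k ((- r) * cos t))); [intros; f_equal; ring|].
    apply cont_comp_cos; auto. now rewrite Rabs_Ropp. }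
  assert (F1 : RInt (fun t => sin t ^ 2 * e (r * cos t)) 0 PI = 0).
  { apply Rmult_eq_reg_l with r; [|lra]. rewrite Rmult_0_r.
    transitivity (sin2_mean k r); [|exact E1].
    unfold sin2_mean. rewrite (RInt_half_period (fun u c => r * u * k (r * c))).
    2:{ intros; now apply cont_sin2_integrand. }
    rewrite <- RInt_Rscal.
    - apply RInt_Rext. intros x. unfold e.
      rewrite Ropp_mult_distr_r. ring.
    - apply ex_RInt_cont; [lra|]. intros. apply continuous_Rmult; auto.
      apply continuous_pow2, continuous_sin. }
  assert (F2 : cos2_mean k r = RInt (fun t => cos t ^ 2 * e (r * cos t)) 0 PI).
  { unfold cos2_mean. rewrite (RInt_half_period (fun u c => c ^ 2 * k (r * c))).
    2:{ intros; now apply cont_cos2_integrand. }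
    apply RInt_Rext. intros x. unfold e. rewrite Ropp_mult_distr_r. ring. }
  (* Without a zero, the intermediate value theorem gives [e (r * cos t)] on [(0, PI)] the sign it
     has at [PI / 2], and the integral in [F1] could not vanish. *)
  assert (Z : exists t0, 0 < t0 < PI /\ e (r * cos t0) = 0).
  { apply NNPP. intros C.
    assert (Nz : forall t, 0 < t < PI -> e (r * cos t) <> 0) by (intros t Ht Q; apply C; eauto).
    destruct (Rtotal_order (e (r * cos (PI / 2))) 0) as [G|[G|G]].
    - assert (0 < RInt (fun t => - (sin t ^ 2 * e (r * cos t))) 0 PI).
      { apply RInt_gt_0; [lra| |].
        - intros t Ht. pose proof (sin_gt_0 t ltac:(lra) ltac:(lra)).
          assert (e (r * cos t) < 0).
          { apply Rnot_le_lt. intros Q.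
            destruct (IVT_gen (fun t => e (r * cos t)) (PI / 2) t 0) as [z [Hz1 Hz2]].
            - intros x. apply continuity_pt_filterlim, Ce.
            - unfold Rmin, Rmax. destruct Rle_dec; lra.
            - apply (Nz z); auto. unfold Rmin, Rmax in Hz1. destruct Rle_dec; lra. }
          assert (0 < sin t ^ 2) by (apply pow_lt; lra). nra.
        - intros. apply (continuous_opp (V := R_NormedModule)). apply continuous_Rmult; auto.
          apply continuous_pow2, continuous_sin. }
      rewrite RInt_Ropp in H; [lra|].
      apply ex_RInt_cont; [lra|]. intros. apply continuous_Rmult; auto.
      apply continuous_pow2, continuous_sin.
    - apply (Nz (PI / 2)); auto; lra.
    - assert (0 < RInt (fun t => sin t ^ 2 * e (r * cos t)) 0 PI); [|lra].
      apply RInt_gt_0; [lra| |].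
      + intros t Ht. pose proof (sin_gt_0 t ltac:(lra) ltac:(lra)).
        assert (0 < e (r * cos t)).
        { apply Rnot_le_lt. intros Q.
          destruct (IVT_gen (fun t => e (r * cos t)) (PI / 2) t 0) as [z [Hz1 Hz2]].
          - intros x. apply continuity_pt_filterlim, Ce.
          - unfold Rmin, Rmax. destruct Rle_dec; lra.
          - apply (Nz z); auto. unfold Rmin, Rmax in Hz1. destruct Rle_dec; lra. }
        apply Rmult_lt_0_compat; auto. apply pow_lt; lra.
      + intros. apply continuous_Rmult; auto. apply continuous_pow2, continuous_sin. }
  destruct Z as [t0 [Ht0 Z]].
  assert (Hs0 : 0 < sin t0 ^ 2) by (apply pow_lt, sin_gt_0; lra).
  assert (HP : xi (Rabs (r * cos t0)) = P).
  { rewrite <- Hxi. rewrite He in Z by auto. apply Rmult_integral in Z.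
    pose proof (Hw _ (Hcos t0)). destruct Z; lra. }
  assert (Hsq : forall t, Rabs (r * cos t) ^ 2 = r ^ 2 * cos t ^ 2).
  { intros. rewrite pow2_abs. ring. }
  assert (Hpos : forall t, 0 <= (cos t ^ 2 - cos t0 ^ 2) * e (r * cos t)).
  { intros t. rewrite He, Hxi, <- HP by auto. pose proof (Hw _ (Hcos t)).
    rewrite <- Rmult_assoc. apply Rmult_le_pos; [|lra].
    pose proof (Hsq t) as S1. pose proof (Hsq t0) as S2.
    pose proof (Hcos t) as C1. pose proof (Hcos t0) as C2.
    pose proof (Rabs_pos (r * cos t)) as N1. pose proof (Rabs_pos (r * cos t0)) as N2.
    assert (0 < r ^ 2) by (apply pow_lt; lra).
    destruct (Rtotal_order (Rabs (r * cos t)) (Rabs (r * cos t0))) as [L|[L|L]].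
    - pose proof (Hinc _ _ N1 L C2) as Q. fold (xi (Rabs (r * cos t))) in Q. 
      fold (xi (Rabs (r * cos t0))) in Q.
      assert (cos t ^ 2 - cos t0 ^ 2 <= 0); [|nra].
      apply Rmult_le_reg_l with (r ^ 2); auto. nra.
    - rewrite L. lra.
    - pose proof (Hinc _ _ N2 L C1) as Q. fold (xi (Rabs (r * cos t))) in Q.
      fold (xi (Rabs (r * cos t0))) in Q.
      assert (0 <= cos t ^ 2 - cos t0 ^ 2); [|nra].
      apply Rmult_le_reg_l with (r ^ 2); auto. nra. }
  assert (Hstrict : forall t, cos t ^ 2 <> cos t0 ^ 2 -> 0 < (cos t ^ 2 - cos t0 ^ 2) * e (r * cos t)).
  { intros t Ht. destruct (Hpos t) as [Q|Q]; auto. exfalso.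
    symmetry in Q. apply Rmult_integral in Q. destruct Q as [Q|Q]; [lra|].
    rewrite He, Hxi, <- HP in Q by auto. pose proof (Hw _ (Hcos t)).
    apply Rmult_integral in Q. destruct Q as [Q|Q]; [|lra].
    pose proof (Hsq t) as S1. pose proof (Hsq t0) as S2.
    pose proof (Hcos t) as C1. pose proof (Hcos t0) as C2.
    pose proof (Rabs_pos (r * cos t)) as N1. pose proof (Rabs_pos (r * cos t0)) as N2.
    destruct (Rtotal_order (Rabs (r * cos t)) (Rabs (r * cos t0))) as [L|[L|L]].
    - pose proof (Hinc _ _ N1 L C2) as Q'. unfold xi in Q. lra.
    - rewrite L in S1. apply Ht. apply Rmult_eq_reg_l with (r ^ 2); [lra|].
      apply pow_nonzero; lra.
    - pose proof (Hinc _ _ N2 L C1) as Q'. unfold xi in Q. lra. }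
  assert (F3 : sin t0 ^ 2 * cos2_mean k r = RInt (fun t => (cos t ^ 2 - cos t0 ^ 2) * e (r * cos t)) 0 PI).
  { assert (J1 : ex_RInt (fun t => cos t ^ 2 * e (r * cos t)) 0 PI).
    { apply ex_RInt_cont; [lra|]. intros. apply continuous_Rmult; auto.
      apply continuous_pow2, continuous_cos. }
    assert (J2 : ex_RInt (fun t => sin t ^ 2 * e (r * cos t)) 0 PI).
    { apply ex_RInt_cont; [lra|]. intros. apply continuous_Rmult; auto.
      apply continuous_pow2, continuous_sin. }
    rewrite F2.
    transitivity (sin t0 ^ 2 * RInt (fun t => cos t ^ 2 * e (r * cos t)) 0 PI
      - cos t0 ^ 2 * RInt (fun t => sin t ^ 2 * e (r * cos t)) 0 PI); [rewrite F1; ring|].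
    rewrite <- !RInt_Rscal by auto.
    rewrite <- RInt_Rminus by auto using ex_RInt_Rscal.
    - apply RInt_Rext. intros x. simpl.
      pose proof (sin2_cos2 t0). pose proof (sin2_cos2 x). unfold Rsqr in *.
      replace (sin x * (sin x * 1)) with (1 - cos x * cos x) by lra.
      replace (sin t0 * (sin t0 * 1)) with (1 - cos t0 * cos t0) by lra. ring.
    }
  apply Rmult_lt_reg_l with (sin t0 ^ 2); auto. rewrite Rmult_0_r, F3.
  assert (Cc : forall t, continuous (fun t => (cos t ^ 2 - cos t0 ^ 2) * e (r * cos t)) t).
  { intros. apply continuous_Rmult; auto. apply (continuous_minus (V := R_NormedModule) (fun t => cos t ^ 2)).
    - apply continuous_pow2, continuous_cos. - apply continuous_const. }
  (* One point with [cos t ^ 2 <> cos t0 ^ 2] makes the integral positive: [PI / 2] serves unless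
     [cos t0 = 0], in which case [PI / 4] does. *)
  destruct (Req_dec (cos t0 ^ 2) 0) as [G|G].
  - apply (RInt_pos_of_point _ _ _ (PI / 4)); auto; [lra|].
    apply Hstrict. rewrite G. apply pow_nonzero, Rgt_not_eq, cos_gt_0; lra.
  - apply (RInt_pos_of_point _ _ _ (PI / 2)); auto; [lra|].
    apply Hstrict. rewrite cos_PI2. simpl. lra.
Qed.

End Means.

Lemma continuous_continuity_pt (f : R -> R) x : continuous f x -> continuity_pt f x.
Proof. intros H. now apply continuity_pt_filterlim. Qed.

Lemma unif_continuous_1d (f : R -> R) a b :
  (forall x, a <= x <= b -> continuous f x) ->
  forall e, 0 < e -> exists d, 0 < d /\ forall x y, a <= x <= b -> a <= y <= b ->
    Rabs (x - y) < d -> Rabs (f x - f y) < e.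
Proof.
  intros H e He.
  destruct (unifcont_normed_1d (K := R_AbsRing) (V := R_NormedModule) f a b H (mkposreal e He)) as [d Hd].
  exists d. split; [apply cond_pos|].
  intros x y Hx Hy Hxy. apply (Hd y x); auto.
Qed.

(** * Dependence of the means on the radius *)

Section MeanDerivative.
Variables (S : R) (k k' : R -> R).
Hypothesis Hk : forall s, Rabs s < S -> is_derive k s (k' s).
Hypothesis Hk' : cont_on S k'.

Lemma cont_on_of_derive : cont_on S k.
Proof. intros s Hs. exact (is_derive_continuous k s (k' s) (Hk s Hs)). Qed.

Lemma cos2_mean_continuous r : Rabs r < S -> continuous (cos2_mean k) r.
Proof.
  intros Hr. pose proof PI_RGT_0 as HPI. pose proof (Rabs_pos r) as Nr.
  set (r1 := (Rabs r + S) / 2).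
  assert (H1 : Rabs r < r1 < S) by (unfold r1; lra).
  intros P [e He].
  (* The interval of integration has length [2 * PI <= 8], so the means differ by at most
     [e / 2]. *)
  destruct (unif_continuous_1d k (- r1) r1) with (e := e / 16) as [d [Hd Hu]].
  { intros x Hx. apply cont_on_of_derive. apply Rabs_def1; lra. }
  { pose proof (cond_pos e); lra. }
  assert (Hd' : 0 < Rmin d (r1 - Rabs r)) by (apply Rmin_pos; lra).
  exists (mkposreal _ Hd'). intros y Hy. apply He.
  change (Rabs (y - r) < Rmin d (r1 - Rabs r)) in Hy.
  assert (Hy1 : Rabs (y - r) < d) by (eapply Rlt_le_trans; [apply Hy|apply Rmin_l]).
  assert (Hy2 : Rabs (y - r) < r1 - Rabs r) by (eapply Rlt_le_trans; [apply Hy|apply Rmin_r]).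
  assert (Hy3 : Rabs y < r1).
  { replace y with (y - r + r) by ring. eapply Rle_lt_trans; [apply Rabs_triang|]. lra. }
  change (Rabs (cos2_mean k y - cos2_mean k r) < e).
  assert (J : forall u, Rabs u < S -> ex_RInt (fun t => cos t ^ 2 * k (u * cos t)) 0 (2 * PI)).
  { intros u Hu'. apply ex_RInt_cont; [lra|]. intros. apply (cont_cos2_integrand S); auto.
    apply cont_on_of_derive. }
  unfold cos2_mean. rewrite <- RInt_Rminus by (apply J; lra).
  apply Rle_lt_trans with ((2 * PI - 0) * (e / 16)).
  - apply abs_RInt_le_const; [lra| |].
    + apply (ex_RInt_minus (V := R_NormedModule)); apply J; lra.
    + intros t _. rewrite <- Rmult_minus_distr_l, Rabs_mult.
      rewrite <- (Rmult_1_l (e / 16)). apply Rmult_le_compat; try apply Rabs_pos.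
      * rewrite <- RPow_abs.
        pose proof (COS_bound t). rewrite <- (pow1 2). apply pow_incr. split; [apply Rabs_pos|].
        apply Rabs_le; lra.
      * apply Rlt_le, Hu.
        -- pose proof (abs_mult_cos y t). apply Rabs_le_between. lra.
        -- pose proof (abs_mult_cos r t). apply Rabs_le_between. lra.
        -- rewrite <- Rmult_minus_distr_r. eapply Rle_lt_trans; [apply abs_mult_cos|auto].
  - pose proof PI_4. pose proof (cond_pos e).
    assert ((2 * PI - 0) * (e / 16) <= 8 * (e / 16)) by (apply Rmult_le_compat_r; lra). lra.
Qed.

(** The [r]-derivative of the integrand equals [cos t ^ 2 * k (r * cos t)] minus the [t]-derivative
    of [G t = sin t * cos t * k (r * cos t)], and [G] takes equal values at the ends of the
    period. *)
Lemma sin2_mean_derive r : Rabs r < S -> is_derive (sin2_mean k) r (cos2_mean k r).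
Proof.
  intros Hr. pose proof PI_RGT_0 as HPI.
  set (F := fun u v : R => u * sin v ^ 2 * k (u * cos v)).
  set (dF := fun u v : R => sin v ^ 2 * k (u * cos v) + u * sin v ^ 2 * (k' (u * cos v) * cos v)).
  assert (Hcos : forall u t, Rabs u < S -> Rabs (u * cos t) < S).
  { intros u t Hu. eapply Rle_lt_trans; [apply abs_mult_cos|auto]. }
  assert (D : forall u v, Rabs u < S -> is_derive (fun z => F z v) u (dF u v)).
  { intros u v Hu. unfold F, dF.
    apply (is_derive_eq _ _ (sin v ^ 2 * k (u * cos v) + (u * sin v ^ 2) * (k' (u * cos v) * cos v))); [|ring].
    apply (is_derive_Rmult (fun z => z * sin v ^ 2) (fun z => k (z * cos v))).
    - auto_derive; auto. ring.
    - apply (is_derive_Rcomp k (fun z => z * cos v)).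
      + apply Hk; auto.
      + auto_derive; auto. ring. }
  assert (Hloc : locally r (fun u => Rabs u < S)).
  { assert (Hp : 0 < S - Rabs r) by lra. exists (mkposreal _ Hp). intros y Hy.
    change (Rabs (y - r) < S - Rabs r) in Hy.
    replace y with (y - r + r) by ring. eapply Rle_lt_trans; [apply Rabs_triang|]. lra. }
  assert (Cc : forall v, continuous (fun v => sin v ^ 2) v) by (intros; apply continuous_pow2, continuous_sin).
  assert (E : RInt (fun t => Derive (fun u => F u t) r) 0 (2 * PI) = cos2_mean k r).
  { set (G := fun t => sin t * cos t * k (r * cos t)).
    set (dG := fun t => (cos t ^ 2 - sin t ^ 2) * k (r * cos t) - r * sin t ^ 2 * (k' (r * cos t) * cos t)).
    assert (DG : forall t, is_derive G t (dG t)).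
    { intros t. unfold G, dG.
      apply (is_derive_eq _ _ ((cos t ^ 2 - sin t ^ 2) * k (r * cos t) + (sin t * cos t) * (k' (r * cos t) * (r * - sin t)))); [|ring].
      apply (is_derive_Rmult (fun t => sin t * cos t) (fun t => k (r * cos t))).
      - auto_derive; auto. ring.
      - apply (is_derive_Rcomp k (fun t => r * cos t)).
        + apply Hk; auto.
        + auto_derive; auto. ring. }
    assert (CdG : forall t, continuous dG t).
    { intros t. unfold dG. apply (continuous_minus (V := R_NormedModule)).
      - apply continuous_Rmult.
        + apply (continuous_minus (V := R_NormedModule) (fun t => cos t ^ 2)); auto.
          apply continuous_pow2, continuous_cos.
        + apply (cont_comp_cos S); auto using cont_on_of_derive.
      - apply continuous_Rmult; [apply continuous_Rmult; auto; apply continuous_const|].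
        apply continuous_Rmult; [|apply continuous_cos]. now apply (cont_comp_cos S). }
    assert (I0 : RInt dG 0 (2 * PI) = 0).
    { replace 0 with (G (2 * PI) - G 0) at 2.
      - apply is_RInt_unique. apply (is_RInt_derive G dG).
        + intros; apply DG. + intros; apply CdG.
      - unfold G. rewrite sin_2PI, sin_0. ring. }
    transitivity (cos2_mean k r - RInt dG 0 (2 * PI)); [|rewrite I0; apply Rminus_0_r].
    unfold cos2_mean.
    rewrite <- RInt_Rminus.
    - apply RInt_Rext. intros t.
      etransitivity; [apply (is_derive_unique (fun u => F u t)), D; auto|].
      unfold dF, dG. ring.
    - apply ex_RInt_cont; [lra|]. intros. apply (cont_cos2_integrand S); auto using cont_on_of_derive.
    - apply ex_RInt_cont; [lra|]. auto. }
  rewrite <- E. unfold sin2_mean. apply (is_derive_RInt_param F).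
  - generalize Hloc; apply filter_imp. intros u Hu t _. exists (dF u t). now apply D.
  - intros t _. apply (continuity_2d_pt_ext_loc dF).
    + destruct Hloc as [d Hd]. exists d. intros u v Hu _. symmetry.
      apply is_derive_unique, D, Hd, Hu.
    + assert (Cs : continuity_2d_pt (fun u v => sin v ^ 2) r t).
      { apply (continuity_1d_2d_pt_comp (fun v => sin v ^ 2) (fun _ v => v)).
        - apply continuous_continuity_pt, Cc. - apply continuity_2d_pt_id2. }
      assert (Cco : continuity_2d_pt (fun u v => cos v) r t).
      { apply (continuity_1d_2d_pt_comp cos (fun _ v => v)).
        - apply continuous_continuity_pt, continuous_cos. - apply continuity_2d_pt_id2. }
      assert (Cuc : continuity_2d_pt (fun u v => u * cos v) r t).
      { apply continuity_2d_pt_mult; auto. apply continuity_2d_pt_id1. }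
      unfold dF. apply continuity_2d_pt_plus; apply continuity_2d_pt_mult; auto.
      * apply (continuity_1d_2d_pt_comp k (fun u v => u * cos v)); auto.
        apply continuous_continuity_pt, cont_on_of_derive; auto.
      * apply continuity_2d_pt_mult; auto. apply continuity_2d_pt_id1.
      * apply continuity_2d_pt_mult; auto.
        apply (continuity_1d_2d_pt_comp k' (fun u v => u * cos v)); auto.
        apply continuous_continuity_pt, Hk'; auto.
  - generalize Hloc; apply filter_imp. intros u Hu. apply ex_RInt_cont; [lra|].
    intros. apply (cont_sin2_integrand S); auto using cont_on_of_derive.
Qed.

End MeanDerivative.

(** For [M = al0 * a + aln * b], eliminating [al0] between two points gives [a1 * (M2 - M1) - M1 *
    (a2 - a1) = aln * a1 * a2 * (b2 / a2 - b1 / a1)]. The right side is at least a constant times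
    [e2 - e1] in absolute value, whereas smallness of [M1] and of the difference quotient makes the
    left side smaller. If [aln = 0], then [M = al0 * a] stays away from zero. *)
Lemma no_degenerate_zero (a b a' b' : R -> R) (r0 r1 al0 aln : R) :
  r0 <= r1 ->
  (forall r, r0 <= r <= r1 -> is_derive a r (a' r) /\ is_derive b r (b' r)) ->
  (forall r, r0 <= r <= r1 -> continuous a' r /\ continuous b' r) ->
  (forall r, r0 <= r <= r1 -> 0 < a r) ->
  (forall r, r0 <= r <= r1 -> 0 < b' r * a r - b r * a' r) ->
  ~ (al0 = 0 /\ aln = 0) ->
  exists eta, 0 < eta /\ forall e1 e2, r0 <= e1 -> e1 < e2 -> e2 <= r1 ->
    Rabs (al0 * a e1 + aln * b e1) <= eta ->
    Rabs ((al0 * a e2 + aln * b e2) - (al0 * a e1 + aln * b e1)) <= eta * (e2 - e1) -> False.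
Proof.
  intros H01 Hd Hc Ha HW Hal.
  assert (Ca : forall r, r0 <= r <= r1 -> continuous a r).
  { intros r Hr. exact (is_derive_continuous a r _ (proj1 (Hd r Hr))). }
  assert (Cb : forall r, r0 <= r <= r1 -> continuous b r).
  { intros r Hr. exact (is_derive_continuous b r _ (proj2 (Hd r Hr))). }
  destruct (continuous_pos_bound a r0 r1 H01 Ca Ha) as [ma [Pma Hma]].
  destruct (Req_dec aln 0) as [Z|NZ].
  - assert (N0 : 0 < Rabs al0) by (apply Rabs_pos_lt; intros C; apply Hal; auto).
    exists (Rabs al0 * ma / 2). split; [apply Rdiv_lt_0_compat; [now apply Rmult_lt_0_compat|lra]|].
    intros e1 e2 H1 H12 H2 E _. subst aln.
    rewrite Rmult_0_l, Rplus_0_r, Rabs_mult, (Rabs_right (a e1)) in E.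
    2:{ apply Rle_ge, Rlt_le, Ha; lra. }
    specialize (Hma e1 ltac:(lra)). nra.
  - destruct (continuous_bounded a r0 r1 H01 Ca) as [A [PA HA]].
    destruct (continuous_bounded a' r0 r1 H01 (fun r Hr => proj1 (Hc r Hr))) as [L [PL HL]].
    destruct (continuous_pos_bound (fun r => (b' r * a r - b r * a' r) * / (a r ^ 2)) r0 r1 H01) as [c [Pc HcP]].
    { intros r Hr. specialize (Ha r Hr). destruct (Hc r Hr). specialize (Ca r Hr). specialize (Cb r Hr).
      apply continuous_Rmult.
      - apply (continuous_minus (V := R_NormedModule)); now apply continuous_Rmult.
      - apply (continuous_comp (fun r => a r ^ 2) Rinv); [now apply continuous_pow2|].
        apply continuous_Rinv. apply pow_nonzero; lra. }
    { intros r Hr. apply Rmult_lt_0_compat; [now apply HW|].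
      apply Rinv_0_lt_compat, pow_lt. now apply Ha. }
    pose proof (Rabs_pos_lt aln NZ) as Pn.
    (* The left side of the identity is at most [eta * (A + L) * (e2 - e1)], the right side at least
       [Rabs aln * ma ^ 2 * c * (e2 - e1)]; the [2] leaves a strict gap. *)
    set (eta := Rabs aln * (ma * ma * c) / (2 * (A + L))).
    assert (Peta : 0 < eta).
    { apply Rdiv_lt_0_compat; [|lra]. repeat apply Rmult_lt_0_compat; auto. }
    exists eta. split; auto.
    intros e1 e2 H1 H12 H2 E1 E2.
    destruct (MVT_derive (fun r => b r * / a r) (fun r => (b' r * a r - b r * a' r) * / (a r ^ 2)) e1 e2) as [x [Hx Ex]]; [lra| |].
    { intros t Ht. destruct (Hd t ltac:(lra)) as [D1 D2]. specialize (Ha t ltac:(lra)).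
      eapply is_derive_eq.
      - apply is_derive_Rmult; [exact D2|].
        apply (is_derive_inv a t (a' t)); [exact D1|lra].
      - cbv beta. field. lra. }
    destruct (MVT_derive a a' e1 e2) as [y [Hy Ey]]; [lra|intros; apply Hd; lra|].
    specialize (HcP x ltac:(lra)). specialize (HL y ltac:(lra)).
    pose proof (HA e1 ltac:(lra)) as A1. pose proof (Ha e1 ltac:(lra)) as a1. pose proof (Ha e2 ltac:(lra)) as a2.
    pose proof (Hma e1 ltac:(lra)) as m1. pose proof (Hma e2 ltac:(lra)) as m2.
    set (M1 := al0 * a e1 + aln * b e1) in *. set (M2 := al0 * a e2 + aln * b e2) in *.
    assert (Id : a e1 * (M2 - M1) - M1 * (a e2 - a e1) = aln * (a e1 * a e2 * (b e2 * / a e2 - b e1 * / a e1))).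
    { unfold M1, M2. field. lra. }
    assert (Lo : ma * ma * (c * (e2 - e1)) <= a e1 * a e2 * (b e2 * / a e2 - b e1 * / a e1)).
    { rewrite Ex. apply Rmult_le_compat; try nra. }
    assert (Hi : Rabs (a e1 * (M2 - M1) - M1 * (a e2 - a e1)) <= eta * (A + L) * (e2 - e1)).
    { unfold Rminus at 1. eapply Rle_trans; [apply Rabs_triang|].
      rewrite Rabs_Ropp, !Rabs_mult, Ey, Rabs_mult, (Rabs_right (e2 - e1)) by lra.
      assert (Rabs (a e1) * Rabs (M2 - M1) <= A * (eta * (e2 - e1))).
      { apply Rmult_le_compat; auto using Rabs_pos. }
      assert (Rabs M1 * (Rabs (a' y) * (e2 - e1)) <= eta * (L * (e2 - e1))).
      { apply Rmult_le_compat; auto using Rabs_pos.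
        - apply Rmult_le_pos; [apply Rabs_pos|lra].
        - apply Rmult_le_compat_r; lra. }
      lra. }
    rewrite Id, Rabs_mult in Hi.
    rewrite (Rabs_right (a e1 * a e2 * _)) in Hi.
    2:{ apply Rle_ge. eapply Rle_trans; [|apply Lo]. repeat apply Rmult_le_pos; lra. }
    assert (Q : Rabs aln * (ma * ma * (c * (e2 - e1))) <= eta * (A + L) * (e2 - e1)).
    { eapply Rle_trans; [|apply Hi]. apply Rmult_le_compat_l; lra. }
    replace (eta * (A + L)) with (Rabs aln * (ma * ma * c) / 2) in Q by (unfold eta; field; lra).
    assert (0 < Rabs aln * (ma * ma * c) * (e2 - e1)); [|lra].
    repeat apply Rmult_lt_0_compat; lra.
Qed.

(** * The radial equation *)

(** The factors [8] in the radial estimates, and [24] together with the Gronwall factor [3], come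
    from this bound. *)
Lemma two_PI_bounds : 0 < 2 * PI <= 8.
Proof. pose proof PI_4. pose proof PI_RGT_0. lra. Qed.

Lemma derive_bound_lip_abs (f f' : R -> R) (C a b : R) :
  (forall t, Rmin a b <= t <= Rmax a b -> is_derive f t (f' t)) ->
  (forall t, Rmin a b <= t <= Rmax a b -> Rabs (f' t) <= C) ->
  Rabs (f b - f a) <= C * Rabs (b - a).
Proof.
  intros H H0. destruct (Rle_dec a b) as [L|L].
  - rewrite Rmin_left, Rmax_right in * by lra. rewrite (Rabs_right (b - a)) by lra.
    now apply (derive_bound_lip f f').
  - rewrite Rmin_right, Rmax_left in * by lra.
    rewrite (Rabs_minus_sym (f b)), (Rabs_minus_sym b), (Rabs_right (a - b)) by lra.
    apply (derive_bound_lip f f'); auto; lra.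
Qed.

Lemma abs_cos_sin_le t : Rabs (cos t * sin t) <= 1.
Proof.
  rewrite Rabs_mult. rewrite <- (Rmult_1_r 1).
  apply Rmult_le_compat; try apply Rabs_pos; apply Rabs_le.
  - pose proof (COS_bound t); lra. - pose proof (SIN_bound t); lra.
Qed.

Lemma sin2_bounds t : 0 <= sin t ^ 2 <= 1.
Proof. pose proof (SIN_bound t). split; [apply pow2_ge_0|]. simpl. nra. Qed.

Section Radial.
Variables (f w f' w' : R -> R) (S r0 r1 : R).
Hypothesis Hr0 : 0 < r0.
Hypothesis Hr1 : r1 < S.
Hypothesis Hf : forall s, Rabs s < S -> is_derive f s (f' s).
Hypothesis Hw : forall s, Rabs s < S -> is_derive w s (w' s).
Hypothesis Hf' : cont_on S f'.
Hypothesis Hw' : cont_on S w'.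
Hypothesis Hwpos : forall s, Rabs s < S -> 0 < w s.

(** [tau] stands for [eps * cos t * sin t]. The kernel is the quotient of [dr/dt] by the angular
    speed without the factor [eps * r * sin ^ 2]. Treating [tau] as a free variable makes it a
    function on a compact rectangle, so uniform continuity controls all [t] and all small [eps] at
    once. *)
Definition ang_kernel (s tau : R) : R := f s / (w s + tau * f s).
Definition ang_kernel1 (s tau : R) : R := (f' s * w s - f s * w' s) / (w s + tau * f s) ^ 2.
Definition radial_rhs (eps t r : R) : R :=
  r * sin t ^ 2 * ang_kernel (r * cos t) (eps * (cos t * sin t)).
Definition radial_rhs1 (eps t r : R) : R :=
  sin t ^ 2 * (ang_kernel (r * cos t) (eps * (cos t * sin t))
    + (r * cos t) * ang_kernel1 (r * cos t) (eps * (cos t * sin t))).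

Lemma ang_kernel_derive s tau : Rabs s < S -> w s + tau * f s <> 0 ->
  is_derive (fun s => ang_kernel s tau) s (ang_kernel1 s tau).
Proof.
  intros Hs Hn. unfold ang_kernel, ang_kernel1.
  eapply is_derive_eq.
  - apply (is_derive_div f (fun s => w s + tau * f s) s (f' s) (w' s + (0 * f s + tau * f' s))); auto.
    apply (is_derive_Rplus w (fun s => tau * f s)); auto.
    apply (is_derive_Rmult (fun _ => tau) f); auto.
    apply is_derive_Rconst.
  - field. auto.
Qed.

Lemma radial_rhs_derive eps t r : Rabs r < S ->
  w (r * cos t) + eps * (cos t * sin t) * f (r * cos t) <> 0 ->
  is_derive (radial_rhs eps t) r (radial_rhs1 eps t r).
Proof.
  intros Hr Hn. unfold radial_rhs, radial_rhs1.
  apply (is_derive_eq _ _ (sin t ^ 2 * ang_kernel (r * cos t) (eps * (cos t * sin t))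
    + r * sin t ^ 2 * (ang_kernel1 (r * cos t) (eps * (cos t * sin t)) * cos t))); [|ring].
  apply (is_derive_Rmult (fun r => r * sin t ^ 2) (fun r => ang_kernel (r * cos t) (eps * (cos t * sin t)))).
  - auto_derive; auto. ring.
  - apply (is_derive_Rcomp (fun s => ang_kernel s (eps * (cos t * sin t))) (fun r => r * cos t)).
    + apply ang_kernel_derive; auto. eapply Rle_lt_trans; [apply abs_mult_cos|auto].
    + auto_derive; auto. ring.
Qed.

Lemma cont_pt_1st (g : R -> R) : cont_on S g ->
  forall s tau, Rabs s < S -> continuity_2d_pt (fun s _ => g s) s tau.
Proof.
  intros Hg s tau Hs. apply (continuity_1d_2d_pt_comp g (fun s _ => s)).
  - apply continuous_continuity_pt, Hg, Hs. - apply continuity_2d_pt_id1.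
Qed.

Definition denominators_pos (tau1 : R) : Prop :=
  0 < tau1 /\ exists c, 0 < c /\
    forall s tau, Rabs s <= r1 -> Rabs tau <= tau1 -> c <= w s + tau * f s.

Lemma denominators_gt tau1 : denominators_pos tau1 ->
  forall s tau, Rabs s <= r1 -> Rabs tau <= tau1 -> 0 < w s + tau * f s.
Proof. intros [_ [c [Pc Hc]]] s tau Hs Ht. specialize (Hc s tau Hs Ht). lra. Qed.

Hypothesis Hr01 : r0 <= r1.

Lemma f_cont_on : cont_on S f.
Proof. intros s Hs. exact (is_derive_continuous f s _ (Hf s Hs)). Qed.

Lemma w_cont_on : cont_on S w.
Proof. intros s Hs. exact (is_derive_continuous w s _ (Hw s Hs)). Qed.

Lemma denominators_pos_exist : exists tau1, denominators_pos tau1.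
Proof.
  destruct (continuous_bounded f (- r1) r1) as [A [PA HA]]; [lra| |].
  { intros x Hx. apply f_cont_on, Rabs_def1; lra. }
  destruct (continuous_pos_bound w (- r1) r1) as [c [Pc Hc]]; [lra| | |].
  { intros x Hx. apply w_cont_on, Rabs_def1; lra. }
  { intros x Hx. apply Hwpos, Rabs_def1; lra. }
  exists (c / (2 * A)). split; [apply Rdiv_lt_0_compat; lra|].
  exists (c / 2). split; [lra|].
  intros s tau Hs Ht. apply Rabs_le_between in Hs.
  specialize (HA s Hs). specialize (Hc s Hs).
  assert (Rabs (tau * f s) <= c / 2).
  { rewrite Rabs_mult. replace (c / 2) with (c / (2 * A) * A) by (field; lra).
    apply Rmult_le_compat; auto using Rabs_pos. }
  pose proof (Rle_abs (- (tau * f s))) as N. rewrite Rabs_Ropp in N. lra.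
Qed.

(** This is the [s]-derivative of [s * ang_kernel s tau]; at [s = r * cos t] it is what
    [radial_rhs1] multiplies by [sin t ^ 2]. *)
Definition radial_factor (s tau : R) : R := ang_kernel s tau + s * ang_kernel1 s tau.

Lemma kernels_continuous tau1 : denominators_pos tau1 ->
  forall s tau, Rabs s <= r1 -> Rabs tau <= tau1 ->
  continuity_2d_pt ang_kernel s tau /\ continuity_2d_pt radial_factor s tau.
Proof.
  intros Hd0 s tau Hs Ht. pose proof (denominators_gt tau1 Hd0 s tau Hs Ht) as Hd.
  assert (Cf : continuity_2d_pt (fun s _ => f s) s tau) by (apply cont_pt_1st; [apply f_cont_on|lra]).
  assert (Cw : continuity_2d_pt (fun s _ => w s) s tau) by (apply cont_pt_1st; [apply w_cont_on|lra]).
  assert (Cf' : continuity_2d_pt (fun s _ => f' s) s tau) by (apply cont_pt_1st; auto; lra).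
  assert (Cw' : continuity_2d_pt (fun s _ => w' s) s tau) by (apply cont_pt_1st; auto; lra).
  assert (Cd : continuity_2d_pt (fun s tau => w s + tau * f s) s tau).
  { apply continuity_2d_pt_plus; auto. apply continuity_2d_pt_mult; auto. apply continuity_2d_pt_id2. }
  assert (C1 : continuity_2d_pt ang_kernel s tau).
  { apply (continuity_2d_pt_mult (fun s _ => f s) (fun s tau => / (w s + tau * f s))); auto.
    apply (continuity_2d_pt_inv (fun s tau => w s + tau * f s)); auto. lra. }
  split; auto.
  apply (continuity_2d_pt_plus ang_kernel); auto.
  apply (continuity_2d_pt_mult (fun s _ => s)); [apply continuity_2d_pt_id1|].
  apply (continuity_2d_pt_mult (fun s _ => f' s * w s - f s * w' s)).
  - apply continuity_2d_pt_minus; now apply continuity_2d_pt_mult.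
  - apply (continuity_2d_pt_inv (fun s tau => (w s + tau * f s) ^ 2)).
    + apply (continuity_2d_pt_ext (fun s tau => (w s + tau * f s) * (w s + tau * f s))); [intros; ring|].
      now apply continuity_2d_pt_mult.
    + apply pow_nonzero; lra.
Qed.

Lemma kernels_unif tau1 : denominators_pos tau1 -> forall eta, 0 < eta ->
  exists d, 0 < d /\ d <= tau1 /\ forall s s' tau, Rabs s <= r1 -> Rabs s' <= r1 -> Rabs (s - s') < d ->
    Rabs tau < d ->
    Rabs (ang_kernel s tau - ang_kernel s' 0) < eta /\
    Rabs (radial_factor s tau - radial_factor s' 0) < eta.
Proof.
  intros Hd eta He. pose proof (kernels_continuous tau1 Hd) as Hc. destruct Hd as [Pt _].
  destruct (uniform_continuity_2d ang_kernel (- r1) r1 (- tau1) tau1) with (eps := mkposreal eta He) as [d1 H1].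
  { intros; apply Hc; apply Rabs_le_between; auto. }
  destruct (uniform_continuity_2d radial_factor (- r1) r1 (- tau1) tau1) with (eps := mkposreal eta He) as [d2 H2].
  { intros; apply Hc; apply Rabs_le_between; auto. }
  exists (Rmin tau1 (Rmin d1 d2)).
  pose proof (cond_pos d1). pose proof (cond_pos d2).
  split; [repeat apply Rmin_pos; auto|]. split; [apply Rmin_l|].
  intros s s' tau Hs Hs' Hss Ht.
  assert (Rmin tau1 (Rmin d1 d2) <= tau1) by apply Rmin_l.
  assert (Rmin tau1 (Rmin d1 d2) <= d1) by (eapply Rle_trans; [apply Rmin_r|apply Rmin_l]).
  assert (Rmin tau1 (Rmin d1 d2) <= d2) by (eapply Rle_trans; [apply Rmin_r|apply Rmin_r]).
  assert (-tau1 <= tau <= tau1) by (apply Rabs_le_between; lra).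
  assert (-tau1 <= 0 <= tau1) by lra.
  apply Rabs_le_between in Hs. apply Rabs_le_between in Hs'.
  split; [apply H1|apply H2]; auto; rewrite ?Rminus_0_r; lra.
Qed.

(** Only the slice [tau = 0] is bounded directly: uniform continuity keeps the slices with
    [Rabs tau <= d / 2] within [1] of it. *)
Lemma kernels_bounded : exists tau1 C, denominators_pos tau1 /\ 0 < C /\
  forall s tau, Rabs s <= r1 -> Rabs tau <= tau1 ->
    Rabs (ang_kernel s tau) <= C /\ Rabs (radial_factor s tau) <= C.
Proof.
  destruct denominators_pos_exist as [tau1 Hd].
  destruct (kernels_unif tau1 Hd 1 Rlt_0_1) as [d [Pd [Hd1 Hu]]].
  assert (C0 : forall g, (forall s, Rabs s <= r1 -> continuity_2d_pt g s 0) ->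
     forall s, - r1 <= s <= r1 -> continuous (fun s => g s 0) s).
  { intros g Hg s Hs. apply continuity_pt_filterlim.
    apply (continuity_pt_ext (fun s => g s 0)); [auto|].
    intros e He. destruct (Hg s ltac:(apply Rabs_le_between; lra) (mkposreal e He)) as [dd Hdd].
    exists dd. split; [apply cond_pos|]. intros y [_ Hy].
    apply Hdd; [exact Hy|]. rewrite Rminus_diag, Rabs_R0. apply cond_pos. }
  assert (Z : Rabs 0 <= tau1) by (rewrite Rabs_R0; apply Rlt_le, Hd).
  destruct (continuous_bounded (fun s => ang_kernel s 0) (- r1) r1) as [A [PA HA]]; [lra| |].
  { apply C0. intros s Hs. now apply (kernels_continuous tau1). }
  destruct (continuous_bounded (fun s => radial_factor s 0) (- r1) r1) as [B [PB HB]]; [lra| |].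
  { apply C0. intros s Hs. now apply (kernels_continuous tau1). }
  exists (d / 2), (A + B + 1). split; [split; [lra|]|split; [lra|]].
  - destruct Hd as [_ [c [Pc Hc]]]. exists c. split; auto. intros s tau Hs Ht. apply Hc; auto. lra.
  - intros s tau Hs Ht.
    destruct (Hu s s tau Hs Hs) as [U1 U2]; [rewrite Rminus_diag, Rabs_R0; lra|lra|].
    apply Rabs_le_between in Hs. specialize (HA s Hs). specialize (HB s Hs). cbv beta in *.
    split.
    + replace (ang_kernel s tau) with ((ang_kernel s tau - ang_kernel s 0) + ang_kernel s 0) by ring.
      eapply Rle_trans; [apply Rabs_triang|]. lra.
    + replace (radial_factor s tau) with ((radial_factor s tau - radial_factor s 0) + radial_factor s 0) by ring.
      eapply Rle_trans; [apply Rabs_triang|]. lra.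
Qed.

Definition radial_solution (eps : R) (p : R -> R) : Prop :=
  forall t, r0 <= p t <= r1 /\ is_derive p t (eps * radial_rhs eps t (p t)).

(** * Estimates for one and for two radial solutions *)

Section Bounds.
Variables tau1 C : R.
Hypothesis Hden : denominators_pos tau1.
Hypothesis HC : 0 < C.
Hypothesis Hbound : forall s tau, Rabs s <= r1 -> Rabs tau <= tau1 ->
    Rabs (ang_kernel s tau) <= C /\ Rabs (radial_factor s tau) <= C.

Lemma tau_small eps t : 0 <= eps -> eps <= tau1 -> Rabs (eps * (cos t * sin t)) <= eps.
Proof.
  intros H1 H2. rewrite Rabs_mult, (Rabs_right eps) by lra.
  pose proof (abs_cos_sin_le t). nra.
Qed.

Lemma radial_rhs1_bound eps t r : 0 <= eps -> eps <= tau1 -> Rabs r <= r1 ->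
  Rabs (radial_rhs1 eps t r) <= C.
Proof.
  intros H1 H2 Hr. pose proof (tau_small eps t H1 H2).
  unfold radial_rhs1. rewrite Rabs_mult, Rabs_right by (apply Rle_ge, sin2_bounds).
  pose proof (sin2_bounds t). pose proof (abs_mult_cos r t).
  destruct (Hbound (r * cos t) (eps * (cos t * sin t))) as [_ B]; try lra.
  unfold radial_factor in B. rewrite <- (Rmult_1_l C).
  apply Rmult_le_compat; try lra. apply Rabs_pos.
Qed.

Lemma radial_rhs_bound eps t r : 0 <= eps -> eps <= tau1 -> Rabs r <= r1 ->
  Rabs (radial_rhs eps t r) <= r1 * C.
Proof.
  intros H1 H2 Hr. pose proof (tau_small eps t H1 H2).
  unfold radial_rhs. rewrite !Rabs_mult, (Rabs_right (sin t ^ 2)) by (apply Rle_ge, sin2_bounds).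
  pose proof (sin2_bounds t). pose proof (abs_mult_cos r t).
  destruct (Hbound (r * cos t) (eps * (cos t * sin t))) as [B _]; try lra.
  pose proof (Rabs_pos r).
  apply Rmult_le_compat; auto using Rabs_pos.
  - apply Rmult_le_pos; lra.
  - rewrite <- (Rmult_1_r r1). apply Rmult_le_compat; lra.
Qed.

Lemma radial_rhs_derive' eps t r : 0 <= eps -> eps <= tau1 -> Rabs r <= r1 ->
  is_derive (radial_rhs eps t) r (radial_rhs1 eps t r).
Proof.
  intros H1 H2 Hr. apply radial_rhs_derive; [lra|].
  apply Rgt_not_eq, (denominators_gt tau1 Hden).
  - eapply Rle_trans; [apply abs_mult_cos|auto].
  - eapply Rle_trans; [apply tau_small|]; auto.
Qed.

Lemma radial_rhs_lip eps t a b : 0 <= eps -> eps <= tau1 -> 0 <= a <= r1 -> 0 <= b <= r1 ->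
  Rabs (radial_rhs eps t b - radial_rhs eps t a) <= C * Rabs (b - a).
Proof.
  intros H1 H2 Ha Hb.
  assert (K : forall x, Rmin a b <= x <= Rmax a b -> Rabs x <= r1).
  { intros x Hx. apply Rabs_le. unfold Rmin, Rmax in Hx. destruct Rle_dec; lra. }
  apply (derive_bound_lip_abs (radial_rhs eps t) (radial_rhs1 eps t)).
  - intros x Hx. apply radial_rhs_derive'; auto.
  - intros x Hx. apply radial_rhs1_bound; auto.
Qed.

Lemma radial_unique eps p1 p2 t0 : 0 <= eps -> eps <= tau1 ->
  radial_solution eps p1 -> radial_solution eps p2 -> p1 t0 = p2 t0 ->
  forall t, p1 t = p2 t.
Proof.
  intros H1 H2 S1 S2 E t.
  apply Rminus_diag_uniq.
  apply (gronwall_zero (fun t => p1 t - p2 t)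
    (fun t => eps * radial_rhs eps t (p1 t) - eps * radial_rhs eps t (p2 t)) (eps * C) t0).
  - intros s. apply is_derive_Rminus; [apply S1|apply S2].
  - intros s. rewrite <- Rmult_minus_distr_l, Rabs_mult, (Rabs_right eps), Rmult_assoc by lra.
    apply Rmult_le_compat_l; auto.
    destruct (S1 s) as [B1 _]. destruct (S2 s) as [B2 _].
    apply radial_rhs_lip; auto; lra.
  - rewrite E. ring.
Qed.

Lemma radial_continuous eps p : radial_solution eps p -> continuity p.
Proof.
  intros Hp t. apply continuous_continuity_pt. eapply is_derive_continuous, Hp.
Qed.

Lemma radial_order eps p1 p2 : 0 <= eps -> eps <= tau1 ->
  radial_solution eps p1 -> radial_solution eps p2 -> p1 0 < p2 0 ->
  forall t, p1 t < p2 t.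
Proof.
  intros H1 H2 S1 S2 L t. apply Rnot_le_lt. intros G.
  destruct (IVT_gen (fun t => p2 t - p1 t) 0 t 0) as [z [_ Hz]].
  - apply continuity_minus; eapply radial_continuous; eauto.
  - unfold Rmin, Rmax. destruct Rle_dec; lra.
  - assert (p1 0 = p2 0); [|lra]. apply (radial_unique eps p1 p2 z); auto. lra.
Qed.

Lemma radial_shift eps p : radial_solution eps p -> radial_solution eps (fun t => p (t + 2 * PI)).
Proof.
  intros Hp t. destruct (Hp (t + 2 * PI)) as [B D]. split; auto.
  apply (is_derive_eq _ _ (eps * radial_rhs eps (t + 2 * PI) (p (t + 2 * PI)) * 1)).
  - apply (is_derive_Rcomp p (fun t => t + 2 * PI)); auto. auto_derive; auto.
  - rewrite Rmult_1_r. unfold radial_rhs.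
    rewrite sin_plus, cos_plus, sin_2PI, cos_2PI. rewrite !Rmult_0_r, !Rmult_1_r, Rminus_0_r, Rplus_0_r.
    reflexivity.
Qed.

(** The shift by [2 * PI] is again a solution, and solutions of a scalar equation keep their order.
    If the first turn moved the radius up, every turn would, and the orbit could not close after
    [N + 1] turns; likewise downwards. *)
Lemma radial_periodic eps p (N : nat) : 0 <= eps -> eps <= tau1 ->
  radial_solution eps p -> p (INR (Datatypes.S N) * (2 * PI)) = p 0 -> forall t, p (t + 2 * PI) = p t.
Proof.
  intros H1 H2 Hp E. pose proof (radial_shift eps p Hp) as Hq.
  assert (Hinc : forall (g : nat -> R), (forall n, g n < g (Datatypes.S n)) -> g 0%nat < g (Datatypes.S N)).
  { intros g Hg. clear E. induction N; auto. eapply Rlt_trans; [apply IHN|apply Hg]. }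
  assert (Hs : forall n, INR n * (2 * PI) + 2 * PI = INR (Datatypes.S n) * (2 * PI)).
  { intros. rewrite S_INR. ring. }
  destruct (Rtotal_order (p 0) (p (0 + 2 * PI))) as [L|[L|L]].
  - exfalso. pose proof (radial_order eps p _ H1 H2 Hp Hq L) as O.
    pose proof (Hinc (fun n => p (INR n * (2 * PI)))) as I. cbv beta in I. change (INR 0) with 0 in I.
    rewrite Rmult_0_l in I.
    assert (p 0 < p (INR (Datatypes.S N) * (2 * PI))); [|lra].
    apply I. intros n. change (p (INR n * (2 * PI)) < p (INR (Datatypes.S n) * (2 * PI))).
    rewrite <- Hs. apply O.
  - intros t. symmetry. apply (radial_unique eps p (fun t => p (t + 2 * PI)) 0); auto.
  - exfalso. pose proof (radial_order eps _ p H1 H2 Hq Hp L) as O.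
    pose proof (Hinc (fun n => - p (INR n * (2 * PI)))) as I. cbv beta in I. change (INR 0) with 0 in I.
    rewrite Rmult_0_l in I.
    assert (- p 0 < - p (INR (Datatypes.S N) * (2 * PI))); [|lra].
    apply I. intros n. change (- p (INR n * (2 * PI)) < - p (INR (Datatypes.S n) * (2 * PI))).
    rewrite <- Hs. apply Ropp_lt_contravar, O.
Qed.

Lemma radial_rhs_path_continuous eps p : 0 <= eps -> eps <= tau1 -> radial_solution eps p ->
  forall t, continuous (fun t => radial_rhs eps t (p t)) t.
Proof.
  intros H1 H2 Hp t. unfold radial_rhs, ang_kernel.
  assert (Cp : continuous p t) by (eapply is_derive_continuous, Hp).
  assert (Hc : Rabs (p t * cos t) < S).
  { eapply Rle_lt_trans; [apply abs_mult_cos|]. destruct (Hp t) as [B _]. apply Rabs_def1; lra. }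
  assert (Cs : continuous (fun t => p t * cos t) t) by (apply continuous_Rmult; auto; apply continuous_cos).
  assert (Cf : continuous (fun t => f (p t * cos t)) t).
  { apply (continuous_comp (fun t => p t * cos t) f); auto. now apply f_cont_on. }
  assert (Cw : continuous (fun t => w (p t * cos t)) t).
  { apply (continuous_comp (fun t => p t * cos t) w); auto. now apply w_cont_on. }
  apply continuous_Rmult.
  - apply continuous_Rmult; auto. apply continuous_pow2, continuous_sin.
  - apply continuous_Rmult; auto.
    apply (continuous_comp (fun t => w (p t * cos t) + eps * (cos t * sin t) * f (p t * cos t)) Rinv).
    + apply continuous_Rplus; auto. apply continuous_Rmult; auto.
      apply continuous_Rmult; [apply continuous_const|].
      apply continuous_Rmult; [apply continuous_cos|apply continuous_sin].
    + apply continuous_Rinv, Rgt_not_eq, (denominators_gt tau1 Hden).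
      * eapply Rle_trans; [apply abs_mult_cos|]. destruct (Hp t) as [B _]. apply Rabs_le; lra.
      * eapply Rle_trans; [apply tau_small|]; auto.
Qed.

(** Closing up means that [eps] times the integral vanishes; division by [eps] leaves a condition
    that survives the limit [eps -> 0]. *)
Lemma radial_rhs_mean_zero eps p : 0 < eps -> eps <= tau1 -> radial_solution eps p ->
  p (2 * PI) = p 0 -> RInt (fun t => radial_rhs eps t (p t)) 0 (2 * PI) = 0.
Proof.
  intros H1 H2 Hp E. pose proof two_PI_bounds.
  assert (Cc := radial_rhs_path_continuous eps p (Rlt_le _ _ H1) H2 Hp).
  apply Rmult_eq_reg_l with eps; [|lra]. rewrite Rmult_0_r, <- RInt_Rscal.
  - transitivity (p (2 * PI) - p 0); [|rewrite E; ring].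
    apply is_RInt_unique.
    apply (is_RInt_derive p (fun t => eps * radial_rhs eps t (p t))).
    + intros; apply Hp. + intros; apply continuous_Rmult; auto. apply continuous_const.
  - apply ex_RInt_cont; [lra|]. auto.
Qed.

Lemma radial_rhs_0_continuous r : Rabs r < S -> forall t, continuous (fun t => radial_rhs 0 t r) t.
Proof.
  intros Hr t. apply (continuous_ext (fun t => r * sin t ^ 2 * (fun s => f s / w s) (r * cos t))).
  - intros x. unfold radial_rhs, ang_kernel. now rewrite !Rmult_0_l, Rplus_0_r.
  - apply (cont_sin2_integrand S (fun s => f s / w s)); auto. intros s Hs.
    apply continuous_Rmult; [now apply f_cont_on|].
    apply (continuous_comp w Rinv); [now apply w_cont_on|].
    apply continuous_Rinv. apply Rgt_not_eq. now apply Hwpos.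
Qed.

Lemma radial_rhs_0_mean r : RInt (fun t => radial_rhs 0 t r) 0 (2 * PI) = sin2_mean (fun s => f s / w s) r.
Proof.
  apply RInt_Rext. intros t. unfold radial_rhs, ang_kernel. now rewrite !Rmult_0_l, Rplus_0_r.
Qed.

Lemma radial_drift eps p : 0 <= eps -> eps <= tau1 -> radial_solution eps p ->
  forall t, 0 <= t <= 2 * PI -> Rabs (p t - p 0) <= 8 * (eps * (r1 * C)).
Proof.
  intros H1 H2 Hp t Ht. pose proof two_PI_bounds.
  assert (0 <= eps * (r1 * C)) by (apply Rmult_le_pos; nra).
  eapply Rle_trans; [apply (derive_bound_lip p (fun t => eps * radial_rhs eps t (p t)) 0 t (eps * (r1 * C)))|].
  - lra. - intros; apply Hp.
  - intros s _. destruct (Hp s) as [B _]. rewrite Rabs_mult, (Rabs_right eps) by lra.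
    apply Rmult_le_compat_l; auto. apply radial_rhs_bound; auto. apply Rabs_le; lra.
  - nra.
Qed.

(** By Gronwall the gap grows at most by [exp (8 * eps * C) <= exp 1 <= 3]; integrating the
    Lipschitz bound over length at most [8] with this factor gives the [24]. *)
Lemma radial_gap eps p1 p2 : 0 <= eps -> eps <= tau1 -> 8 * (eps * C) <= 1 ->
  radial_solution eps p1 -> radial_solution eps p2 -> p1 0 < p2 0 ->
  forall t, 0 <= t <= 2 * PI ->
   0 < p2 t - p1 t <= 3 * (p2 0 - p1 0) /\
   Rabs ((p2 t - p1 t) - (p2 0 - p1 0)) <= 24 * (eps * C) * (p2 0 - p1 0).
Proof.
  intros H1 H2 H3 S1 S2 L. pose proof two_PI_bounds as HPI.
  pose proof (radial_order eps p1 p2 H1 H2 S1 S2 L) as O.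
  assert (HeC : 0 <= eps * C) by (apply Rmult_le_pos; lra).
  assert (D : forall t, is_derive (fun t => p2 t - p1 t) t
    (eps * radial_rhs eps t (p2 t) - eps * radial_rhs eps t (p1 t))).
  { intros t. apply is_derive_Rminus; [apply S2|apply S1]. }
  assert (B : forall t, Rabs (eps * radial_rhs eps t (p2 t) - eps * radial_rhs eps t (p1 t))
     <= eps * C * (p2 t - p1 t)).
  { intros t. specialize (O t). rewrite <- Rmult_minus_distr_l, Rabs_mult, (Rabs_right eps), Rmult_assoc by lra.
    apply Rmult_le_compat_l; auto. rewrite <- (Rabs_right (p2 t - p1 t)) by lra.
    destruct (S1 t) as [B1 _]. destruct (S2 t) as [B2 _]. apply radial_rhs_lip; auto; lra. }
  assert (G : forall t, 0 <= t <= 2 * PI -> p2 t - p1 t <= 3 * (p2 0 - p1 0)).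
  { intros t Ht.
    pose proof (gronwall_growth (fun t => p2 t - p1 t) _ (eps * C) 0 t (proj1 Ht)
      (fun t _ => D t) (fun t _ => Rle_trans _ _ _ (Rle_abs _) (B t))) as E.
    cbv beta in E.
    assert (exp (eps * C * (t - 0)) <= 3).
    { eapply Rle_trans; [|apply exp_le_3].
      assert (eps * C * (t - 0) <= 1) as [Q|Q] by nra.
      - apply Rlt_le, exp_increasing, Q. - rewrite Q. lra. }
    nra. }
  intros t Ht. specialize (O t). split; [split; [lra|now apply G]|].
  eapply Rle_trans; [apply (derive_bound_lip (fun t => p2 t - p1 t) _ 0 t (eps * C * (3 * (p2 0 - p1 0))) (proj1 Ht) (fun t _ => D t))|].
  - intros s Hs. eapply Rle_trans; [apply B|]. apply Rmult_le_compat_l; auto. apply G; lra.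
  - replace (24 * (eps * C) * (p2 0 - p1 0)) with (eps * C * (3 * (p2 0 - p1 0)) * 8) by ring.
    apply Rmult_le_compat_l; [|lra]. apply Rmult_le_pos; lra.
Qed.

(** Both integrals along the closed solutions vanish, so [M] equals minus the error made by freezing
    the solution at its initial radius and setting [eps = 0] in the kernel. For one solution the
    error is drift plus [eta']; for two, the difference of errors has to carry the factor
    [p2 0 - p1 0]. *)
Lemma radial_two_solutions_aux eta' d eps p1 p2 :
  0 < eta' -> 0 < eps -> eps <= tau1 -> 8 * (eps * C) <= 1 -> 8 * (eps * (r1 * C)) < d -> eps < d ->
  (forall s s' tau, Rabs s <= r1 -> Rabs s' <= r1 -> Rabs (s - s') < d -> Rabs tau < d ->
    Rabs (ang_kernel s tau - ang_kernel s' 0) < eta' /\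
    Rabs (radial_factor s tau - radial_factor s' 0) < eta') ->
  radial_solution eps p1 -> radial_solution eps p2 -> p1 0 < p2 0 ->
  p1 (2 * PI) = p1 0 -> p2 (2 * PI) = p2 0 ->
  let M := sin2_mean (fun s => f s / w s) in
  Rabs (M (p1 0)) <= 8 * (8 * (eps * (r1 * C)) * C + r1 * eta') /\
  Rabs (M (p2 0) - M (p1 0)) <= 8 * (3 * eta' + 24 * (eps * C) * C) * (p2 0 - p1 0).
Proof.
  intros He' He1 He2 He3 He4 He5 Hu S1 S2 L E1 E2 M.
  pose proof two_PI_bounds as HPI.
  pose proof (proj1 (S1 0)) as I1. pose proof (proj1 (S2 0)) as I2.
  pose proof (radial_drift eps p1 (Rlt_le _ _ He1) He2 S1) as D1.
  pose proof (radial_drift eps p2 (Rlt_le _ _ He1) He2 S2) as D2.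
  pose proof (radial_gap eps p1 p2 (Rlt_le _ _ He1) He2 He3 S1 S2 L) as G.
  pose proof (radial_rhs_mean_zero eps p1 He1 He2 S1 E1) as Z1.
  pose proof (radial_rhs_mean_zero eps p2 He1 He2 S2 E2) as Z2.
  assert (JM : forall r, 0 <= r <= r1 -> ex_RInt (fun t => radial_rhs 0 t r) 0 (2 * PI)).
  { intros r Hr. apply ex_RInt_cont; [lra|]. intros. apply radial_rhs_0_continuous, Rabs_def1; lra. }
  assert (Jp : forall p, radial_solution eps p -> ex_RInt (fun t => radial_rhs eps t (p t)) 0 (2 * PI)).
  { intros p Hp. apply ex_RInt_cont; [lra|]. intros. apply radial_rhs_path_continuous; auto; lra. }
  assert (T0 : 0 < tau1) by apply Hden.
  assert (Htau : forall t, Rabs (eps * (cos t * sin t)) <= eps) by (intros; apply tau_small; lra).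
  assert (Hcos : forall r t, 0 <= r <= r1 -> Rabs (r * cos t) <= r1).
  { intros r t Hr. eapply Rle_trans; [apply abs_mult_cos|]. apply Rabs_le; lra. }
  assert (Hcd : forall a b t, Rabs (a - b) <= 8 * (eps * (r1 * C)) -> Rabs (a * cos t - b * cos t) < d).
  { intros a b t Hab. rewrite <- Rmult_minus_distr_r. eapply Rle_lt_trans; [apply abs_mult_cos|]. lra. }
  split.
  - unfold M. rewrite <- radial_rhs_0_mean.
    replace (RInt (fun t => radial_rhs 0 t (p1 0)) 0 (2 * PI)) with
      (RInt (fun t => radial_rhs 0 t (p1 0)) 0 (2 * PI) - RInt (fun t => radial_rhs eps t (p1 t)) 0 (2 * PI))
      by (rewrite Z1; ring).
    rewrite <- RInt_Rminus by (auto; apply JM; lra).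
    apply Rle_trans with ((2 * PI - 0) * (8 * (eps * (r1 * C)) * C + r1 * eta')).
    + apply abs_RInt_le_const; [lra| |].
      { apply (ex_RInt_minus (V := R_NormedModule)); auto. apply JM; lra. }
      intros t Ht. destruct (S1 t) as [B1 _]. specialize (D1 t Ht).
      unfold radial_rhs. rewrite !Rmult_0_l.
      destruct (Hu (p1 t * cos t) (p1 0 * cos t) (eps * (cos t * sin t))) as [U _].
      { apply Hcos; lra. } { apply Hcos; lra. } { now apply Hcd. } { specialize (Htau t); lra. }
      destruct (Hbound (p1 0 * cos t) 0) as [V _]; [apply Hcos; lra|rewrite Rabs_R0; lra|].
      set (k0 := ang_kernel (p1 0 * cos t) 0) in *. set (k := ang_kernel (p1 t * cos t) _) in *.
      replace (_ - _) with (sin t ^ 2 * (- ((p1 t - p1 0) * k0 + p1 t * (k - k0)))) by ring.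
      pose proof (sin2_bounds t).
      rewrite Rabs_mult, (Rabs_right (sin t ^ 2)), Rabs_Ropp by lra.
      rewrite <- (Rmult_1_l (8 * _ * C + _)). apply Rmult_le_compat; try lra; try apply Rabs_pos.
      eapply Rle_trans; [apply Rabs_triang|]. rewrite !Rabs_mult.
      apply Rplus_le_compat; apply Rmult_le_compat; auto using Rabs_pos; try lra.
      apply Rabs_le; lra.
    + apply Rmult_le_compat_r; [|lra].
      assert (0 <= eps * (r1 * C)) by (apply Rmult_le_pos; nra). nra.
  - set (D0 := p2 0 - p1 0) in *.
    assert (PD0 : 0 < D0) by (unfold D0; lra).
    unfold M. rewrite <- !radial_rhs_0_mean. rewrite <- RInt_Rminus by (apply JM; lra).
    assert (J0 : ex_RInt (fun t => radial_rhs 0 t (p2 0) - radial_rhs 0 t (p1 0)) 0 (2 * PI)).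
    { apply (ex_RInt_minus (V := R_NormedModule)); apply JM; lra. }
    assert (J1 : ex_RInt (fun t => radial_rhs eps t (p2 t) - radial_rhs eps t (p1 t)) 0 (2 * PI)).
    { apply (ex_RInt_minus (V := R_NormedModule)); auto. }
    assert (Z : RInt (fun t => radial_rhs eps t (p2 t) - radial_rhs eps t (p1 t)) 0 (2 * PI) = 0).
    { rewrite RInt_Rminus, Z1, Z2 by auto. apply Rminus_0_r. }
    replace (RInt (fun t => radial_rhs 0 t (p2 0) - radial_rhs 0 t (p1 0)) 0 (2 * PI)) with
      (- (RInt (fun t => radial_rhs eps t (p2 t) - radial_rhs eps t (p1 t)) 0 (2 * PI)
          - RInt (fun t => radial_rhs 0 t (p2 0) - radial_rhs 0 t (p1 0)) 0 (2 * PI)))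
      by (rewrite Z; ring).
    rewrite Rabs_Ropp, <- RInt_Rminus by auto.
    apply Rle_trans with ((2 * PI - 0) * ((3 * eta' + 24 * (eps * C) * C) * D0)).
    + apply abs_RInt_le_const; [lra| |].
      { now apply (ex_RInt_minus (V := R_NormedModule)). }
      intros t Ht. destruct (S1 t) as [B1 _]. destruct (S2 t) as [B2 _].
      specialize (D1 t Ht). specialize (D2 t Ht). destruct (G t Ht) as [[G1 G2] G3].
      set (D := p2 t - p1 t) in *.
      (* A single mean value for the difference puts the same [h] on both segments. The two
         intermediate radii are then within the drift of each other, so [radial_rhs1] is compared at
         nearby points and every term carries [D] or [D - D0], both of order [D0]. *)
      set (psi := fun h => radial_rhs eps t (p1 t + h * D) - radial_rhs 0 t (p1 0 + h * D0)).
      destruct (MVT_derive psi (fun h => radial_rhs1 eps t (p1 t + h * D) * D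
         - radial_rhs1 0 t (p1 0 + h * D0) * D0) 0 1) as [h [Hh Eh]]; [lra| |].
      { intros h Hh. unfold psi. apply is_derive_Rminus.
        - apply (is_derive_Rcomp (radial_rhs eps t) (fun h => p1 t + h * D)).
          + apply radial_rhs_derive'; try lra. apply Rabs_le. unfold D; nra.
          + auto_derive; auto. ring.
        - apply (is_derive_Rcomp (radial_rhs 0 t) (fun h => p1 0 + h * D0)).
          + apply radial_rhs_derive'; try lra. apply Rabs_le. unfold D0; nra.
          + auto_derive; auto. ring. }
      replace (_ - _ - _) with (psi 1 - psi 0).
      2:{ unfold psi, D, D0. rewrite !Rmult_0_l, !Rmult_1_l, !Rplus_0_r.
          replace (p1 t + (p2 t - p1 t)) with (p2 t) by ring.
          replace (p1 0 + (p2 0 - p1 0)) with (p2 0) by ring. ring. }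
      rewrite Eh. set (x := p1 t + h * D) in *. set (y := p1 0 + h * D0) in *.
      assert (Hx : 0 <= x <= r1) by (unfold x, D; nra).
      assert (Hy : 0 <= y <= r1) by (unfold y, D0; nra).
      assert (Hxy : Rabs (x - y) <= 8 * (eps * (r1 * C))).
      { replace (x - y) with ((1 - h) * (p1 t - p1 0) + h * (p2 t - p2 0)) by (unfold x, y, D, D0; ring).
        eapply Rle_trans; [apply Rabs_triang|]. rewrite !Rabs_mult, (Rabs_right (1 - h)), (Rabs_right h) by lra.
        nra. }
      destruct (Hu (x * cos t) (y * cos t) (eps * (cos t * sin t))) as [_ U].
      { apply Hcos; lra. } { apply Hcos; lra. } { now apply Hcd. } { specialize (Htau t); lra. }
      pose proof (radial_rhs1_bound 0 t y (Rle_refl 0) (Rlt_le _ _ T0) ltac:(apply Rabs_le; lra)) as V.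
      replace (_ * (1 - 0)) with ((radial_rhs1 eps t x - radial_rhs1 0 t y) * D + radial_rhs1 0 t y * (D - D0)) by ring.
      assert (W : Rabs (radial_rhs1 eps t x - radial_rhs1 0 t y) <= eta').
      { unfold radial_rhs1. rewrite !Rmult_0_l.
        fold (radial_factor (x * cos t) (eps * (cos t * sin t))). fold (radial_factor (y * cos t) 0).
        rewrite <- Rmult_minus_distr_l, Rabs_mult. pose proof (sin2_bounds t).
        rewrite (Rabs_right (sin t ^ 2)) by lra. rewrite <- (Rmult_1_l eta').
        apply Rmult_le_compat; try lra. apply Rabs_pos. }
      eapply Rle_trans; [apply Rabs_triang|]. rewrite !Rabs_mult, (Rabs_right D) by lra.
      assert (Q1 : Rabs (radial_rhs1 eps t x - radial_rhs1 0 t y) * D <= eta' * (3 * D0)).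
      { apply Rmult_le_compat; try lra. apply Rabs_pos. }
      assert (Q2 : Rabs (radial_rhs1 0 t y) * Rabs (D - D0) <= C * (24 * (eps * C) * D0)).
      { apply Rmult_le_compat; try lra; apply Rabs_pos. }
      lra.
    + rewrite (Rmult_assoc 8). apply Rmult_le_compat_r; [|lra].
      assert (0 <= eps * C * C) by (repeat apply Rmult_le_pos; lra).
      apply Rmult_le_pos; lra.
Qed.

End Bounds.

Lemma radial_two_solutions : forall eta, 0 < eta -> exists eps0, 0 < eps0 /\
  forall eps, 0 < eps < eps0 ->
  (forall p (N : nat), radial_solution eps p -> p (INR (Datatypes.S N) * (2 * PI)) = p 0 ->
     forall t, p (t + 2 * PI) = p t) /\
  (forall p1 p2, radial_solution eps p1 -> radial_solution eps p2 -> p1 0 = p2 0 ->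
     forall t, p1 t = p2 t) /\
  (forall p1 p2, radial_solution eps p1 -> radial_solution eps p2 -> p1 0 < p2 0 ->
    p1 (2 * PI) = p1 0 -> p2 (2 * PI) = p2 0 ->
    let M := sin2_mean (fun s => f s / w s) in
    Rabs (M (p1 0)) <= eta /\ Rabs (M (p2 0) - M (p1 0)) <= eta * (p2 0 - p1 0)) /\
  (exists c, 0 < c /\ forall s t, Rabs s <= r1 -> c <= w s + eps * (cos t * sin t) * f s).
Proof.
  intros eta He.
  destruct kernels_bounded as [tau1 [C [Hden [HC HB]]]].
  (* This gives [8 * r1 * eta' <= eta / 6] and [24 * eta' <= eta / 2], the parts of the two errors
     that do not involve [eps]. *)
  set (eta' := eta / (48 * (r1 + 1))).
  assert (He' : 0 < eta') by (apply Rdiv_lt_0_compat; lra).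
  destruct (kernels_unif tau1 Hden eta' He') as [d [Pd [Hd1 Hu]]].
  (* [B] gathers the side conditions [8 * eps * C <= 1], [8 * eps * r1 * C < d] and [eps < d]. [A]
     below is twice the sum of the coefficients [64 * r1 * C ^ 2] and [192 * C ^ 2] of [eps] in the
     two errors, so each of them gets at most [eta / 2]. *)
  set (B := 8 * C + 8 * (r1 * C) + 1).
  assert (Prc : 0 < r1 * C) by (apply Rmult_lt_0_compat; lra).
  set (A := 128 * (r1 * C * C) + 384 * (C * C)).
  assert (PA : 0 < A). { unfold A. assert (0 < C * C) by (now apply Rmult_lt_0_compat). nra. }
  set (e := Rmin (Rmin d 1 / B) (eta / A)).
  assert (Pe : 0 < e).
  { unfold e. apply Rmin_pos; apply Rdiv_lt_0_compat; auto; [apply Rmin_pos; lra|unfold B; lra]. }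
  assert (E1 : e <= Rmin d 1 / B) by apply Rmin_l.
  assert (E2 : e <= eta / A) by apply Rmin_r.
  assert (PB : 1 < B) by (unfold B; lra).
  assert (F1 : e * B <= Rmin d 1).
  { apply Rmult_le_reg_r with (/ B); [apply Rinv_0_lt_compat; lra|].
    rewrite Rmult_assoc, Rinv_r by lra. rewrite Rmult_1_r. exact E1. }
  assert (F2 : e * A <= eta).
  { apply Rmult_le_reg_r with (/ A); [apply Rinv_0_lt_compat; lra|].
    rewrite Rmult_assoc, Rinv_r by lra. rewrite Rmult_1_r. exact E2. }
  assert (F3 : e * B <= d) by (eapply Rle_trans; [apply F1|apply Rmin_l]).
  assert (F4 : e * B <= 1) by (eapply Rle_trans; [apply F1|apply Rmin_r]).
  unfold B in F3, F4. unfold A in F2.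
  exists e. split; auto. intros eps [Q1 Q2].
  assert (R1 : eps * C <= e * C) by nra.
  assert (R2 : eps * (r1 * C) < e * (r1 * C)) by nra.
  assert (P1 : 0 < e * C) by nra. assert (P2 : 0 < e * (r1 * C)) by nra.
  assert (R3 : eps <= tau1) by nra.
  split; [|split; [|split]].
  - intros p N Hp E. now apply (radial_periodic tau1 C Hden HB eps p N); auto; try lra.
  - intros p1 p2 S1 S2 E. apply (radial_unique tau1 C Hden HB eps p1 p2 0); auto; lra.
  - intros p1 p2 S1 S2 L T1 T2.
    destruct (radial_two_solutions_aux tau1 C Hden HC HB eta' d eps p1 p2) as [K1 K2]; auto; try lra; try nra.
    assert (X1 : r1 * eta' <= eta / 48 /\ eta' <= eta / 48).
    { unfold eta'.
      assert (r1 * (eta / (48 * (r1 + 1))) = eta / 48 - eta / (48 * (r1 + 1))) by (field; lra).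
      assert (0 < r1 * (eta / (48 * (r1 + 1)))) by (apply Rmult_lt_0_compat; [lra|exact He']).
      assert (0 < eta / (48 * (r1 + 1))) by exact He'. lra. }
    assert (X2 : eps * (r1 * C * C) <= e * (r1 * C * C)) by (apply Rmult_le_compat_r; nra).
    assert (X3 : eps * (C * C) <= e * (C * C)) by (apply Rmult_le_compat_r; nra).
    assert (X4 : 0 <= e * (r1 * C * C)) by (apply Rmult_le_pos; nra).
    assert (X5 : 0 <= e * (C * C)) by (apply Rmult_le_pos; nra).
    split.
    + eapply Rle_trans; [apply K1|]. lra.
    + eapply Rle_trans; [apply K2|]. apply Rmult_le_compat_r; [lra|]. lra.
  - destruct Hden as [_ [c [Pc Hc]]]. exists c. split; auto.
    intros s t Hs. apply Hc; auto. eapply Rle_trans; [apply (tau_small tau1); lra|lra].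
Qed.

End Radial.

(** * Polar coordinates along an orbit *)

Lemma unit_circle_angle (a b : R) : a ^ 2 + b ^ 2 = 1 -> exists th, cos th = a /\ sin th = b.
Proof.
  intros H. assert (Ha : -1 <= a <= 1) by (split; nra).
  destruct (Rle_dec 0 b) as [Hb|Hb].
  - exists (acos a). split; [now apply cos_acos|].
    rewrite sin_acos by auto. replace (1 - a²) with (b²) by (unfold Rsqr; nra).
    now apply sqrt_Rsqr.
  - exists (- acos a). rewrite cos_neg, sin_neg. split; [now apply cos_acos|].
    rewrite sin_acos by auto. replace (1 - a²) with ((- b)²) by (unfold Rsqr; nra).
    rewrite sqrt_Rsqr by lra. ring.
Qed.

Lemma full_turns (a b : R) : a < b -> cos b = cos a -> sin b = sin a ->
  exists N, b = a + INR (S N) * (2 * PI).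
Proof.
  intros Hab Hc Hs. pose proof PI_RGT_0 as HPI.
  assert (E : sin ((b - a) / 2) = 0).
  { assert (C : cos (2 * ((b - a) / 2)) = 1).
    { replace (2 * ((b - a) / 2)) with (b - a) by field.
      rewrite cos_minus, Hc, Hs. pose proof (sin2_cos2 a) as T. unfold Rsqr in T. lra. }
    rewrite cos_2a_sin in C. nra. }
  apply sin_eq_0_0 in E. destruct E as [k Hk].
  assert (Hk' : b = a + IZR k * (2 * PI)) by lra.
  assert (0 < k)%Z.
  { apply lt_IZR. apply Rnot_le_lt. intros Q. nra. }
  exists (pred (Z.to_nat k)). rewrite Hk'. f_equal. f_equal.
  replace (S (pred (Z.to_nat k))) with (Z.to_nat k) by lia.
  rewrite INR_IZR_INZ. f_equal. lia.
Qed.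

Lemma is_derive_primitive (h : R -> R) : (forall t, continuous h t) ->
  forall t, is_derive (fun t => RInt h 0 t) t (h t).
Proof.
  intros Hc t. apply (is_derive_RInt h (fun t => RInt h 0 t) 0).
  - apply filter_forall. intros b. apply (RInt_correct (V := R_CompleteNormedModule)), (ex_RInt_continuous (V := R_CompleteNormedModule)). auto.
  - apply Hc.
Qed.

(** The angle is defined as a primitive of the angular speed, which avoids gluing branches of an
    inverse trigonometric function. The sign in [y = - r sin th] makes the angle increase along the
    flow. *)
Lemma polar_lift (s y ds dy : R -> R) :
  (forall t, is_derive s t (ds t)) -> (forall t, is_derive y t (dy t)) ->
  (forall t, continuous ds t) -> (forall t, continuous dy t) ->
  (forall t, 0 < s t ^ 2 + y t ^ 2) ->
  exists th : R -> R,
    (forall t, is_derive th t ((y t * ds t - s t * dy t) / (s t ^ 2 + y t ^ 2))) /\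
    (forall t, s t = sqrt (s t ^ 2 + y t ^ 2) * cos (th t)) /\
    (forall t, y t = - (sqrt (s t ^ 2 + y t ^ 2) * sin (th t))).
Proof.
  intros Hs Hy Cs Cy Hp.
  set (n := fun t => s t ^ 2 + y t ^ 2). set (r := fun t => sqrt (n t)).
  assert (Hn : forall t, 0 < n t) by auto.
  assert (Hr : forall t, 0 < r t) by (intros; apply sqrt_lt_R0; auto).
  assert (Er : forall t, r t * r t = n t) by (intros; apply sqrt_def, Rlt_le; auto).
  set (om := fun t => (y t * ds t - s t * dy t) / n t).
  assert (Ds : forall t, continuous s t) by (intros; eapply is_derive_continuous; auto).
  assert (Dy : forall t, continuous y t) by (intros; eapply is_derive_continuous; auto).
  assert (Co : forall t, continuous om t).
  { intros t. unfold om. apply continuous_Rmult.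
    - apply (continuous_minus (V := R_NormedModule)); apply continuous_Rmult; auto.
    - apply (continuous_comp n Rinv).
      + apply continuous_Rplus; apply continuous_pow2; auto.
      + apply continuous_Rinv, Rgt_not_eq, Hn. }
  destruct (unit_circle_angle (s 0 / r 0) (- y 0 / r 0)) as [th0 [C0 S0]].
  { specialize (Hr 0). specialize (Er 0). field_simplify; [|lra].
    replace (r 0 ^ 2) with (s 0 ^ 2 + y 0 ^ 2) by (change (s 0 ^ 2 + y 0 ^ 2) with (n 0); rewrite <- Er; ring).
    field. apply Rgt_not_eq, Hn. }
  set (th := fun t => th0 + RInt om 0 t).
  assert (Dth : forall t, is_derive th t (om t)).
  { intros t. apply (is_derive_eq _ _ (0 + om t)); [|ring].
    apply is_derive_Rplus; [apply is_derive_Rconst|].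
    now apply is_derive_primitive. }
  assert (Dn : forall t, is_derive n t (2 * (s t * ds t + y t * dy t))).
  { intros t. unfold n. apply (is_derive_ext (fun t => s t * s t + y t * y t)); [intros; simpl; ring|].
    apply (is_derive_eq _ _ ((ds t * s t + s t * ds t) + (dy t * y t + y t * dy t))); [|ring].
    apply is_derive_Rplus; now apply is_derive_Rmult. }
  assert (Dr : forall t, is_derive (fun t => / r t) t (- ((s t * ds t + y t * dy t) / r t) / (r t) ^ 2)).
  { intros t. apply (is_derive_inv r t); [|apply Rgt_not_eq, Hr].
    eapply is_derive_eq; [apply (is_derive_sqrt n t); auto|]. fold (r t). field. apply Rgt_not_eq, Hr. }
  assert (Dc : forall t, is_derive (fun t => cos (th t)) t (- sin (th t) * om t)).
  { intros t. apply (is_derive_Rcomp cos th); auto. apply is_derive_Reals, derivable_pt_lim_cos. }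
  assert (Dsn : forall t, is_derive (fun t => sin (th t)) t (cos (th t) * om t)).
  { intros t. apply (is_derive_Rcomp sin th); auto. apply is_derive_Reals, derivable_pt_lim_sin. }
  assert (Th0 : th 0 = th0) by (unfold th; rewrite RInt_point; apply Rplus_0_r).
  (* [Ka] and [Kb] state that [(s, y) / r], rotated by [th], is the constant vector [(1, 0)]: it is
     so at time [0], and its derivative vanishes. *)
  assert (Ka : forall t, (s t * cos (th t) - y t * sin (th t)) * / r t = 1).
  { intros t. transitivity ((s 0 * cos (th 0) - y 0 * sin (th 0)) * / r 0).
    - apply (derive_zero_const (fun t => (s t * cos (th t) - y t * sin (th t)) * / r t)).
      clear t. intros t. eapply is_derive_eq.
      + apply (is_derive_Rmult (fun t => s t * cos (th t) - y t * sin (th t)) (fun t => / r t)); [|apply Dr].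
        apply (is_derive_Rminus (fun t => s t * cos (th t)) (fun t => y t * sin (th t))).
        * apply (is_derive_Rmult s (fun t => cos (th t))); auto.
        * apply (is_derive_Rmult y (fun t => sin (th t))); auto.
      + unfold om. rewrite <- Er. cbv beta. specialize (Hr t).
        specialize (Er t). unfold n in Er.
        apply Rmult_eq_reg_r with (r t ^ 3); [|apply pow_nonzero; lra].
        field_simplify; [|lra].
        replace (r t ^ 2) with (s t ^ 2 + y t ^ 2) by (rewrite <- Er; ring). ring.
    - rewrite Th0, C0, S0. specialize (Hr 0). specialize (Er 0). unfold n in Er.
      field_simplify; [|lra]. replace (r 0 ^ 2) with (s 0 ^ 2 + y 0 ^ 2) by (rewrite <- Er; ring).
      field. apply Rgt_not_eq, Hn. }
  assert (Kb : forall t, (s t * sin (th t) + y t * cos (th t)) * / r t = 0).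
  { intros t. transitivity ((s 0 * sin (th 0) + y 0 * cos (th 0)) * / r 0).
    - apply (derive_zero_const (fun t => (s t * sin (th t) + y t * cos (th t)) * / r t)).
      clear t. intros t. eapply is_derive_eq.
      + apply (is_derive_Rmult (fun t => s t * sin (th t) + y t * cos (th t)) (fun t => / r t)); [|apply Dr].
        apply (is_derive_Rplus (fun t => s t * sin (th t)) (fun t => y t * cos (th t))).
        * apply (is_derive_Rmult s (fun t => sin (th t))); auto.
        * apply (is_derive_Rmult y (fun t => cos (th t))); auto.
      + unfold om. rewrite <- Er. cbv beta. specialize (Hr t).
        specialize (Er t). unfold n in Er.
        apply Rmult_eq_reg_r with (r t ^ 3); [|apply pow_nonzero; lra].
        field_simplify; [|lra].
        replace (r t ^ 2) with (s t ^ 2 + y t ^ 2) by (rewrite <- Er; ring). ring.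
    - rewrite Th0, C0, S0. specialize (Hr 0). field. lra. }
  exists th. split; [exact Dth|].
  assert (K : forall t, s t * cos (th t) - y t * sin (th t) = r t /\ s t * sin (th t) + y t * cos (th t) = 0).
  { intros t. specialize (Ka t). specialize (Kb t). specialize (Hr t).
    split; apply Rmult_eq_reg_r with (/ r t); try (apply Rinv_neq_0_compat; lra).
    - rewrite Ka. field. lra. - rewrite Kb. ring. }
  split; intros t; destruct (K t) as [K1 K2]; pose proof (sin2_cos2 (th t)) as T; unfold Rsqr in T;
    change (sqrt (s t ^ 2 + y t ^ 2)) with (r t); rewrite <- K1.
  - transitivity (s t * (sin (th t) * sin (th t) + cos (th t) * cos (th t))); [rewrite T; ring|].
    replace (s t * (sin (th t) * sin (th t) + cos (th t) * cos (th t))) with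
      ((s t * sin (th t) + y t * cos (th t)) * sin (th t) + (s t * cos (th t) - y t * sin (th t)) * cos (th t)) by ring.
    rewrite K2. ring.
  - transitivity (y t * (sin (th t) * sin (th t) + cos (th t) * cos (th t))); [rewrite T; ring|].
    replace (y t * (sin (th t) * sin (th t) + cos (th t) * cos (th t))) with
      ((s t * sin (th t) + y t * cos (th t)) * cos (th t) - (s t * cos (th t) - y t * sin (th t)) * sin (th t)) by ring.
    rewrite K2. ring.
Qed.

Section OrbitRadial.
Variables beta m l : R.
Hypothesis Hbeta : 0 < beta.
Hypothesis Hm : 0 < m.
Hypothesis Hl : m <= l.
Variable X : R -> R.
Local Notation Smax := (sg beta m l m).
Hypothesis HX : forall s, Rabs s < Smax ->
  - l < X s < m /\ sg beta m l (X s) = s /\ is_derive X s (/ om beta m l (X s)).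
Hypothesis HX' : forall x, - l < x < m -> Rabs (sg beta m l x) < Smax -> X (sg beta m l x) = x.
Variables F F' : R -> R.
Hypothesis HF : forall x, is_derive F x (F' x).
Hypothesis HF' : forall x, continuous F' x.

Definition ang_om (s : R) : R := om beta m l (X s).
Definition ang_om1 (s : R) : R := om1 beta m l (X s) / om beta m l (X s).
Definition damp (s : R) : R := F (X s).
Definition damp1 (s : R) : R := F' (X s) / om beta m l (X s).

Lemma ang_om_pos s : Rabs s < Smax -> 0 < ang_om s.
Proof. intros Hs. destruct (HX s Hs) as [A _]. now apply om_pos. Qed.

Lemma ang_om_derive s : Rabs s < Smax -> is_derive ang_om s (ang_om1 s).
Proof.
  intros Hs. destruct (HX s Hs) as [A [_ D]].
  apply (is_derive_Rcomp (om beta m l) X); auto. apply om_derive; auto; lra.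
Qed.

Lemma damp_derive s : Rabs s < Smax -> is_derive damp s (damp1 s).
Proof.
  intros Hs. destruct (HX s Hs) as [A [_ D]]. now apply (is_derive_Rcomp F X).
Qed.

Lemma cont_comp_X (g : R -> R) : (forall x, - l < x < m -> continuous g x) ->
  cont_on Smax (fun s => g (X s) / om beta m l (X s)).
Proof.
  intros Hg s Hs. destruct (HX s Hs) as [A [_ D]].
  apply continuous_Rmult.
  - apply (continuous_comp X g); auto. eapply is_derive_continuous; eauto.
  - apply (continuous_comp ang_om Rinv).
    + eapply is_derive_continuous. now apply ang_om_derive.
    + apply continuous_Rinv, Rgt_not_eq. now apply ang_om_pos.
Qed.

Lemma ang_om1_cont : cont_on Smax ang_om1.
Proof. apply cont_comp_X. intros x Hx. apply om1_continuous; auto; lra. Qed.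

Lemma damp1_cont : cont_on Smax damp1.
Proof. apply cont_comp_X. auto. Qed.

Definition norm_rhs (eps u y : R) : R := eps * F u * y - cub beta m l u.

Definition radial_orbit (p : R -> R) : pset :=
  fun q => exists th, q = (X (p th * cos th), - (p th * sin th)).

(** As [V' = om * s], the conservative part cancels in [r' = eps * F * r * sin ^ 2] and leaves just
    the rotation [om] in [th']. The lower bound [c] on [th'] makes the angle a global time; dividing
    the two equations gives the radial one. *)
Lemma orbit_radial eps r0 r1 c x y :
  0 < r0 -> r1 < Smax -> 0 < c ->
  (forall s t, Rabs s <= r1 -> c <= ang_om s + eps * (cos t * sin t) * damp s) ->
  periodic_solution (norm_rhs eps) x y ->
  (forall t, - l < x t < m) ->
  (forall t, r0 <= sqrt (sg beta m l (x t) ^ 2 + y t ^ 2) <= r1) ->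
  exists p, radial_solution damp ang_om r0 r1 eps p /\
    (exists N, p (INR (S N) * (2 * PI)) = p 0) /\
    same_set (orbit x y) (radial_orbit p).
Proof.
  intros Hr0 Hr1 Hc Hden [Hsol [[T [HT Hper]] _]] Hx Hr.
  set (s := fun t => sg beta m l (x t)).
  set (ds := fun t => om beta m l (x t) * y t).
  set (dy := fun t => norm_rhs eps (x t) (y t)).
  set (r := fun t => sqrt (s t ^ 2 + y t ^ 2)).
  assert (Hn : forall t, 0 < s t ^ 2 + y t ^ 2).
  { intros t. apply Rnot_le_lt. intros C. pose proof (sqrt_neg_0 _ C). specialize (Hr t). unfold s in *. lra. }
  assert (Hrp : forall t, 0 < r t) by (intros; apply sqrt_lt_R0; auto).
  assert (Er : forall t, r t * r t = s t ^ 2 + y t ^ 2) by (intros; apply sqrt_def, Rlt_le; auto).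
  assert (Ds : forall t, is_derive s t (ds t)).
  { intros t. apply (is_derive_Rcomp (sg beta m l) x); [|apply Hsol].
    apply sg_derive; auto. specialize (Hx t); lra. }
  assert (Dy : forall t, is_derive y t (dy t)) by (intros; apply Hsol).
  assert (Cx : forall t, continuous x t) by (intros; eapply is_derive_continuous; apply Hsol).
  assert (Cy : forall t, continuous y t) by (intros; eapply is_derive_continuous; apply Hsol).
  assert (Cds : forall t, continuous ds t).
  { intros t. apply continuous_Rmult; auto. apply (continuous_comp x (om beta m l)); auto.
    eapply is_derive_continuous. apply om_derive; auto. specialize (Hx t); lra. }
  assert (Cdy : forall t, continuous dy t).
  { intros t. unfold dy, norm_rhs. apply (continuous_minus (V := R_NormedModule)).
    - apply continuous_Rmult; auto. apply continuous_Rmult; [apply continuous_const|].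
      apply (continuous_comp x F); auto. eapply is_derive_continuous; apply HF.
    - apply (continuous_comp x (cub beta m l)); auto.
      apply (ex_derive_continuous (V := R_NormedModule)). unfold cub. auto_derive; auto. }
  destruct (polar_lift s y ds dy Ds Dy Cds Cdy Hn) as [th [Dth [Es Ey]]].
  fold (r) in Es, Ey. change (forall t, s t = r t * cos (th t)) in Es.
  change (forall t, y t = - (r t * sin (th t))) in Ey.
  assert (Sb : forall t, Rabs (s t) <= r1).
  { intros t. rewrite Es. eapply Rle_trans; [apply abs_mult_cos|].
    specialize (Hrp t). rewrite Rabs_right by lra. apply Hr. }
  assert (Xs : forall t, X (s t) = x t).
  { intros t. apply HX'; auto. specialize (Sb t). unfold s in Sb. lra. }
  set (dth := fun t => ang_om (s t) + eps * (cos (th t) * sin (th t)) * damp (s t)).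
  assert (Dth' : forall t, is_derive th t (dth t)).
  { intros t. eapply is_derive_eq; [apply Dth|].
    rewrite <- Er. unfold ds, dy, dth, norm_rhs, ang_om, damp. rewrite Xs.
    rewrite cub_om_sg by (auto; specialize (Hx t); lra). fold (s t).
    specialize (Hrp t).
    assert (Q : s t * y t = - (r t * r t) * (cos (th t) * sin (th t))).
    { rewrite (Es t) at 1. rewrite (Ey t) at 1. ring. }
    apply Rmult_eq_reg_r with (r t * r t); [|nra].
    unfold Rdiv. rewrite Rmult_assoc, Rinv_l, Rmult_1_r by nra.
    transitivity (om beta m l (x t) * (s t ^ 2 + y t ^ 2) - eps * F (x t) * (s t * y t)); [ring|].
    rewrite Q, <- Er. ring. }
  assert (Ldth : forall t, c <= dth t) by (intros; apply Hden; auto).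
  destruct (global_inverse th dth c Hc Dth' Ldth) as [t_of [G1 [G2 DG]]].
  assert (Dr : forall t, is_derive r t (eps * damp (s t) * r t * sin (th t) ^ 2)).
  { intros t. eapply is_derive_eq.
    - apply (is_derive_sqrt (fun t => s t ^ 2 + y t ^ 2) t); [|auto].
      apply (is_derive_ext (fun t => s t * s t + y t * y t)); [intros; simpl; ring|].
      apply is_derive_Rplus; [apply (is_derive_Rmult s s); apply Ds|apply (is_derive_Rmult y y); apply Dy].
    - fold (r t). specialize (Hrp t).
      unfold ds, dy, norm_rhs, damp. rewrite Xs.
      rewrite cub_om_sg by (auto; specialize (Hx t); lra). fold (s t).
      assert (Q : y t * y t = r t * r t * sin (th t) ^ 2) by (rewrite (Ey t); ring).
      apply Rmult_eq_reg_r with (2 * r t); [|lra].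
      unfold Rdiv. rewrite Rmult_assoc, Rinv_l, Rmult_1_r by lra.
      transitivity (2 * (eps * F (x t) * (y t * y t))); [ring|]. rewrite Q. ring. }
  exists (fun a => r (t_of a)).
  split; [|split].
  - intros a. split; [apply Hr|].
    eapply is_derive_eq; [apply (is_derive_Rcomp r t_of); [apply Dr|apply DG]|].
    assert (Ea : r (t_of a) * cos a = s (t_of a)) by (rewrite <- (G1 a) at 2; symmetry; apply Es).
    unfold radial_rhs, ang_kernel. rewrite Ea. unfold dth. rewrite G1. unfold Rdiv. ring.
  - assert (Sper : forall t, s (t + T) = s t /\ y (t + T) = y t).
    { intros t. destruct (Hper t) as [P1 P2]. unfold s. rewrite P1. auto. }
    assert (Rper : forall t, r (t + T) = r t).
    { intros t. destruct (Sper t) as [P1 P2]. unfold r. now rewrite P1, P2. }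
    assert (Dt : forall t, is_derive (fun t => th (t + T) - th t) t 0).
    { intros t. apply (is_derive_eq _ _ ((y (t + T) * ds (t + T) - s (t + T) * dy (t + T)) / (s (t + T) ^ 2 + y (t + T) ^ 2) * 1
        - (y t * ds t - s t * dy t) / (s t ^ 2 + y t ^ 2))).
      - apply (is_derive_Rminus (fun t => th (t + T)) th); auto.
        apply (is_derive_Rcomp th (fun t => t + T)); auto. auto_derive; auto.
      - unfold ds, dy. destruct (Sper t) as [P1 P2]. destruct (Hper t) as [P3 _]. rewrite P1, P2, P3. ring. }
    set (t0 := t_of 0).
    (* After time [T] the point is the same and the angle is larger, so a positive number of full
       turns has been made, possibly several. *)
    destruct (full_turns (th t0) (th (t0 + T))) as [N HN].
    + apply (derive_pos_incr th dth); [lra|auto|]. intros u _. specialize (Ldth u). lra.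
    + apply Rmult_eq_reg_l with (r t0); [|apply Rgt_not_eq, Hrp].
      rewrite <- Es, <- (Rper t0), <- Es. apply Sper.
    + apply Rmult_eq_reg_l with (r t0); [|apply Rgt_not_eq, Hrp].
      apply Ropp_eq_reg. rewrite <- Ey, <- (Rper t0), <- Ey. apply Sper.
    + exists N. unfold t0 in HN. rewrite G1, Rplus_0_l in HN. rewrite <- HN, G2. apply Rper.
  - intros q. split.
    + intros [t E]. exists (th t). rewrite E, G2. rewrite <- Es, <- Ey, Xs. reflexivity.
    + intros [a E]. exists (t_of a). rewrite E.
      assert (Ea : r (t_of a) * cos a = s (t_of a)) by (rewrite <- (G1 a) at 2; symmetry; apply Es).
      assert (Eb : - (r (t_of a) * sin a) = y (t_of a)) by (rewrite <- (G1 a) at 2; symmetry; apply Ey).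
      rewrite Ea, Eb, Xs. reflexivity.
Qed.

End OrbitRadial.

(** * The periodic annulus *)

Lemma bounded_subsequence (u : nat -> R) (M : R) : (forall n, Rabs (u n) <= M) ->
  exists (sub : nat -> nat) (lim : R), (forall n, (n <= sub n)%nat) /\ Un_cv (fun n => u (sub n)) lim.
Proof.
  intros HM.
  destruct (Bolzano_Weierstrass u (fun x => - M <= x <= M)) as [lim Hl].
  { apply compact_P3. }
  { intros n. apply Rabs_le_between, HM. }
  assert (H : forall n, exists p, (n <= p)%nat /\ Rabs (u p - lim) < / (INR n + 1)).
  { intros n. pose proof (pos_INR n).
    assert (Hp : 0 < / (INR n + 1)) by (apply Rinv_0_lt_compat; lra).
    apply (Hl (fun x => Rabs (x - lim) < / (INR n + 1)) n).
    exists (mkposreal _ Hp). intros x Hx. exact Hx. }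
  destruct (functional_choice _ H) as [sub Hs].
  exists sub, lim. split; [apply Hs|].
  intros e He. destruct (archimed_cor1 e He) as [N [HN HN0]].
  exists N. intros n Hn. unfold Rdist. eapply Rlt_trans; [apply Hs|].
  eapply Rle_lt_trans; [|apply HN]. apply Rinv_le_contravar.
  - now apply lt_0_INR.
  - apply le_INR in Hn. lra.
Qed.

Lemma Un_cv_subsequence (u : nat -> R) (sub : nat -> nat) (lim : R) :
  (forall n, (n <= sub n)%nat) -> Un_cv u lim -> Un_cv (fun n => u (sub n)) lim.
Proof.
  intros Hs Hu e He. destruct (Hu e He) as [N HN]. exists N.
  intros n Hn. apply HN. specialize (Hs n). lia.
Qed.

(** Otherwise points of [K] with [h < a + 1 / (n + 1)] exist for every [n]. Extracting subsequences
    one coordinate at a time produces a limit in [K] with [h <= a]. *)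
Lemma compact2_strict_bound (K : pset) (h : pt -> R) (a : R) : compact2 K ->
  (forall (s : nat -> pt) p, Un_cv (fun n => fst (s n)) (fst p) -> Un_cv (fun n => snd (s n)) (snd p) ->
     Un_cv (fun n => h (s n)) (h p)) ->
  (forall p, K p -> a < h p) -> exists a', a < a' /\ forall p, K p -> a' <= h p.
Proof.
  intros [[M HM] Hcl] Hh Ha. apply NNPP. intros C.
  assert (E : forall n : nat, exists p, K p /\ h p < a + / (INR n + 1)).
  { intros n. apply NNPP. intros D. apply C. exists (a + / (INR n + 1)).
    pose proof (pos_INR n). split.
    - assert (0 < / (INR n + 1)) by (apply Rinv_0_lt_compat; lra). lra.
    - intros p Hp. apply Rnot_lt_le. intros Q. apply D. eauto. }
  destruct (functional_choice _ E) as [s Hs].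
  destruct (bounded_subsequence (fun n => fst (s n)) M) as [s1 [x [S1 L1]]].
  { intros n. apply HM, Hs. }
  destruct (bounded_subsequence (fun n => snd (s (s1 n))) M) as [s2 [y [S2 L2]]].
  { intros n. apply HM, Hs. }
  apply (Un_cv_subsequence _ s2 _ S2) in L1.
  assert (Kp : K (x, y)).
  { apply (Hcl (fun n => s (s1 (s2 n)))); auto. intros n. apply Hs. }
  specialize (Ha _ Kp).
  assert (L3 : Un_cv (fun n => h (s (s1 (s2 n)))) (h (x, y))) by (apply Hh; auto).
  destruct (L3 ((h (x, y) - a) / 2)) as [N1 HN1]; [lra|].
  destruct (archimed_cor1 ((h (x, y) - a) / 2)) as [N2 [HN2 HN20]]; [lra|].
  specialize (HN1 (max N1 N2) (Nat.le_max_l _ _)). unfold Rdist in HN1. apply Rabs_def2 in HN1.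
  set (n := max N1 N2) in *.
  pose proof (proj2 (Hs (s1 (s2 n)))) as Q.
  assert (/ (INR (s1 (s2 n)) + 1) <= / INR N2).
  { apply Rinv_le_contravar; [now apply lt_0_INR|].
    assert (N2 <= s1 (s2 n))%nat.
    { specialize (S1 (s2 n)). specialize (S2 n). pose proof (Nat.le_max_r N1 N2). unfold n in *. lia. }
    apply le_INR in H. lra. }
  lra.
Qed.

Lemma Un_cv_continuous (f : R -> R) (u : nat -> R) (x : R) :
  continuous f x -> Un_cv u x -> Un_cv (fun n => f (u n)) (f x).
Proof.
  intros Hf Hu. apply is_lim_seq_Reals. apply is_lim_seq_Reals in Hu.
  apply (is_lim_seq_continuous f); auto. now apply continuous_continuity_pt.
Qed.

(** * Energy levels and the potential well *)

Section Annulus.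
Variables beta m l : R.
Hypothesis Hbeta : 0 < beta.
Hypothesis Hm : 0 < m.
Hypothesis Hl : m <= l.

(** Inside the well this is twice the energy, normalized to vanish at the center. *)
Definition radius2 (q : pt) : R := sg beta m l (fst q) ^ 2 + snd q ^ 2.

Lemma radius2_seq_continuous (s : nat -> pt) p :
  Un_cv (fun n => fst (s n)) (fst p) -> Un_cv (fun n => snd (s n)) (snd p) ->
  Un_cv (fun n => radius2 (s n)) (radius2 p).
Proof.
  intros H1 H2. apply (CV_plus (fun n => sg beta m l (fst (s n)) ^ 2) (fun n => snd (s n) ^ 2)).
  - apply (Un_cv_continuous (fun x => sg beta m l x ^ 2)); auto.
    now apply continuous_pow2, sg_continuous.
  - apply (Un_cv_continuous (fun x => x ^ 2)); auto. apply continuous_pow2, continuous_id.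
Qed.

Definition ham_rhs (u y : R) : R := - cub beta m l u.

(* Twice the potential. *)
Definition pot (x : R) : R := x ^ 2 * rho beta m l x.

Lemma pot_derive x : is_derive pot x (2 * cub beta m l x).
Proof. unfold pot, rho, cub. auto_derive; auto. field. Qed.

Lemma pot_decr a b : a < b -> (forall x, a <= x <= b -> cub beta m l x <= 0) ->
  (forall x, a < x < b -> cub beta m l x < 0) -> pot b < pot a.
Proof.
  intros Hab H0 H. apply Ropp_lt_cancel.
  apply (derive_strict_incr (fun x => - pot x) (fun x => - (2 * cub beta m l x))); auto.
  - intros t _. apply (is_derive_opp pot), pot_derive.
  - intros t Ht. specialize (H0 t Ht). lra.
  - intros t Ht. specialize (H t Ht). lra.
Qed.

Lemma pot_incr a b : a < b -> (forall x, a <= x <= b -> 0 <= cub beta m l x) ->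
  (forall x, a < x < b -> 0 < cub beta m l x) -> pot a < pot b.
Proof.
  intros Hab H0 H.
  apply (derive_strict_incr pot (fun x => 2 * cub beta m l x)); auto.
  - intros t _. apply pot_derive.
  - intros t Ht. specialize (H0 t Ht). lra.
  - intros t Ht. specialize (H t Ht). lra.
Qed.

Lemma cub_neg_right x : m < x -> cub beta m l x < 0.
Proof.
  intros H. assert (0 < beta * x * (x - m) * (l + x)) by (repeat apply Rmult_lt_0_compat; lra).
  unfold cub. lra.
Qed.

Lemma cub_pos_mid x : 0 < x < m -> 0 < cub beta m l x.
Proof. intros H. unfold cub. repeat apply Rmult_lt_0_compat; lra. Qed.

Lemma cub_neg_mid x : - l < x < 0 -> cub beta m l x < 0.
Proof.
  intros H. assert (0 < beta * - x * (m - x) * (l + x)) by (repeat apply Rmult_lt_0_compat; lra).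
  unfold cub. lra.
Qed.

Lemma cub_pos_left x : x < - l -> 0 < cub beta m l x.
Proof.
  intros H. assert (0 < beta * - x * (m - x) * (- (l + x))) by (repeat apply Rmult_lt_0_compat; lra).
  unfold cub. lra.
Qed.

Lemma cub_zeros x : x = m \/ x = 0 \/ x = - l -> cub beta m l x = 0.
Proof. unfold cub. intros [E | [E | E] ]; rewrite E; ring. Qed.

Lemma pot_sg x : - l <= x <= m -> pot x = sg beta m l x ^ 2.
Proof.
  intros Hx. unfold pot, sg. rewrite Rpow_mult_distr, pow2_sqrt; auto.
  apply Rlt_le, rho_pos; auto.
Qed.

Lemma pot_left_end : pot m <= pot (- l).
Proof.
  pose proof (sg_left_end beta m l Hbeta Hm Hl) as H.
  pose proof (sg_m_pos beta m l Hbeta Hm Hl) as P.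
  rewrite !pot_sg by lra. nra.
Qed.

Lemma periodic_representative (f g : R -> R) T : 0 < T ->
  (forall t, f (t + T) = f t /\ g (t + T) = g t) ->
  forall t, exists t', 0 <= t' <= T /\ f t' = f t /\ g t' = g t.
Proof.
  intros HT Hp.
  assert (Hn : forall n t, f (t + INR n * T) = f t /\ g (t + INR n * T) = g t).
  { induction n as [|n IH]; intros t.
    - simpl. now rewrite Rmult_0_l, Rplus_0_r.
    - rewrite S_INR. replace (t + (INR n + 1) * T) with ((t + INR n * T) + T) by ring.
      destruct (Hp (t + INR n * T)) as [-> ->]. apply IH. }
  assert (Hz : forall z t, f (t + IZR z * T) = f t /\ g (t + IZR z * T) = g t).
  { intros z t. destruct (Z.le_gt_cases 0 z) as [Q|Q].
    - rewrite <- (Z2Nat.id z Q), <- INR_IZR_INZ. apply Hn.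
    - destruct (Hn (Z.to_nat (- z)) (t + IZR z * T)) as [A B].
      rewrite INR_IZR_INZ, Z2Nat.id, opp_IZR in A, B by lia.
      replace (t + IZR z * T + - IZR z * T) with t in A, B by ring. auto. }
  (* [up v] exceeds [v] by more than [0] and at most [1], so [v + 1 - up v] lies in [[0, 1)]. *)
  intros t. exists (t + IZR (1 - up (t / T)) * T). split; [|apply Hz].
  destruct (archimed (t / T)) as [A B]. rewrite minus_IZR.
  set (u := IZR (up (t / T))) in *.
  assert (E : t = t / T * T) by (field; lra).
  set (v := t / T) in *. rewrite E. clearbody u v. clear - HT A B. nra.
Qed.

Lemma derive_zero_at_max (f : R -> R) (t d : R) :
  (forall s, f s <= f t) -> is_derive f t d -> d = 0.
Proof.
  intros Hmax Hd. apply is_derive_Reals in Hd.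
  assert (pr : derivable_pt f t) by (now exists d).
  pose proof (deriv_maximum f (t - 1) (t + 1) t pr) as K.
  rewrite <- K; try lra; auto.
  symmetry. now apply derive_pt_eq_0.
Qed.

(** Gronwall for the squared distance to the equilibrium. The vector field is Lipschitz with
    constant [L] on the range of the bounded solution, and [2 * A * B <= A ^ 2 + B ^ 2] yields the
    rate [1 + L]. *)
Lemma equilibrium_constant x y e t0 M :
  is_solution ham_rhs x y -> cub beta m l e = 0 -> (forall t, Rabs (x t) <= M) -> Rabs e <= M ->
  x t0 = e -> y t0 = 0 -> forall t, x t = e /\ y t = 0.
Proof.
  intros Hs He HM HeM Hx0 Hy0.
  set (c1 := fun x => beta * (m - x) * (l + x) + beta * x * (- 1) * (l + x) + beta * x * (m - x)).
  assert (Dc : forall x, is_derive (cub beta m l) x (c1 x)).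
  { intros z. unfold cub, c1. auto_derive; auto. ring. }
  destruct (continuous_bounded c1 (- M) M) as [L [PL HL]].
  { pose proof (Rabs_pos e). lra. }
  { intros z _. apply (ex_derive_continuous (V := R_NormedModule)). unfold c1. auto_derive; auto. }
  assert (Lc : forall t, Rabs (cub beta m l (x t)) <= L * Rabs (x t - e)).
  { intros t. rewrite <- (Rminus_0_r (cub beta m l (x t))), <- He.
    assert (Q : forall z, Rmin e (x t) <= z <= Rmax e (x t) -> - M <= z <= M).
    { intros z Hz. specialize (HM t). apply Rabs_le_between in HM. apply Rabs_le_between in HeM.
      unfold Rmin, Rmax in Hz. destruct Rle_dec; lra. }
    apply (derive_bound_lip_abs (cub beta m l) c1); auto. }
  assert (Z : forall t, (x t - e) ^ 2 + y t ^ 2 = 0).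
  { apply (gronwall_zero (fun t => (x t - e) ^ 2 + y t ^ 2)
      (fun t => 2 * (x t - e) * y t + 2 * y t * - cub beta m l (x t)) (1 + L) t0).
    - intros t. destruct (Hs t) as [D1 D2]. unfold ham_rhs in D2.
      apply (is_derive_ext (fun t => (x t - e) * (x t - e) + y t * y t)); [intros; simpl; ring|].
      eapply is_derive_eq.
      + apply is_derive_Rplus; apply is_derive_Rmult.
        * apply is_derive_Rminus; [apply D1|apply is_derive_Rconst].
        * apply is_derive_Rminus; [apply D1|apply is_derive_Rconst].
        * apply D2.
        * apply D2.
      + unfold zero; simpl. ring.
    - intros t. specialize (Lc t).
      rewrite (Rabs_right ((x t - e) ^ 2 + y t ^ 2)) by (apply Rle_ge, Rplus_le_le_0_compat; apply pow2_ge_0).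
      rewrite <- (pow2_abs (x t - e)), <- (pow2_abs (y t)).
      eapply Rle_trans; [apply Rabs_triang|]. rewrite !Rabs_mult, Rabs_Ropp, (Rabs_right 2) by lra.
      set (A := Rabs (x t - e)) in *. set (B := Rabs (y t)).
      assert (0 <= A) by apply Rabs_pos. assert (0 <= B) by apply Rabs_pos.
      set (c := Rabs (cub beta m l (x t))) in *.
      assert (B * c <= B * (L * A)) by (apply Rmult_le_compat_l; auto).
      pose proof (pow2_ge_0 (A - B)).
      assert (L * (2 * A * B) <= L * (A ^ 2 + B ^ 2)) by (apply Rmult_le_compat_l; nra).
      nra.
    - rewrite Hx0, Hy0. ring. }
  intros t. specialize (Z t). destruct (Rplus_sqr_eq_0 (x t - e) (y t)); [unfold Rsqr; lra|]. split; lra.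
Qed.

Lemma energy_constant x y : is_solution ham_rhs x y ->
  forall a b, y a ^ 2 + pot (x a) = y b ^ 2 + pot (x b).
Proof.
  intros Hs. apply (derive_zero_const (fun t => y t ^ 2 + pot (x t))).
  intros t. destruct (Hs t) as [D1 D2]. unfold ham_rhs in D2.
  apply (is_derive_ext (fun t => y t * y t + pot (x t))); [intros; simpl; ring|].
  eapply is_derive_eq.
  - apply is_derive_Rplus; [apply is_derive_Rmult; apply D2|].
    apply (is_derive_Rcomp pot x); [apply pot_derive|apply D1].
  - ring.
Qed.

(** At the maximum [M] and the minimum [mm] of [x] the velocity vanishes, so [pot] has the same
    value there and nowhere exceeds it in between; moreover neither is an equilibrium. As [pot]
    rises up to [- l], falls to [0], rises to [m] and falls beyond, this forces [0 < M < m]; and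
    [mm <= - l] would require [pot (- l) <= pot M < pot m]. *)
Lemma periodic_solution_in_well x y : periodic_solution ham_rhs x y ->
  exists h, 0 < h < pot m /\ forall t, - l < x t < m /\ y t ^ 2 + pot (x t) = h.
Proof.
  intros [Hs [[T [HT Hp]] Hnc]].
  assert (Cx : forall t, continuous x t) by (intros t; eapply is_derive_continuous; apply Hs).
  destruct (continuity_ab_maj x 0 T) as [t1 [M1 B1]]; [lra|intros; apply continuous_continuity_pt, Cx|].
  destruct (continuity_ab_min x 0 T) as [t2 [M2 B2]]; [lra|intros; apply continuous_continuity_pt, Cx|].
  assert (N1 : forall t, x t <= x t1).
  { intros t. destruct (periodic_representative x y T HT Hp t) as [t' [Ht' [<- _]]]. auto. }
  assert (N2 : forall t, x t2 <= x t).
  { intros t. destruct (periodic_representative x y T HT Hp t) as [t' [Ht' [<- _]]]. auto. }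
  assert (Y1 : y t1 = 0) by (apply (derive_zero_at_max x t1); [apply N1|apply Hs]).
  assert (Y2 : y t2 = 0).
  { assert (- y t2 = 0); [|lra]. apply (derive_zero_at_max (fun t => - x t) t2).
    - intros s. specialize (N2 s). lra.
    - apply (is_derive_opp x). apply Hs. }
  pose proof (energy_constant x y Hs) as En.
  assert (Hbd : forall t, Rabs (x t) <= Rabs (x t1) + Rabs (x t2)).
  { intros t. specialize (N1 t). specialize (N2 t).
    apply Rabs_le. pose proof (Rle_abs (x t1)). pose proof (Rle_abs (- x t2)). rewrite Rabs_Ropp in *.
    pose proof (Rabs_pos (x t1)). pose proof (Rabs_pos (x t2)). lra. }
  assert (Ne : forall t0, y t0 = 0 -> ~ (x t0 = m \/ x t0 = 0 \/ x t0 = - l)).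
  { intros t0 Hy Hx. destruct Hnc as [t Hnc]. apply Hnc.
    pose proof (equilibrium_constant x y (x t0) t0 _ Hs (cub_zeros _ Hx) Hbd (Hbd t0) eq_refl Hy) as Q.
    destruct (Q t) as [-> ->]. destruct (Q 0) as [-> ->]. reflexivity. }
  assert (Lt : x t2 < x t1).
  { apply Rnot_le_lt. intros C. destruct Hnc as [t Hnc]. apply Hnc.
    assert (K : forall s, x s = x t1) by (intros s; specialize (N1 s); specialize (N2 s); lra).
    assert (Ky : forall s, y s = 0).
    { intros s. apply (derive_zero_at_max x s); [|apply Hs]. intros u. rewrite (K u), (K s). lra. }
    now rewrite (K t), (K 0), !Ky. }
  assert (At : forall z, x t2 <= z <= x t1 -> pot z <= pot (x t1)).
  { intros z Hz. destruct (IVT_gen x t2 t1 z) as [s [_ E]].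
    - intros t. apply continuous_continuity_pt, Cx.
    - rewrite Rmin_left, Rmax_right; lra.
    - specialize (En s t1). rewrite E, Y1 in En. pose proof (pow2_ge_0 (y s)). lra. }
  assert (Ee : pot (x t2) = pot (x t1)).
  { specialize (En t2 t1). rewrite Y1, Y2 in En. lra. }
  pose proof (Ne t1 Y1) as Ne1.
  pose proof pot_left_end as PL.
  set (M := x t1) in *. set (mm := x t2) in *.
  assert (I1 : 0 < M < m).
  { destruct (Rlt_dec m M) as [C|C].
    (* The potential falls from [z] to [M], yet the orbit passes over [z], where its kinetic energy
       would be negative. *)
    { exfalso. set (z := Rmax mm m).
      assert (m <= z) by apply Rmax_r. assert (mm <= z) by apply Rmax_l.
      assert (z < M) by (apply Rmax_lub_lt; auto).
      assert (pot M < pot z).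
      { apply pot_decr; auto; intros u Hu.
        - destruct (Req_dec u m) as [E | ]; [rewrite E, cub_zeros; auto; lra|].
          apply Rlt_le, cub_neg_right; lra.
        - apply cub_neg_right; lra. }
      pose proof (At z ltac:(lra)). lra. }
    destruct (Rlt_dec 0 M) as [C2|C2].
    { split; auto. destruct (Req_dec M m); [exfalso; apply Ne1; auto|lra]. }
    exfalso.
    destruct (Rlt_dec (- l) M) as [C3|C3].
    { assert (M <> 0) by (intros Q; apply Ne1; auto).
      set (z := Rmax mm (- l)).
      assert (- l <= z) by apply Rmax_r. assert (mm <= z) by apply Rmax_l.
      assert (z < M) by (apply Rmax_lub_lt; auto).
      assert (pot M < pot z).
      { apply pot_decr; auto; intros u Hu.
        - destruct (Req_dec u (- l)) as [E | ]; [rewrite E, cub_zeros; auto; lra|].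
          apply Rlt_le, cub_neg_mid; lra.
        - apply cub_neg_mid; lra. }
      pose proof (At z ltac:(lra)). lra. }
    assert (M <> - l) by (intros Q; apply Ne1; auto).
    assert (pot mm < pot M); [|lra].
    apply pot_incr; auto; intros u Hu; [apply Rlt_le|]; apply cub_pos_left; lra. }
  assert (PM : 0 < pot M < pot m).
  { split.
    - replace 0 with (pot 0) at 1 by (unfold pot; ring).
      apply pot_incr; [lra| |]; intros u Hu.
      + destruct (Req_dec u 0) as [E | ]; [rewrite E, cub_zeros; auto; lra|]. apply Rlt_le, cub_pos_mid; lra.
      + apply cub_pos_mid; lra.
    - apply pot_incr; [lra| |]; intros u Hu.
      + destruct (Req_dec u m) as [E | ]; [rewrite E, cub_zeros; auto; lra|]. apply Rlt_le, cub_pos_mid; lra.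
      + apply cub_pos_mid; lra. }
  assert (I2 : - l < mm).
  { apply Rnot_le_lt. intros C. pose proof (At (- l) ltac:(lra)). lra. }
  exists (pot M). split; auto. intros t. split.
  - specialize (N1 t). specialize (N2 t). unfold M, mm in *. lra.
  - rewrite (En t t1), Y1. unfold M. ring.
Qed.

Lemma annulus_in_well G p : periodic_orbit ham_rhs G -> G p ->
  - l < fst p < m /\ 0 < radius2 p < sg beta m l m ^ 2.
Proof.
  intros [x [y [Hp HG]]] Gp. apply HG in Gp. destruct Gp as [t ->].
  destruct (periodic_solution_in_well x y Hp) as [h [Hh Ht]].
  destruct (Ht t) as [Hx E]. unfold radius2. simpl fst; simpl snd.
  rewrite <- !pot_sg by lra. split; auto. lra.
Qed.

Lemma compact_in_annulus (K : pset) : compact2 K ->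
  (forall p, K p -> exists G, periodic_orbit ham_rhs G /\ G p) ->
  exists r0 r1, 0 < r0 /\ r0 <= r1 /\ r1 < sg beta m l m /\
    forall p, K p -> - l < fst p < m /\ r0 <= sqrt (radius2 p) <= r1.
Proof.
  intros HK Hsub.
  pose proof (sg_m_pos beta m l Hbeta Hm Hl) as Sp. set (Sm := sg beta m l m) in *.
  assert (HW : forall p, K p -> - l < fst p < m /\ 0 < radius2 p < Sm ^ 2).
  { intros p Kp. destruct (Hsub p Kp) as [G [HG Gp]]. now apply (annulus_in_well G). }
  destruct (compact2_strict_bound K radius2 0 HK radius2_seq_continuous) as [a [Pa Ha]].
  { intros p Kp. apply HW, Kp. }
  destruct (compact2_strict_bound K (fun p => - radius2 p) (- Sm ^ 2) HK) as [b [Pb Hb]].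
  { intros s p H1 H2. apply (CV_opp (fun n => radius2 (s n))). now apply radius2_seq_continuous. }
  { intros p Kp. destruct (HW p Kp). lra. }
  assert (S2 : 0 < Sm ^ 2) by (apply pow_lt; auto).
  (* For an empty [K] the bounds [a] and [- b] carry no information; [Rmax] keeps [B] positive, and
     [A = Rmin a B] keeps the two radii in order. *)
  set (B := Rmax (- b) (Sm ^ 2 / 2)).
  assert (B1 : - b <= B) by apply Rmax_l. assert (B2 : Sm ^ 2 / 2 <= B) by apply Rmax_r.
  assert (B3 : B < Sm ^ 2) by (apply Rmax_lub_lt; lra).
  set (A := Rmin a B).
  assert (A1 : A <= a) by apply Rmin_l. assert (A2 : A <= B) by apply Rmin_r.
  assert (A3 : 0 < A) by (apply Rmin_pos; lra).
  exists (sqrt A), (sqrt B). split; [now apply sqrt_lt_R0|]. split; [now apply sqrt_le_1_alt|].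
  split.
  - rewrite <- (sqrt_pow2 Sm) by lra. apply sqrt_lt_1_alt. lra.
  - intros p Kp. destruct (HW p Kp) as [W1 W2]. split; auto.
    specialize (Ha p Kp). specialize (Hb p Kp). cbv beta in Hb.
    split; apply sqrt_le_1_alt; lra.
Qed.

End Annulus.

(** * The normal form *)

Lemma same_set_trans (A B C : pset) : same_set A B -> same_set B C -> same_set A C.
Proof. intros H1 H2 p. rewrite (H1 p). apply H2. Qed.

Lemma same_set_sym (A B : pset) : same_set A B -> same_set B A.
Proof. intros H p. symmetry. apply H. Qed.

Lemma periodic_orbit_ext (F1 F2 : R -> R -> R) G :
  (forall u y, F1 u y = F2 u y) -> periodic_orbit F1 G -> periodic_orbit F2 G.
Proof.
  intros E [x [y [[Hs Hp] HG]]]. exists x, y. split; auto. split; auto.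
  intros t. rewrite <- E. apply Hs.
Qed.

Lemma sin2_mean_comb S k1 k2 c1 c2 r : cont_on S k1 -> cont_on S k2 -> Rabs r < S ->
  sin2_mean (fun s => c1 * k1 s + c2 * k2 s) r = c1 * sin2_mean k1 r + c2 * sin2_mean k2 r.
Proof.
  intros H1 H2 Hr. pose proof PI_RGT_0.
  assert (Z : cont_on S (fun _ => 0)) by (intros s _; apply continuous_const).
  assert (Z0 : sin2_mean (fun _ => 0) r = 0).
  { transitivity (RInt (fun _ => 0) 0 (2 * PI)).
    - unfold sin2_mean. apply RInt_Rext. intros; ring.
    - rewrite RInt_const. apply Rmult_0_r. }
  assert (N1 : cont_on S (fun s => 0 - - c1 * k1 s)) by (now apply cont_on_lin).
  pose proof (sin2_mean_linear S k1 (fun _ => 0) (- c1) r H1 Z Hr) as E1.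
  pose proof (sin2_mean_linear S k2 _ (- c2) r H2 N1 Hr) as E2.
  rewrite E1, Z0 in E2.
  transitivity (sin2_mean (fun s => 0 - - c1 * k1 s - - c2 * k2 s) r).
  - unfold sin2_mean. apply RInt_Rext. intros; ring.
  - rewrite E2. ring.
Qed.

Section Normal.
Variables beta m l : R.
Hypothesis Hbeta : 0 < beta.
Hypothesis Hm : 0 < m.
Hypothesis Hl : m <= l.
Variable X : R -> R.
Local Notation Smax := (sg beta m l m).
Hypothesis HX : forall s, Rabs s < Smax ->
  - l < X s < m /\ sg beta m l (X s) = s /\ is_derive X s (/ om beta m l (X s)).
Hypothesis HX' : forall x, - l < x < m -> Rabs (sg beta m l x) < Smax -> X (sg beta m l x) = x.

(** With [k1 = 1 / w] and [k2 = R0 / w], the quotient of the even parts of [k2] and [k1] becomes the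
    chord of [R0] after multiplication by [w s * w (- s)]. Monotone chords thus supply the
    hypothesis of [mean_wronskian_pos], hence a positive derivative of the quotient of the means. *)
Lemma damping_means_nondegenerate (R0 R0' : R -> R) al0 aln r0 r1 :
  (forall x, is_derive R0 x (R0' x)) -> (forall x, continuous R0' x) ->
  strict_incr beta m l (chord X (fun s => om beta m l (X s)) R0) ->
  ~ (al0 = 0 /\ aln = 0) -> 0 < r0 -> r0 <= r1 -> r1 < Smax ->
  let M := sin2_mean (fun s => damp X (fun x => al0 + aln * R0 x) s / ang_om beta m l X s) in
  exists eta, 0 < eta /\ forall e1 e2, r0 <= e1 -> e1 < e2 -> e2 <= r1 ->
    Rabs (M e1) <= eta -> Rabs (M e2 - M e1) <= eta * (e2 - e1) -> False.
Proof.
  intros DR CR Hinc Hal H0 H01 H1 M.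
  set (w := ang_om beta m l X). set (w' := ang_om1 beta m l X).
  assert (Pw : forall s, Rabs s < Smax -> 0 < w s) by (intros; apply ang_om_pos; auto).
  assert (Dw : forall s, Rabs s < Smax -> is_derive w s (w' s)) by (intros; apply ang_om_derive; auto).
  assert (Cw : cont_on Smax w) by (intros s Hs; eapply is_derive_continuous; now apply Dw).
  assert (Cw' : cont_on Smax w') by (apply ang_om1_cont; auto).
  set (k1 := fun s => / w s). set (k1' := fun s => - w' s / w s ^ 2).
  set (k2 := fun s => damp X R0 s * k1 s).
  set (k2' := fun s => damp1 beta m l X R0' s * k1 s + damp X R0 s * k1' s).
  assert (D1 : forall s, Rabs s < Smax -> is_derive k1 s (k1' s)).
  { intros s Hs. apply (is_derive_inv w s (w' s)); [now apply Dw|]. apply Rgt_not_eq. now apply Pw. }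
  assert (Dd : forall s, Rabs s < Smax -> is_derive (damp X R0) s (damp1 beta m l X R0' s)).
  { intros s Hs. apply damp_derive; auto. }
  assert (D2 : forall s, Rabs s < Smax -> is_derive k2 s (k2' s)).
  { intros s Hs. apply is_derive_Rmult; auto. }
  assert (C1 : cont_on Smax k1) by (intros s Hs; eapply is_derive_continuous; now apply D1).
  assert (C2 : cont_on Smax k2) by (intros s Hs; eapply is_derive_continuous; now apply D2).
  assert (C1' : cont_on Smax k1').
  { intros s Hs. unfold k1'. apply continuous_Rmult.
    - apply (continuous_opp (V := R_NormedModule)). now apply Cw'.
    - apply (continuous_comp (fun s => w s ^ 2) Rinv); [now apply continuous_pow2, Cw|].
      apply continuous_Rinv, pow_nonzero, Rgt_not_eq. now apply Pw. }
  assert (C2' : cont_on Smax k2').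
  { intros s Hs. unfold k2'. apply continuous_Rplus; apply continuous_Rmult.
    - now apply (damp1_cont beta m l).
    - now apply C1.
    - eapply is_derive_continuous. now apply Dd.
    - now apply C1'. }
  assert (P1 : forall s, Rabs s < Smax -> 0 < k1 s).
  { intros s Hs. apply Rinv_0_lt_compat. now apply Pw. }
  assert (Hab : forall r, r0 <= r <= r1 -> Rabs r < Smax) by (intros; apply Rabs_def1; lra).
  destruct (no_degenerate_zero (sin2_mean k1) (sin2_mean k2) (cos2_mean k1) (cos2_mean k2) r0 r1 al0 aln)
    as [eta [Pe He]]; auto.
  - intros r Hr. split; [apply (sin2_mean_derive Smax k1 k1') | apply (sin2_mean_derive Smax k2 k2')]; auto.
  - intros r Hr. split; [apply (cos2_mean_continuous Smax k1 k1') | apply (cos2_mean_continuous Smax k2 k2')]; auto.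
  - intros r Hr. apply (sin2_mean_pos Smax); auto; lra.
  - intros r Hr. apply (mean_wronskian_pos Smax); auto; try lra.
    intros s1 s2 Q1 Q2 Q3.
    assert (E : forall s, 0 <= s -> s < Smax ->
      (k2 s + k2 (- s)) / (k1 s + k1 (- s)) = chord X (fun s => om beta m l (X s)) R0 s).
    { intros s G1 G2. unfold k2, k1, w, damp, ang_om, chord.
      pose proof (Pw s ltac:(apply Rabs_def1; lra)) as W1.
      pose proof (Pw (- s) ltac:(apply Rabs_def1; lra)) as W2. unfold w, ang_om in W1, W2.
      field. lra. }
    rewrite !E by lra. apply Hinc; auto.
  - exists eta. split; auto. intros e1 e2 Q1 Q2 Q3.
    assert (E : forall e, r0 <= e <= r1 -> M e = al0 * sin2_mean k1 e + aln * sin2_mean k2 e).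
    { intros e Hee. rewrite <- (sin2_mean_comb Smax) by auto.
      unfold M, sin2_mean. apply RInt_Rext. intros t. unfold k2, k1, damp, w. field.
      apply Rgt_not_eq, Pw. eapply Rle_lt_trans; [apply abs_mult_cos|]. now apply Hab. }
    rewrite !E by lra. apply He; auto.
Qed.

(** Compactness of [K] fixes the ring of radii, and with it [eta], before [eps] is chosen. Two
    orbits with different initial radii would meet both smallness conditions excluded by [eta]; with
    equal ones they coincide by uniqueness. *)
Lemma unique_periodic_orbit (R0 R0' : R -> R) al0 aln (K : pset) :
  (forall x, is_derive R0 x (R0' x)) -> (forall x, continuous R0' x) ->
  strict_incr beta m l (chord X (fun s => om beta m l (X s)) R0) ->
  ~ (al0 = 0 /\ aln = 0) -> compact2 K ->
  (forall p, K p -> exists G, periodic_orbit (ham_rhs beta m l) G /\ G p) ->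
  exists eps0, 0 < eps0 /\ forall eps, 0 < eps < eps0 -> forall G1 G2,
    periodic_orbit (norm_rhs beta m l (fun x => al0 + aln * R0 x) eps) G1 ->
    periodic_orbit (norm_rhs beta m l (fun x => al0 + aln * R0 x) eps) G2 ->
    subset G1 K -> subset G2 K -> same_set G1 G2.
Proof.
  intros DR CR Hinc Hal HK Hsub.
  destruct (compact_in_annulus beta m l Hbeta Hm Hl K HK Hsub) as [r0 [r1 [H0 [H01 [H1 HKr]]]]].
  set (F := fun x => al0 + aln * R0 x). set (F' := fun x => aln * R0' x).
  assert (DF : forall x, is_derive F x (F' x)).
  { intros x. apply (is_derive_eq _ _ (0 + (0 * R0 x + aln * R0' x))); [|unfold F'; ring].
    apply is_derive_Rplus; [apply is_derive_Rconst|].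
    apply is_derive_Rmult; auto. apply is_derive_Rconst. }
  assert (CF : forall x, continuous F' x).
  { intros x. apply continuous_Rmult; auto. apply continuous_const. }
  destruct (damping_means_nondegenerate R0 R0' al0 aln r0 r1 DR CR Hinc Hal H0 H01 H1) as [eta [Pe He]].
  destruct (radial_two_solutions (damp X F) (ang_om beta m l X) (damp1 beta m l X F') (ang_om1 beta m l X)
     Smax r0 r1 H0 H1) with (eta := eta) as [eps0 [P0 HE]]; auto.
  { intros; apply damp_derive; auto. }
  { intros; apply ang_om_derive; auto. }
  { apply damp1_cont; auto. }
  { apply ang_om1_cont; auto. }
  { intros; apply ang_om_pos; auto. }
  exists eps0. split; auto. intros eps Heps G1 G2 PG1 PG2 S1 S2.
  destruct (HE eps Heps) as [Eper [Euni [Etwo [c [Pc Hc]]]]].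
  assert (Lift : forall G, periodic_orbit (norm_rhs beta m l F eps) G -> subset G K ->
    exists p, radial_solution (damp X F) (ang_om beta m l X) r0 r1 eps p /\
      p (2 * PI) = p 0 /\ same_set G (radial_orbit X p)).
  { intros G [x [y [Hp HG]]] HS.
    assert (Kt : forall t, - l < x t < m /\ r0 <= sqrt (radius2 beta m l (x t, y t)) <= r1).
    { intros t. apply (HKr (x t, y t)), HS, HG. now exists t. }
    destruct (orbit_radial beta m l Hbeta Hm Hl X HX' F F' DF eps r0 r1 c x y) as [p [Q1 [[N Q2] Q3]]]; auto.
    - intros t. apply Kt. - intros t. apply (Kt t).
    - exists p. split; auto. split.
      + pose proof (Eper p N Q1 Q2 0) as Q. now rewrite Rplus_0_l in Q.
      + now apply (same_set_trans _ (orbit x y)). }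
  destruct (Lift G1 PG1 S1) as [p1 [A1 [A2 A3]]].
  destruct (Lift G2 PG2 S2) as [p2 [B1 [B2 B3]]].
  destruct (Rtotal_order (p1 0) (p2 0)) as [L|[L|L]].
  - exfalso. destruct (Etwo p1 p2 A1 B1 L A2 B2) as [K1 K2].
    apply (He (p1 0) (p2 0)); auto; [apply A1|apply B1].
  - apply (same_set_trans _ (radial_orbit X p1)); auto.
    apply (same_set_trans _ (radial_orbit X p2)); [|now apply same_set_sym].
    intros q. unfold radial_orbit. pose proof (Euni p1 p2 A1 B1 L) as E.
    split; intros [th Q]; exists th; rewrite Q, E; reflexivity.
  - exfalso. destruct (Etwo p2 p1 B1 A1 L B2 A2) as [K1 K2].
    apply (He (p2 0) (p1 0)); auto; [apply B1|apply A1].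
Qed.

(* The Hamiltonian orbit of radius [r], parametrised by the inverse of the quadrature
   [t = int d(th) / ang_om]. *)
Lemma hamiltonian_orbit_exists r : 0 < r -> r < Smax ->
  periodic_orbit (ham_rhs beta m l) (radial_orbit X (fun _ => r)).
Proof.
  intros H0 H1. pose proof PI_RGT_0 as HPI.
  set (w := ang_om beta m l X).
  assert (Hr : Rabs r < Smax) by (apply Rabs_def1; lra).
  assert (Hcos : forall t, Rabs (r * cos t) < Smax).
  { intros. eapply Rle_lt_trans; [apply abs_mult_cos|auto]. }
  assert (Pw : forall s, Rabs s < Smax -> 0 < w s) by (intros; apply ang_om_pos; auto).
  assert (Cw : cont_on Smax w).
  { intros s Hs. eapply is_derive_continuous. apply ang_om_derive; auto. }
  set (g := fun t => / w (r * cos t)).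
  assert (Cg : forall t, continuous g t).
  { intros t. apply (continuous_comp (fun t => w (r * cos t)) Rinv).
    - now apply (cont_comp_cos Smax). - apply continuous_Rinv, Rgt_not_eq, Pw, Hcos. }
  set (T := fun t => RInt g 0 t).
  assert (DT : forall t, is_derive T t (g t)) by (apply is_derive_primitive; auto).
  destruct (continuous_bounded w (- r) r) as [A [PA HA]]; [lra| |].
  { intros x Hx. apply Cw, Rabs_def1; lra. }
  assert (Lg : forall t, / A <= g t).
  { intros t. apply Rinv_le_contravar; [apply Pw, Hcos|].
    eapply Rle_trans; [apply Rle_abs|]. apply HA, Rabs_le_between.
    eapply Rle_trans; [apply abs_mult_cos|]. rewrite Rabs_right; lra. }
  destruct (global_inverse T g (/ A)) as [th [I1 [I2 Dth]]]; auto.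
  { now apply Rinv_0_lt_compat. }
  assert (Dth' : forall t, is_derive th t (w (r * cos (th t)))).
  { intros t. eapply is_derive_eq; [apply Dth|]. unfold g. apply Rinv_inv. }
  assert (Tper : forall t, T (t + 2 * PI) - T t = T (0 + 2 * PI) - T 0).
  { intros t. apply (derive_zero_const (fun t => T (t + 2 * PI) - T t)).
    clear t. intros t. apply (is_derive_eq _ _ (g (t + 2 * PI) * 1 - g t)).
    - apply is_derive_Rminus; auto. apply (is_derive_Rcomp T (fun t => t + 2 * PI)); auto.
      auto_derive; auto.
    - assert (E : cos (t + 2 * PI) = cos t) by (rewrite cos_plus, sin_2PI, cos_2PI; ring).
      unfold g. rewrite E. ring. }
  assert (T0 : T 0 = 0) by (unfold T; now rewrite RInt_point).
  set (P := T (2 * PI)).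
  assert (PP : 0 < P).
  { unfold P. rewrite <- T0. apply (derive_pos_incr T g); [lra|auto|].
    intros t _. specialize (Lg t). pose proof (Rinv_0_lt_compat A PA). lra. }
  assert (thper : forall t, th (t + P) = th t + 2 * PI).
  { intros t. rewrite <- (I2 (th t + 2 * PI)). f_equal.
    specialize (Tper (th t)). rewrite I1, T0, Rplus_0_l in Tper. unfold P. lra. }
  exists (fun t => X (r * cos (th t))), (fun t => - (r * sin (th t))).
  split; [split; [|split]|].
  - intros t. destruct (HX (r * cos (th t)) (Hcos _)) as [Y1 [Y2 Y3]]. split.
    + eapply is_derive_eq.
      * apply (is_derive_Rcomp X (fun t => r * cos (th t))); [exact Y3|].
        apply (is_derive_Rmult (fun _ => r) (fun t => cos (th t))).
        -- apply is_derive_Rconst.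
        -- apply (is_derive_Rcomp cos th); [apply is_derive_Reals, derivable_pt_lim_cos|apply Dth'].
      * unfold w, ang_om, zero; simpl. field. apply Rgt_not_eq, om_pos; auto.
    + eapply is_derive_eq.
      * apply (is_derive_opp (fun t => r * sin (th t))).
        apply (is_derive_Rmult (fun _ => r) (fun t => sin (th t))).
        -- apply is_derive_Rconst.
        -- apply (is_derive_Rcomp sin th); [apply is_derive_Reals, derivable_pt_lim_sin|apply Dth'].
      * unfold ham_rhs. rewrite cub_om_sg, Y2 by (auto; lra).
        unfold w, ang_om, zero, opp; simpl. ring.
  - exists P. split; auto. intros t. rewrite thper, cos_plus, sin_plus, sin_2PI, cos_2PI.
    split; [f_equal|]; ring.
  (* [T PI] is the time of the half turn; there the first coordinate is [X (- r)], which [sg]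
     separates from [X r]. *)
  - exists (T PI). intros Q. injection Q as Q _.
    rewrite I2 in Q. rewrite <- T0, I2 in Q at 1. rewrite cos_PI, cos_0 in Q.
    apply (f_equal (sg beta m l)) in Q.
    assert (A1 : Rabs (r * -1) < Smax) by (apply Rabs_def1; lra).
    assert (A2 : Rabs (r * 1) < Smax) by (apply Rabs_def1; lra).
    rewrite (proj1 (proj2 (HX _ A1))), (proj1 (proj2 (HX _ A2))) in Q. lra.
  - intros q. split.
    + intros [a ->]. exists (T a). now rewrite I2.
    + intros [t ->]. now exists (th t).
Qed.

(** The orbit is the level of radius [r], and the level of radius [r + e] is another periodic orbit
    within the distance that isolation would reserve for [G]. *)
Lemma no_hamiltonian_limit_cycle G : ~ limit_cycle (ham_rhs beta m l) G.
Proof.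
  intros [[x [y [Hp HG]]] [d [Pd Hd]]].
  pose proof (sg_m_pos beta m l Hbeta Hm Hl) as Sp.
  destruct (periodic_solution_in_well beta m l Hbeta Hm Hl x y Hp) as [h [Hh Ht]].
  rewrite (pot_sg beta m l Hbeta Hm Hl m) in Hh by lra.
  set (r := sqrt h).
  assert (r0 : 0 < r) by (apply sqrt_lt_R0; lra).
  assert (r1 : r < Smax).
  { unfold r. rewrite <- (sqrt_pow2 Smax) by lra. apply sqrt_lt_1_alt. lra. }
  assert (Pw : forall s, Rabs s < Smax -> 0 < ang_om beta m l X s) by (intros; apply ang_om_pos; auto).
  destruct (continuous_pos_bound (ang_om beta m l X) (- r) r) as [c [Pc Hc]]; [lra| | |].
  { intros s Hs. eapply is_derive_continuous. apply ang_om_derive; auto. apply Rabs_def1; lra. }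
  { intros s Hs. apply Pw, Rabs_def1; lra. }
  assert (GR : same_set G (radial_orbit X (fun _ => r))).
  (* Conservation of energy allows [r0 = r1 = r], which pins the radial solution to the constant
     [r]. *)
  { destruct (orbit_radial beta m l Hbeta Hm Hl X HX' (fun _ => 0) (fun _ => 0)) with (eps := 0) (r0 := r) (r1 := r) (c := c) (x := x) (y := y)
      as [p [Q1 [_ Q3]]]; auto.
    - intros t. apply is_derive_Rconst.
    - intros s t Hs. rewrite !Rmult_0_l, Rplus_0_r. apply Hc. now apply Rabs_le_between.
    - destruct Hp as [H1 H2]. split; auto. intros t. destruct (H1 t) as [D1 D2]. split; auto.
      eapply is_derive_eq; [exact D2|]. unfold ham_rhs, norm_rhs. ring.
    - intros t. apply Ht.
    - intros t. destruct (Ht t) as [T1 T2]. rewrite (pot_sg beta m l Hbeta Hm Hl) in T2 by lra.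
      rewrite Rplus_comm, T2. unfold r. lra.
    - apply (same_set_trans _ (orbit x y)); auto.
      apply (same_set_trans _ (radial_orbit X p)); auto.
      assert (E : forall t, p t = r) by (intros t; destruct (Q1 t) as [B _]; lra).
      intros q. split; intros [th Q]; exists th; rewrite Q; now rewrite ?E. }
  set (rr := (r + Smax) / 2).
  destruct (unif_continuous_1d X (- rr) rr) with (e := d / 2) as [dx [Pdx Hdx]].
  { intros s Hs. eapply is_derive_continuous. apply HX. unfold rr in Hs. apply Rabs_def1; lra. }
  { lra. }
  (* The first bound keeps [r + e] within the interval of uniform continuity of [X]; the second
     moves each coordinate by less than [d / 2]. *)
  set (e := Rmin ((Smax - r) / 2) (Rmin (dx / 2) (d / 2) / 2)).
  assert (M0 : 0 < Rmin (dx / 2) (d / 2)) by (apply Rmin_pos; lra).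
  assert (M1 : Rmin (dx / 2) (d / 2) <= dx / 2) by apply Rmin_l.
  assert (M2 : Rmin (dx / 2) (d / 2) <= d / 2) by apply Rmin_r.
  assert (e0 : 0 < e) by (apply Rmin_pos; lra).
  assert (e1 : e <= (Smax - r) / 2) by apply Rmin_l.
  assert (e2 : e <= Rmin (dx / 2) (d / 2) / 2) by apply Rmin_r.
  pose proof (hamiltonian_orbit_exists (r + e) ltac:(lra) ltac:(lra)) as PO.
  assert (SS : same_set (radial_orbit X (fun _ => r + e)) G).
  { apply Hd; auto. intros q [th ->]. exists (X (r * cos th), - (r * sin th)).
    split; [apply GR; now exists th|].
    unfold dist2. simpl fst; simpl snd.
    assert (B1 : Rabs (X (r * cos th) - X ((r + e) * cos th)) < d / 2).
    { apply Hdx.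
      - apply Rabs_le_between. eapply Rle_trans; [apply abs_mult_cos|]. unfold rr. rewrite Rabs_right; lra.
      - apply Rabs_le_between. eapply Rle_trans; [apply abs_mult_cos|]. unfold rr. rewrite Rabs_right; lra.
      - rewrite <- Rmult_minus_distr_r. eapply Rle_lt_trans; [apply abs_mult_cos|].
        replace (r - (r + e)) with (- e) by ring. rewrite Rabs_Ropp, Rabs_right; lra. }
    assert (B2 : Rabs (- (r * sin th) - - ((r + e) * sin th)) < d / 2).
    { replace (- (r * sin th) - - ((r + e) * sin th)) with (e * sin th) by ring.
      rewrite Rabs_mult, (Rabs_right e) by lra. pose proof (SIN_bound th).
      assert (Rabs (sin th) <= 1) by (apply Rabs_le; lra). nra. }
    rewrite <- (sqrt_pow2 d) by lra. apply sqrt_lt_1_alt.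
    rewrite <- (pow2_abs (X _ - _)), <- (pow2_abs (- _ - _)).
    set (a := Rabs (X (r * cos th) - X ((r + e) * cos th))) in *.
    set (b := Rabs (- (r * sin th) - - ((r + e) * sin th))) in *.
    assert (0 <= a) by apply Rabs_pos. assert (0 <= b) by apply Rabs_pos. nra. }
  assert (Q : G (X (r + e), 0)).
  { apply SS. exists 0. rewrite cos_0, sin_0. f_equal; [f_equal|]; ring. }
  apply GR in Q. destruct Q as [th Q]. injection Q as Q _.
  apply (f_equal (sg beta m l)) in Q.
  pose proof (COS_bound th).
  assert (A1 : Rabs (r + e) < Smax) by (apply Rabs_def1; lra).
  assert (A2 : Rabs (r * cos th) < Smax).
  { eapply Rle_lt_trans; [apply abs_mult_cos|]. rewrite Rabs_right; lra. }
  rewrite (proj1 (proj2 (HX _ A1))), (proj1 (proj2 (HX _ A2))) in Q. nra.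
Qed.

End Normal.

(** * Transport to the normal form *)

(* Preimages under the inverse of the isometry [(u, y) |-> (sigma * u + d, sigma * y)], where
   [sigma = 1] or [sigma = -1]. *)
Definition push_rhs (sigma d : R) (F : R -> R -> R) (x y : R) : R :=
  sigma * F (sigma * (x - d)) (sigma * y).
Definition push_set (sigma d : R) (G : pset) : pset :=
  fun q => G (sigma * (fst q - d), sigma * snd q).

Lemma periodic_orbit_push sigma d F G : sigma = 1 \/ sigma = -1 ->
  periodic_orbit F G -> periodic_orbit (push_rhs sigma d F) (push_set sigma d G).
Proof.
  intros Hs [u [y [[Hsol [[T [HT Hp]] [t0 Hn]]] HG]]].
  assert (S2 : forall v, sigma * (sigma * v) = v) by (intros v; destruct Hs; subst; ring).
  assert (Back : forall v, sigma * (sigma * v + d - d) = v) by (intros v; destruct Hs; subst; ring).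
  exists (fun t => sigma * u t + d), (fun t => sigma * y t). split; [split; [|split]|].
  - intros t. destruct (Hsol t) as [D1 D2]. split.
    + apply (is_derive_eq _ _ ((0 * u t + sigma * y t) + 0)); [|ring].
      apply is_derive_Rplus; [|apply is_derive_Rconst].
      apply is_derive_Rmult; auto. apply is_derive_Rconst.
    + apply (is_derive_eq _ _ (0 * y t + sigma * F (u t) (y t))).
      * apply is_derive_Rmult; auto. apply is_derive_Rconst.
      * unfold push_rhs. rewrite Back, S2. ring.
  - exists T. split; auto. intros t. destruct (Hp t) as [-> ->]. auto.
  - exists t0. intros Q. injection Q as Q1 Q2. apply Hn.
    f_equal; [rewrite <- (Back (u t0)), Q1, Back | rewrite <- (S2 (y t0)), Q2, S2]; auto.
  - intros [q1 q2]. unfold push_set. rewrite (HG _). split; intros [t Q]; exists t; simpl in *.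
    + injection Q as Q1 Q2. rewrite <- Q1, <- Q2, !S2. f_equal. ring.
    + injection Q as Q1 Q2. rewrite Q1, Q2, Back, S2. auto.
Qed.

(** The inverse of the isometry belongs to the same family, with offset [- (sigma * d)], because
    [sigma ^ 2 = 1]. *)
Lemma periodic_orbit_pull sigma d F G : sigma = 1 \/ sigma = -1 ->
  periodic_orbit (push_rhs sigma d F) G ->
  periodic_orbit F (fun p => G (sigma * fst p + d, sigma * snd p)).
Proof.
  intros Hs H. apply (periodic_orbit_push sigma (- (sigma * d)) _ _ Hs) in H.
  apply (periodic_orbit_ext _ F) in H.
  - destruct H as [u [y [H1 H2]]]. exists u, y. split; auto.
    intros p. rewrite <- (H2 p). unfold push_set.
    replace (sigma * (fst p - - (sigma * d))) with (sigma * fst p + d); [tauto|].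
    destruct Hs; subst; ring.
  - intros a b. unfold push_rhs. destruct Hs; subst.
    + replace (1 * (1 * (a - - (1 * d)) - d)) with a by ring.
      replace (1 * (1 * b)) with b by ring. ring.
    + replace (-1 * (-1 * (a - - (-1 * d)) - d)) with a by ring.
      replace (-1 * (-1 * b)) with b by ring. ring.
Qed.

Lemma limit_cycle_push sigma d F G : sigma = 1 \/ sigma = -1 ->
  limit_cycle F G -> limit_cycle (push_rhs sigma d F) (push_set sigma d G).
Proof.
  intros Hs [HG [e [Pe He]]]. split; [now apply periodic_orbit_push|].
  assert (S2 : forall v, sigma * (sigma * v) = v) by (intros v; destruct Hs; subst; ring).
  assert (Back : forall v, sigma * (sigma * v + d - d) = v) by (intros v; destruct Hs; subst; ring).
  assert (Forth : forall v, sigma * (sigma * (v - d)) + d = v) by (intros v; destruct Hs; subst; ring).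
  exists e. split; auto. intros G' PG' Hnear.
  pose proof (periodic_orbit_pull sigma d F G' Hs PG') as P.
  assert (Q : same_set (fun p => G' (sigma * fst p + d, sigma * snd p)) G).
  { apply He; auto. intros q Hq. destruct (Hnear _ Hq) as [p [Hp Hd]].
    exists (sigma * (fst p - d), sigma * snd p). split; auto.
    unfold dist2 in *. simpl in *.
    match type of Hd with sqrt ?a < _ => match goal with |- sqrt ?b < _ => replace b with a; auto end end.
    destruct Hs; subst; ring. }
  intros [q1 q2]. unfold push_set. rewrite <- (Q _). simpl. rewrite Forth, S2. tauto.
Qed.

Lemma compact2_push sigma d K : sigma = 1 \/ sigma = -1 ->
  compact2 K -> compact2 (push_set sigma d K).
Proof.
  intros Hs [[M HM] Hcl]. split.
  - exists (M + Rabs d). intros [q1 q2] Hq. destruct (HM _ Hq) as [B1 B2]. simpl in *.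
    pose proof (Rabs_pos d).
    assert (A : forall v, Rabs (sigma * v) = Rabs v).
    { intros v. destruct Hs; subst; rewrite Rabs_mult; [rewrite Rabs_R1|rewrite (Rabs_left (-1)) by lra]; ring. }
    rewrite A in B1, B2. split; [|lra].
    replace q1 with ((q1 - d) + d) by ring. eapply Rle_trans; [apply Rabs_triang|]. lra.
  - intros s p Hk L1 L2.
    apply (Hcl (fun n => (sigma * (fst (s n) - d), sigma * snd (s n)))); auto; simpl.
    + apply (Un_cv_continuous (fun v => sigma * (v - d))); auto.
      apply (ex_derive_continuous (V := R_NormedModule)). auto_derive; auto.
    + apply (Un_cv_continuous (fun v => sigma * v)); auto.
      apply (ex_derive_continuous (V := R_NormedModule)). auto_derive; auto.
Qed.

Lemma push_set_inj sigma d A B : sigma = 1 \/ sigma = -1 ->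
  same_set (push_set sigma d A) (push_set sigma d B) -> same_set A B.
Proof.
  intros Hs H p. specialize (H (sigma * fst p + d, sigma * snd p)). unfold push_set in H. simpl in H.
  replace (sigma * (sigma * fst p + d - d)) with (fst p) in H by (destruct Hs; subst; ring).
  replace (sigma * (sigma * snd p)) with (snd p) in H by (destruct Hs; subst; ring).
  now destruct p.
Qed.

(** [b] absorbs the constant that the change of variable puts in front of [R0], namely [(-1) ^ n]
    under a reflection; being nonzero, it preserves the distinction between a Hamiltonian and a
    genuinely perturbed system. *)
Lemma at_most_one_of_normal_form (n : nat) (beta u0 k m l sigma d b : R) (R0 R0' : R -> R) :
  0 < beta -> 0 < m -> m <= l -> sigma = 1 \/ sigma = -1 -> b <> 0 ->
  (forall x, is_derive R0 x (R0' x)) -> (forall x, continuous R0' x) ->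
  (forall X, (forall s, Rabs s < sg beta m l m ->
     - l < X s < m /\ sg beta m l (X s) = s /\ is_derive X s (/ om beta m l (X s))) ->
     strict_incr beta m l (chord X (fun s => om beta m l (X s)) R0)) ->
  (forall alpha0 alphan eps x y,
     push_rhs sigma d (pert_rhs n beta u0 k alpha0 alphan eps) x y
     = norm_rhs beta m l (fun x => alpha0 + alphan * b * R0 x) eps x y) ->
  forall (alpha0 alphan : R) (K : pset), compact2 K -> subset K (period_annulus n beta u0 k) ->
    exists eps0, 0 < eps0 /\
      forall eps, 0 < eps < eps0 ->
        forall G1 G2 : pset,
          limit_cycle (pert_rhs n beta u0 k alpha0 alphan eps) G1 ->
          limit_cycle (pert_rhs n beta u0 k alpha0 alphan eps) G2 ->
          subset G1 K -> subset G2 K -> same_set G1 G2.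
Proof.
  intros Hb Hm Hl Hs Nb DR CR Hinc Hrhs alpha0 alphan K HK Hsub.
  destruct (chart_exists beta m l Hb Hm Hl) as [X [HX HX']].
  destruct (classic (alpha0 = 0 /\ alphan = 0)) as [[-> ->]|Hal].
  - exists 1. split; [lra|]. intros eps _ G1 G2 L1 _ _ _. exfalso.
    apply (limit_cycle_push sigma d _ _ Hs) in L1.
    apply (no_hamiltonian_limit_cycle beta m l Hb Hm Hl X HX HX' (push_set sigma d G1)).
    assert (E : forall u y, push_rhs sigma d (pert_rhs n beta u0 k 0 0 eps) u y = ham_rhs beta m l u y).
    { intros u y. rewrite Hrhs. unfold norm_rhs, ham_rhs. ring. }
    destruct L1 as [P1 [e [Pe He]]]. split; [now apply (periodic_orbit_ext _ _ _ E)|].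
    exists e. split; auto. intros G' PG'. apply He.
    apply (periodic_orbit_ext (ham_rhs beta m l)); auto.
  - destruct (unique_periodic_orbit beta m l Hb Hm Hl X HX HX' R0 R0' alpha0 (alphan * b) (push_set sigma d K))
      as [eps0 [P0 He]]; auto.
    + intros [A B]. apply Hal. split; auto. apply Rmult_integral in B. tauto.
    + now apply compact2_push.
    + intros p Kp. destruct (Hsub _ Kp) as [G [PG Gp]].
      exists (push_set sigma d G). split; [|exact Gp].
      apply (periodic_orbit_push sigma d _ _ Hs) in PG.
      apply (periodic_orbit_ext _ (ham_rhs beta m l)) in PG; auto.
      intros u y. rewrite Hrhs. unfold norm_rhs, ham_rhs. ring.
    + exists eps0. split; auto. intros eps Heps G1 G2 [P1 _] [P2 _] S1 S2.
      apply (push_set_inj sigma d); auto. apply (He eps Heps).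
      * apply (periodic_orbit_ext _ _ _ (Hrhs alpha0 alphan eps)). now apply periodic_orbit_push.
      * apply (periodic_orbit_ext _ _ _ (Hrhs alpha0 alphan eps)). now apply periodic_orbit_push.
      * intros q. apply S1. * intros q. apply S2.
Qed.

Lemma pow_derive n x : is_derive (fun x => x ^ n) x (INR n * x ^ pred n).
Proof. apply is_derive_Reals, derivable_pt_lim_pow. Qed.

Lemma continuous_pow_scal n c x : continuous (fun x => c * x ^ n) x.
Proof. apply (ex_derive_continuous (V := R_NormedModule)). auto_derive; auto. Qed.

(** Bifurcation from the open annulus is expressed through a compact [K] inside it: [eps0] may
    depend on [K], as the estimates degenerate towards the center and the outer boundary. *)
Theorem theorem3p1 :
  forall (n : nat) (beta u0 k alpha0 alphan : R),
    (2 <= n)%nat -> 0 < beta -> theorem_cases n u0 k ->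
    forall K : pset, compact2 K -> subset K (period_annulus n beta u0 k) ->
    exists eps0, 0 < eps0 /\
      forall eps, 0 < eps < eps0 ->
        forall G1 G2 : pset,
          limit_cycle (pert_rhs n beta u0 k alpha0 alphan eps) G1 ->
          limit_cycle (pert_rhs n beta u0 k alpha0 alphan eps) G2 ->
          subset G1 K -> subset G2 K -> same_set G1 G2.
Proof.
  intros n beta u0 k alpha0 alphan Hn Hb Hcases.
  destruct Hcases as [[H1 [H2 H3]]|[[H1 H2]|[[H1 H2]|[H1 [H2 H3]]]]].
  (* Case (i): the center [u0] is moved to [0] and the saddles [k] and [0] to [k - u0] and [- u0];
     [k <= 2 * u0] is [m <= l]. The damping [u ^ n] becomes [(l + x) ^ n]. *)
  - apply (at_most_one_of_normal_form n beta u0 k (k - u0) u0 1 (- u0) 1 (fun x => (u0 + x) ^ n)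
      (fun x => INR n * (u0 + x) ^ pred n)); auto; try lra.
    + intros x. apply (is_derive_eq _ _ (INR n * (u0 + x) ^ pred n * 1)); [|ring].
      apply (is_derive_Rcomp (fun x => x ^ n) (fun x => u0 + x)); [apply pow_derive|auto_derive; auto].
    + intros x. apply (ex_derive_continuous (V := R_NormedModule)). auto_derive; auto.
    + intros X HX. apply chord_shift_strict_incr; auto; lra.
    + intros al0 aln eps x y. unfold push_rhs, pert_rhs, norm_rhs, cub.
      replace (1 * (x - - u0)) with (u0 + x) by ring. ring.
  (* Case (ii): the nearer saddle [u0] is on the left, so the axis is reflected, at the cost of the
     factor [(-1) ^ n]. *)
  - apply (at_most_one_of_normal_form n beta u0 k (- u0) k (-1) 0 ((-1) ^ n) (fun x => x ^ n)
      (fun x => INR n * x ^ pred n)); auto using pow_derive, continuous_pow_scal; try lra.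
    + apply pow_nonzero; lra.
    + intros X HX. apply chord_pow_strict_incr; auto; try lra; left; lra.
    + intros al0 aln eps x y. unfold push_rhs, pert_rhs, norm_rhs, cub.
      rewrite Rpow_mult_distr, Rminus_0_r. ring.
  (* Case (iii): the nearer saddle [k] is already on the right, and [m < l] strictly. *)
  - apply (at_most_one_of_normal_form n beta u0 k k (- u0) 1 0 1 (fun x => x ^ n)
      (fun x => INR n * x ^ pred n)); auto using pow_derive, continuous_pow_scal; try lra.
    + intros X HX. apply chord_pow_strict_incr; auto; try lra; left; lra.
    + intros al0 aln eps x y. unfold push_rhs, pert_rhs, norm_rhs, cub.
      rewrite Rminus_0_r, !Rmult_1_l. ring.
  (* Case (iv): the saddles are symmetric, [m = l], and strict growth of the chord relies on the
     parity of [n]. *)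
  - apply (at_most_one_of_normal_form n beta u0 k k k 1 0 1 (fun x => x ^ n)
      (fun x => INR n * x ^ pred n)); auto using pow_derive, continuous_pow_scal; try lra.
    + intros X HX. apply chord_pow_strict_incr; auto; lra.
    + intros al0 aln eps x y. unfold push_rhs, pert_rhs, norm_rhs, cub. subst u0.
      rewrite Rminus_0_r, !Rmult_1_l. ring.
Qed.
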